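(* Let $\Lambda$ be an aperiodic strongly connected (row-finite, source-free) $k$-graph with finitely many vertices such that $\Lambda^\infty$ is a Cantor space. Let $\Lambda_{\mathrm{ht}}$ be the Higman-Thompson like group of $\mathcal{O}_\Lambda$ and $\Lambda_{\mathrm{ht}}'$ its commutator subgroup. (i) If $N$ is a nontrivial normal subgroup of $\Lambda_{\mathrm{ht}}$, then $\Lambda_{\mathrm{ht}}'\subseteq N$. In particular, $\Lambda_{\mathrm{ht}}'$ is simple. (ii) The only nontrivial uniformly recurrent subgroup (URS) of $\Lambda_{\mathrm{ht}}'$ is the stabilizer URS $\mathcal{S}_{\Lambda_{\mathrm{ht}}'}(\Lambda^\infty)$ of the action of $\Lambda_{\mathrm{ht}}'$ on $\Lambda^\infty$.
   Context: **$k$-graphs.** $\mathbb{N}$ includes $0$ and $k\ge 1$. A $k$-graph is a countable small category $\Lambda$ with a functor $d:\Lambda\to\mathbb{N}^k$ such that whenever $d(\mu)=n+m$ there are unique $\alpha,\beta\in\Lambda$ with $\mu=\alpha\beta$, $d(\alpha)=n$, $d(\beta)=m$, $s(\alpha)=r(\beta)$ (products $\mu\nu$ are defined when $s(\mu)=r(\nu)$). $\Lambda^n:=d^{-1}(n)$; $\Lambda^0$ is the set of vertices; $v\Lambda^n:=\{\mu\in\Lambda^n: r(\mu)=v\}$. $\Lambda$ is row-finite if all $|v\Lambda^n|<\infty$, source-free if all $v\Lambda^n\neq\varnothing$, and strongly connected if for all $v,w\in\Lambda^0$ there is $\lambda\in\Lambda$ with $r(\lambda)=v$, $s(\lambda)=w$.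 **Infinite paths.** $\Omega_k:=\{(p,q)\in\mathbb{N}^k\times\mathbb{N}^k: p\le q\}$ is a $k$-graph with $(p,q)(q,m)=(p,m)$, $r(p,q)=(p,p)$, $s(p,q)=(q,q)$, $d(p,q)=q-p$. $\Lambda^\infty$ is the set of degree-preserving functors $x:\Omega_k\to\Lambda$; $v\Lambda^\infty:=\{x\in\Lambda^\infty:x(0,0)=v\}$. If $s(\mu)=x(0,0)$, $\mu x$ is the infinite path obtained by prefixing $\mu$ to $x$. $Z(\mu):=\{\mu x: x\in s(\mu)\Lambda^\infty\}$, and the sets $Z(\mu)$ form a basis of the topology of $\Lambda^\infty$. A Cantor space is a compact, metrizable, totally disconnected space with no isolated points. $\Lambda$ is aperiodic if for each $v\in\Lambda^0$ there is $x\in v\Lambda^\infty$ with $\sigma^m(x)\ne\sigma^n(x)$ for all $m\neq n$ in $\mathbb{N}^k$, where $\sigma^n(x)(p,q)=x(p+n,q+n)$. **The C*-algebra and $\Lambda_{\mathrm{ht}}$.** $\mathcal{O}_\Lambda$ is the universal C*-algebra generated by partial isometries $\{s_\mu\}_{\mu\in\Lambda}$ such that: $\{s_v\}_{v\in\Lambda^0}$ are mutually orthogonal projections; $s_{\mu\nu}=s_\mu s_\nu$ if $s(\mu)=r(\nu)$; $s_\mu^*s_\mu=s_{s(\mu)}$; $s_v=\sum_{\mu\in v\Lambda^n}s_\mu s_\mu^*$ for all $v\in\Lambda^0$, $n\in\mathbb{N}^k$. It is unital since $\Lambda^0$ is finite. $\Lambda_{\mathrm{ht}}$ is the group (under multiplication)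 of all unitaries $U\in\mathcal{O}_\Lambda$ which can be written as a finite sum $U=\sum_{i=1}^n s_{\alpha_i}s_{\beta_i}^*$ with $\alpha_i,\beta_i\in\Lambda$, $s(\alpha_i)=s(\beta_i)$. **Action.** For such $U$, the sets $Z(\beta_i)$ partition $\Lambda^\infty$, as do the sets $Z(\alpha_i)$. $\Lambda_{\mathrm{ht}}$ acts on $\Lambda^\infty$ by homeomorphisms via $\phi(U)(\beta_iy)=\alpha_iy$ for $y\in s(\beta_i)\Lambda^\infty$ (the action induced by the left regular representation on $\ell^2(\Lambda^\infty)$); it is faithful when $\Lambda$ is aperiodic. $\Lambda_{\mathrm{ht}}'$ acts by restriction. **URS.** For a countable group $G$, $\mathrm{Sub}(G)\subseteq\{0,1\}^G$ is the compact space of subgroups of $G$ (product topology), with $G$ acting by conjugation. A URS of $G$ is a nonempty closed minimal $G$-invariant subset of $\mathrm{Sub}(G)$; it is nontrivial if it is neither $\{\{1\}\}$ nor $\{G\}$. For a faithful minimal action of $G$ by homeomorphisms on a compact space $X$, the stabilizer URS $\mathcal{S}_G(X)$ is the unique URS contained in the closure of $\{G_x:x\in X\}$ in $\mathrm{Sub}(G)$, where $G_x$ is the stabilizer of $x$. *)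

(* Defs.v *)
From HB Require Import structures.
From mathcomp Require Import all_boot all_order all_algebra.
From mathcomp Require Import complex.
From mathcomp Require Import all_classical all_reals all_analysis.

Set Implicit Arguments.
Unset Strict Implicit.
Unset Printing Implicit Defensive.

Import Order.TTheory GRing.Theory Num.Theory.
Import numFieldNormedType.Exports.

Local Open Scope classical_set_scope.
Local Open Scope ring_scope.

Notation degree k := {ffun 'I_k -> nat}.

Definition le_deg k (p q : degree k) : bool := [forall i, (p i <= q i)%N].
Definition sub_deg k (q p : degree k) : degree k := [ffun i => (q i - p i)%N].

(** Composition is a total function, but only its values on composable pairs
    ([src m = rng n]) are constrained or used. *)
Record kgraph (k : nat) := KGraph {
  vertex : countType;
  mor : countType;
  rng : mor -> vertex;
  src : mor -> vertex;
  idm : vertex -> mor;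
  comp : mor -> mor -> mor;
  deg : mor -> degree k;
  rng_idm : forall v, rng (idm v) = v;
  src_idm : forall v, src (idm v) = v;
  rng_comp : forall m n, src m = rng n -> rng (comp m n) = rng m;
  src_comp : forall m n, src m = rng n -> src (comp m n) = src n;
  comp_idl : forall m, comp (idm (rng m)) m = m;
  comp_idr : forall m, comp m (idm (src m)) = m;
  compA : forall l m n, src l = rng m -> src m = rng n ->
    comp l (comp m n) = comp (comp l m) n;
  deg_idm : forall v, deg (idm v) = 0;
  deg_comp : forall m n, src m = rng n -> deg (comp m n) = deg m + deg n;
  factorization : forall (l : mor) (n m : degree k), deg l = n + m ->
    exists! ab : mor * mor,
      [/\ l = comp ab.1 ab.2, deg ab.1 = n, deg ab.2 = m & src ab.1 = rng ab.2]
}.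

Arguments rng {k} {_}.
Arguments src {k} {_}.
Arguments idm {k} {_}.
Arguments comp {k} {_}.
Arguments deg {k} {_}.

Section KGraphProperties.
Context {k : nat} (L : kgraph k).

Definition paths_from (v : vertex L) (n : degree k) : set (mor L) :=
  [set m | rng m = v /\ deg m = n].

Definition row_finite := forall v n, finite_set (paths_from v n).
Definition source_free := forall v n, paths_from v n !=set0.
Definition strongly_connected :=
  forall v w : vertex L, exists l : mor L, rng l = v /\ src l = w.

End KGraphProperties.

Section Omega.
Context (k : nat).

Definition omega_mor : Type :=
  {pq : degree k * degree k | le_deg pq.1 pq.2}.
HB.instance Definition _ := Countable.on omega_mor.

Lemma le_degP (p q : degree k) : reflect (forall i, p i <= q i)%N (le_deg p q).
Proof. exact: forallP. Qed.

Lemma le_deg_refl (p : degree k) : le_deg p p.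
Proof. by apply/le_degP. Qed.

Lemma le_deg_trans (q p r : degree k) :
  le_deg p q -> le_deg q r -> le_deg p r.
Proof.
move=> /le_degP pq /le_degP qr; apply/le_degP => i.
exact: leq_trans (pq i) (qr i).
Qed.

Lemma le_deg_add2r (n p q : degree k) : le_deg p q -> le_deg (p + n) (q + n).
Proof.
move=> /le_degP pq; apply/le_degP => i; rewrite !ffunE.
by rewrite (leq_add2r (n i) (p i) (q i)).
Qed.

Lemma le_deg_addr (p n : degree k) : le_deg p (p + n).
Proof. by apply/le_degP => i; rewrite ffunE; exact: leq_addr. Qed.

Lemma le0_deg (p : degree k) : le_deg 0 p.
Proof. by apply/le_degP => i; rewrite ffunE. Qed.

Lemma sub_degK (p q : degree k) : le_deg p q -> p + sub_deg q p = q.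
Proof.
move=> /le_degP pq; apply/ffunP => i; rewrite !ffunE -[LHS]/(_ + _)%N.
by rewrite subnKC.
Qed.

Definition om (p q : degree k) (pq : le_deg p q) : omega_mor :=
  exist (fun pq => le_deg pq.1 pq.2) (p, q) pq.

Definition omega_rng (a : omega_mor) : degree k := (val a).1.
Definition omega_src (a : omega_mor) : degree k := (val a).2.
Definition omega_id (p : degree k) : omega_mor := om (le_deg_refl p).
Definition omega_deg (a : omega_mor) : degree k :=
  sub_deg (omega_src a) (omega_rng a).
Definition omega_comp (a b : omega_mor) : omega_mor :=
  insubd a (omega_rng a, omega_src b).

Lemma omega_compE a b : omega_src a = omega_rng b ->
  val (omega_comp a b) = (omega_rng a, omega_src b).
Proof.
move=> ab; rewrite /omega_comp val_insubd /=.
case: a b ab => [[p q] /= pq] [[q' r] /= qr] ab.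
rewrite /omega_src /omega_rng /= in ab *; rewrite -ab in qr.
by rewrite (le_deg_trans pq qr).
Qed.

Let rng_id p : omega_rng (omega_id p) = p. Proof. by []. Qed.
Let src_id p : omega_src (omega_id p) = p. Proof. by []. Qed.
Let rng_co a b : omega_src a = omega_rng b ->
  omega_rng (omega_comp a b) = omega_rng a.
Proof. by move=> ab; rewrite /omega_rng omega_compE. Qed.
Let src_co a b : omega_src a = omega_rng b ->
  omega_src (omega_comp a b) = omega_src b.
Proof. by move=> ab; rewrite /omega_src omega_compE. Qed.
Let idl a : omega_comp (omega_id (omega_rng a)) a = a.
Proof. by apply: val_inj; rewrite omega_compE //; case: (a) => -[]. Qed.
Let idr a : omega_comp a (omega_id (omega_src a)) = a.
Proof. by apply: val_inj; rewrite omega_compE //; case: (a) => -[]. Qed.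
Let coA a b c : omega_src a = omega_rng b -> omega_src b = omega_rng c ->
  omega_comp a (omega_comp b c) = omega_comp (omega_comp a b) c.
Proof.
move=> ab bc; apply: val_inj.
by rewrite !omega_compE ?rng_co ?src_co.
Qed.
Let deg_id p : omega_deg (omega_id p) = 0.
Proof. by apply/ffunP => i; rewrite !ffunE subnn. Qed.
Let deg_co a b : omega_src a = omega_rng b ->
  omega_deg (omega_comp a b) = omega_deg a + omega_deg b.
Proof.
move=> ab; rewrite /omega_deg src_co // rng_co //.
case: a b ab => [[p q] /= pq] [[q' r] /= qr].
rewrite /omega_src /omega_rng /= => ab; subst q'.
apply/ffunP => i; rewrite !ffunE.
have /le_degP/(_ i) := pq; have /le_degP/(_ i) := qr => /= h1 h2.
by rewrite -[RHS]/(_ + _)%N addnC addnBA // subnK.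
Qed.
Let fact (l : omega_mor) (n m : degree k) : omega_deg l = n + m ->
  exists! ab : omega_mor * omega_mor,
    [/\ l = omega_comp ab.1 ab.2, omega_deg ab.1 = n, omega_deg ab.2 = m
      & omega_src ab.1 = omega_rng ab.2].
Proof.
case: l => [[p q] pq]; rewrite /omega_deg /omega_src /omega_rng /= in pq * => e.
have qE : q = (p + n) + m by rewrite -addrA -e sub_degK.
have pnq : le_deg (p + n) q by rewrite qE le_deg_addr.
have subK (a b : degree k) : sub_deg (a + b) a = b.
  by apply/ffunP => i; rewrite !ffunE -[(_ + _)]/(_ + _)%N addnC addnK.
exists (om (le_deg_addr p n), om pnq); split=> /=.
  split => //; last by rewrite qE subK.
  by apply: val_inj; rewrite omega_compE.
case=> [[[a b] /= ab] [[c d] /= cd]] [] /(congr1 val).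
move=> H an cm bc; move: H; rewrite omega_compE //.
rewrite /omega_src /omega_rng /= in bc *; case=> pa qd; subst c d a.
have bE : b = p + n by rewrite -an sub_degK.
by subst b; congr (_, _); apply: val_inj.
Qed.

Definition Omega : kgraph k :=
  KGraph rng_id src_id rng_co src_co idl idr coA deg_id deg_co fact.

End Omega.

Record kgraph_functor k (G L : kgraph k) := KGraphFunctor {
  fobj : vertex G -> vertex L;
  fmor : mor G -> mor L;
  fmor_rng : forall a, rng (fmor a) = fobj (rng a);
  fmor_src : forall a, src (fmor a) = fobj (src a);
  fmor_idm : forall v, fmor (idm v) = idm (fobj v);
  fmor_comp : forall a b, src a = rng b ->
    fmor (comp a b) = comp (fmor a) (fmor b);
  fmor_deg : forall a, deg (fmor a) = deg a
}.

Lemma kgraph_functor_eq k (G L : kgraph k) (x y : kgraph_functor G L) :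
  fmor x =1 fmor y -> x = y.
Proof.
move=> xy; have xy' : fobj x =1 fobj y.
  by move=> v; rewrite -[v]rng_idm -!fmor_rng xy.
case: x y xy xy' => [ob m x1 x2 x3 x4 x5] [ob' m' y1 y2 y3 y4 y5] /=.
move=> me oe; have {}me : m = m' := funext me; have {}oe : ob = ob' := funext oe.
subst ob' m'.
by congr KGraphFunctor; exact: Prop_irrelevance.
Qed.

Section InfinitePaths.
Context {k : nat} (L : kgraph k).

Definition infpath : Type := kgraph_functor (Omega k) L.

HB.instance Definition _ := gen_eqMixin infpath.
HB.instance Definition _ := gen_choiceMixin infpath.

(** [start x] is the vertex x(0,0), and [segment x pq] is x(p,q). *)
Definition start (x : infpath) : vertex L := fobj x 0.
Definition segment (x : infpath) (p q : degree k) (pq : le_deg p q) : mor L :=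
  fmor x (om pq).

Section Shift.
Context (n : degree k) (x : infpath).

Let sobj (p : degree k) : vertex L := fobj x (p + n).
Let smor (a : omega_mor k) : mor L :=
  segment x (le_deg_add2r n (valP a)).

Let smor_rng (a : omega_mor k) : rng (smor a) = sobj (omega_rng a).
Proof. exact: fmor_rng. Qed.
Let smor_src (a : omega_mor k) : src (smor a) = sobj (omega_src a).
Proof. exact: fmor_src. Qed.
Let smor_id (p : degree k) : smor (omega_id p) = idm (sobj p).
Proof. by rewrite -fmor_idm; congr fmor; apply: val_inj. Qed.
Let smor_comp (a b : omega_mor k) : omega_src a = omega_rng b ->
  smor (omega_comp a b) = comp (smor a) (smor b).
Proof.
move=> ab; have ab' : omega_src (om (le_deg_add2r n (valP a))) =
    omega_rng (om (le_deg_add2r n (valP b))) by congr (_ + _); exact: ab.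
rewrite -fmor_comp //; congr fmor; apply: val_inj.
by rewrite [RHS]omega_compE //= /omega_rng /omega_src /= omega_compE.
Qed.
Let smor_deg (a : omega_mor k) : deg (smor a) = omega_deg a.
Proof.
rewrite /smor /segment fmor_deg; apply/ffunP => i.
by rewrite [LHS]ffunE [RHS]ffunE [X in (X - _)%N]ffunE [X in (_ - X)%N]ffunE subnDr.
Qed.

Definition shift : infpath :=
  @KGraphFunctor k (Omega k) L sobj smor
    smor_rng smor_src smor_id smor_comp smor_deg.

End Shift.

(** [prefixed m x y]: the infinite path m x is defined and equal to y, i.e. y
    is the path with y(0, d(m)) = m and sigma^{d(m)}(y) = x. *)
Definition prefixed (m : mor L) (x y : infpath) : Prop :=
  [/\ src m = start x, segment y (le0_deg (deg m)) = m & shift (deg m) y = x].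

Definition cylinder (m : mor L) : set infpath :=
  [set y | exists2 x, start x = src m & prefixed m x y].

Lemma cylinderE m (y : infpath) :
  cylinder m y <-> segment y (le0_deg (deg m)) = m.
Proof.
split=> [[x _ []]//|ym]; exists (shift (deg m) y); last split => //.
  rewrite -[in RHS]ym /segment fmor_src /start /= add0r //.
by rewrite -[in LHS]ym /segment fmor_src /start /= add0r.
Qed.

Lemma segment_deg (x : infpath) p : deg (segment x (le0_deg p)) = p.
Proof. by rewrite fmor_deg; apply/ffunP => i; rewrite !ffunE subn0. Qed.

Lemma segment_eq (x y : infpath) (p q : degree k) : le_deg p q ->
  segment x (le0_deg q) = segment y (le0_deg q) ->
  segment x (le0_deg p) = segment y (le0_deg p).
Proof.
move=> pq xy.
have cE (z : infpath) : segment z (le0_deg q) =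
    comp (segment z (le0_deg p)) (segment z pq).
  rewrite /segment -fmor_comp //; congr fmor; apply: val_inj.
  by rewrite /= omega_compE.
have dE : deg (segment x (le0_deg q)) = p + sub_deg q p.
  by rewrite segment_deg sub_degK.
have [ab [_ abU]] := factorization dE.
have h (z : infpath) : segment z (le0_deg q) = segment x (le0_deg q) ->
    ab = (segment z (le0_deg p), segment z pq).
  move=> zx; apply: abU => /=; split.
  - by rewrite -zx cE.
  - exact: segment_deg.
  - by rewrite /segment fmor_deg.
  - by rewrite /segment fmor_src fmor_rng.
by have := h x erefl; rewrite (h y (esym xy)) => -[].
Qed.

Lemma cylinder_cover :
  \bigcup_(Z in range cylinder) Z = [set: infpath].
Proof.
rewrite -subTset => x _; exists (cylinder (segment x (le0_deg 0))).
  by exists (segment x (le0_deg 0)).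
by apply/cylinderE; rewrite segment_deg.
Qed.

Lemma cylinder_join (A B : set infpath) (x : infpath) :
  range cylinder A -> range cylinder B -> A x -> B x ->
  exists C, [/\ range cylinder C, C x & C `<=` A `&` B].
Proof.
move=> [a _ <-] [b _ <-] /cylinderE xa /cylinderE xb.
pose q := deg a + deg b; pose c := segment x (le0_deg q).
have cq : deg c = q := segment_deg x q.
exists (cylinder c); split; first by exists c.
  by apply/cylinderE; rewrite cq.
move=> y /cylinderE; rewrite cq => yc; split; apply/cylinderE.
  by rewrite -[RHS]xa; apply: segment_eq yc; exact: le_deg_addr.
by rewrite -[RHS]xb; apply: segment_eq yc; rewrite /q addrC le_deg_addr.
Qed.

HB.instance Definition _ := @isBaseTopological.Build infpath
  (set infpath) (range cylinder) id cylinder_cover cylinder_join.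

Definition aperiodic := forall v : vertex L, exists2 x : infpath, start x = v &
  forall m n : degree k, m <> n -> shift m x <> shift n x.

End InfinitePaths.

Definition metrizable (R : realType) (T : topologicalType) := exists d : T -> T -> R,
  [/\ forall x y, d x y = 0 <-> x = y,
      forall x y, d x y = d y x,
      forall x y z, d x z <= d x y + d y z &
      forall x (A : set T),
        nbhs x A <-> exists2 e : R, 0 < e & [set y | d x y < e] `<=` A].

(** Nonemptiness is made explicit: the other conditions also hold for the empty
    space. *)
Definition is_cantor_space (R : realType) (T : topologicalType) :=
  [/\ [set: T] !=set0, compact [set: T], metrizable R T,
      totally_disconnected [set: T] & isolated [set: T] = set0].

(** Not assumed unital. *)
Record cstar_algebra (R : realType) := CstarAlgebra {
  cs_car :> completeNormedModType R[i];
  cs_mul : cs_car -> cs_car -> cs_car;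
  cs_star : cs_car -> cs_car;
  cs_mulA : forall x y z, cs_mul x (cs_mul y z) = cs_mul (cs_mul x y) z;
  cs_mulDl : forall x y z, cs_mul (x + y) z = cs_mul x z + cs_mul y z;
  cs_mulDr : forall x y z, cs_mul x (y + z) = cs_mul x y + cs_mul x z;
  cs_mulZl : forall (a : R[i]) x y, cs_mul (a *: x) y = a *: cs_mul x y;
  cs_mulZr : forall (a : R[i]) x y, cs_mul x (a *: y) = a *: cs_mul x y;
  cs_starK : forall x, cs_star (cs_star x) = x;
  cs_starD : forall x y, cs_star (x + y) = cs_star x + cs_star y;
  cs_starZ : forall (a : R[i]) x, cs_star (a *: x) = Num.conj a *: cs_star x;
  cs_starM : forall x y, cs_star (cs_mul x y) = cs_mul (cs_star y) (cs_star x);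
  cs_normM : forall x y, `|cs_mul x y| <= `|x| * `|y|;
  cs_norm_star : forall x, `|cs_mul (cs_star x) x| = `|x| ^+ 2
}.

Record unital_cstar_algebra (R : realType) := UnitalCstarAlgebra {
  ucs_car :> cstar_algebra R;
  cs_one : ucs_car;
  cs_mul1 : forall x, cs_mul cs_one x = x;
  cs_mulr1 : forall x, cs_mul x cs_one = x
}.

Arguments cs_mul {R} {_}.
Arguments cs_star {R} {_}.
Arguments cs_one {R} {_}.

Declare Scope cstar_scope.
Delimit Scope cstar_scope with cstar.
Notation "x ** y" := (cs_mul x y) (at level 40, left associativity) : cstar_scope.
Notation "x ^†" := (cs_star x) (at level 2, format "x ^†") : cstar_scope.
Local Open Scope cstar_scope.

Definition star_hom (R : realType) (A B : cstar_algebra R)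
    (f : {linear A -> B}) : Prop :=
  (forall x y, f (x ** y) = f x ** f y) /\ (forall x, f (x^†) = (f x)^†).

(** The closed *-subalgebra generated by the range of s is the whole of A. *)
Definition cstar_generated (R : realType) (A : cstar_algebra R) (I : Type)
    (s : I -> A) : Prop :=
  forall D : set A,
    closed D -> D 0 ->
    (forall x y, D x -> D y -> D (x + y)) ->
    (forall (a : R[i]) x, D x -> D (a *: x)) ->
    (forall x y, D x -> D y -> D (x ** y)) ->
    (forall x, D x -> D (x^†)) ->
    (forall i, D (s i)) -> D = setT.

Section KGraphAlgebra.
Context {R : realType} {k : nat} (L : kgraph k).

(** The vertex projection s_v is [s (idm v)]. *)
Record is_ck_family (A : cstar_algebra R) (s : mor L -> A) : Prop := IsCKFamily {
  ck_isometry : forall m, s m ** (s m)^† ** s m = s m;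
  ck_proj : forall v, s (idm v) ** s (idm v) = s (idm v) /\
    (s (idm v))^† = s (idm v);
  ck_orth : forall v w, v <> w -> s (idm v) ** s (idm w) = 0;
  ck_comp : forall m n, src m = rng n -> s (comp m n) = s m ** s n;
  ck_src : forall m, (s m)^† ** s m = s (idm (src m));
  ck_sum : forall v n,
    s (idm v) = \sum_(m \in paths_from v n) (s m ** (s m)^†)
}.

Definition is_kgraph_algebra (A : cstar_algebra R) (s : mor L -> A) : Prop :=
  [/\ is_ck_family s, cstar_generated s &
      forall (B : cstar_algebra R) (t : mor L -> B), is_ck_family t ->
        exists2 f : {linear A -> B}, star_hom f & forall m, f (s m) = t m].

End KGraphAlgebra.

Section UnitaryGroup.
Context {R : realType} (A : unital_cstar_algebra R).

Definition is_unitary (u : A) : Prop := u^† ** u = cs_one /\ u ** u^† = cs_one.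

Definition unitary : Type := {u : A | `[< is_unitary u >]}.
HB.instance Definition _ := Choice.on unitary.
HB.instance Definition _ := SubType.on unitary.

Let star1 : (cs_one : A)^† = cs_one.
Proof. by rewrite -[LHS]cs_mul1 -[X in X ** _]cs_starK -cs_starM cs_mul1 cs_starK. Qed.

Let one_unitary : `[< is_unitary cs_one >].
Proof. by apply/asboolP; split; rewrite star1 cs_mul1. Qed.
Let mul_unitary (u v : unitary) : `[< is_unitary (val u ** val v) >].
Proof.
case: u v => [u /= /asboolP [u1 u2]] [v /= /asboolP [v1 v2]].
apply/asboolP; split; rewrite cs_starM cs_mulA.
  by rewrite -(cs_mulA _ _ u) u1 cs_mulr1.
by rewrite -(cs_mulA _ v) v2 cs_mulr1.
Qed.
Let inv_unitary (u : unitary) : `[< is_unitary (val u)^† >].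
Proof.
by case: u => [u /= /asboolP [u1 u2]]; apply/asboolP; split; rewrite cs_starK.
Qed.

Let one : unitary := Sub cs_one one_unitary.
Let mul (u v : unitary) : unitary := Sub (val u ** val v) (mul_unitary u v).
Let inv (u : unitary) : unitary := Sub (val u)^† (inv_unitary u).

Let mulA : associative mul.
Proof. by move=> u v w; apply: val_inj; rewrite /= cs_mulA. Qed.
Let mul1 : left_id one mul.
Proof. by move=> u; apply: val_inj; rewrite /= cs_mul1. Qed.
Let mulr1 : right_id one mul.
Proof. by move=> u; apply: val_inj; rewrite /= cs_mulr1. Qed.
Let mulV : left_inverse one inv mul.
Proof. by move=> u; apply: val_inj => /=; case: u => [u /= /asboolP []]. Qed.
Let mulrV : right_inverse one inv mul.
Proof. by move=> u; apply: val_inj => /=; case: u => [u /= /asboolP []]. Qed.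

HB.instance Definition _ := isGroup.Build unitary mulA mul1 mulr1 mulV mulrV.

End UnitaryGroup.

Section Subgroups.
Context {gT : groupType}.
Local Open Scope group_scope.

Definition is_subgroup (H : set gT) : Prop :=
  [/\ H 1, forall x y, H x -> H y -> H (x * y) & forall x, H x -> H x^-1].

Definition is_normal_subgroup (G N : set gT) : Prop :=
  [/\ is_subgroup N, N `<=` G & forall g x, G g -> N x -> N (x ^ g)].

Definition commutator_subgroup (G : set gT) : set gT :=
  smallest is_subgroup [set z | exists x y, [/\ G x, G y & z = [~ x, y]]].

Lemma commutator_subgroupP (G : set gT) : is_subgroup (commutator_subgroup G).
Proof.
split=> [H [[]]//|x y Hx Hy H HG|x Hx H HG]; have [[H1 HM HV] _] := HG.
  by apply: HM; [exact: Hx | exact: Hy].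
by apply: HV; exact: Hx.
Qed.

Definition derived (G : set gT) : Type :=
  {x : gT | x \in commutator_subgroup G}.
HB.instance Definition _ (G : set gT) := Choice.on (derived G).
HB.instance Definition _ (G : set gT) := SubType.on (derived G).

Lemma commutator_group_closed (G : set gT) :
  group_closed (fun x => x \in commutator_subgroup G).
Proof.
have [H1 HM HV] := commutator_subgroupP G.
split=> [|x y]; first by rewrite unfold_in inE.
by rewrite !unfold_in !inE => Hx Hy; apply: HM => //; exact: HV.
Qed.

HB.instance Definition _ (G : set gT) := SubChoice_isSubGroup.Build gT
  (fun x => x \in commutator_subgroup G) (derived G)
  (commutator_group_closed G).

End Subgroups.

Definition simple_group (gT : groupType) : Prop :=
  [set: gT] <> [set 1%g] /\
  forall N : set gT, is_normal_subgroup setT N -> N = [set 1%g] \/ N = setT.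

Section URS.
Context (gT : groupType).
Local Open Scope group_scope.

(** The compact space 2^G; its elements are the indicator functions of subsets
    of G.  The subgroups form a closed subspace, so closed subsets and closures
    may be taken in the whole space. *)
Definition subset_space : Type := prod_topology (fun _ : gT => bool).
HB.instance Definition _ := Topological.on subset_space.

Definition Sub_space : set subset_space :=
  [set H | is_subgroup [set x | H x]].

(** [conj_sub g H] is g H g^-1. *)
Definition conj_sub (g : gT) (H : subset_space) : subset_space :=
  fun x => H (x ^ g).

Definition conj_invariant (S : set subset_space) : Prop :=
  forall g H, S H -> S (conj_sub g H).

Definition is_urs (S : set subset_space) : Prop :=
  [/\ S `<=` Sub_space, S !=set0, closed S, conj_invariant S &
      forall T : set subset_space, T `<=` S -> T !=set0 -> closed T ->
        conj_invariant T -> T = S].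

Definition is_nontrivial_urs (S : set subset_space) : Prop :=
  [/\ is_urs S, S <> [set (fun x : gT => x == 1)] & S <> [set (fun=> true)]].

Definition stabilizer (X : choiceType) (act : gT -> X -> X) (x : X) :
  subset_space := fun g => act g x == x.

Definition is_stabilizer_urs (X : choiceType) (act : gT -> X -> X)
    (S : set subset_space) : Prop :=
  let C := closure (range (stabilizer act)) in
  [/\ is_urs S, S `<=` C & forall T, is_urs T -> T `<=` C -> T = S].

End URS.

Section HigmanThompson.
Context {R : realType} {k : nat} {L : kgraph k} {A : unital_cstar_algebra R}.
Variable s : mor L -> A.

Definition ht_form (U : A) (n : nat) (a b : 'I_n -> mor L) : Prop :=
  (forall i, src (a i) = src (b i)) /\
  U = \sum_(i < n) (s (a i) ** (s (b i))^†).

Definition ht : set (unitary A) :=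
  [set U | exists n (a b : 'I_n -> mor L), ht_form (val U) a b].

Definition ht_graph (U : unitary A) (x y : infpath L) : Prop :=
  exists n (a b : 'I_n -> mor L), ht_form (val U) a b /\
    exists i z, prefixed (b i) z x /\ prefixed (a i) z y.

(** phi(U)(b_i z) = a_i z. *)
Definition ht_act (U : unitary A) (x : infpath L) : infpath L :=
  xget x [set y | ht_graph U x y].

Definition ht'_act (U : derived ht) : infpath L -> infpath L := ht_act (val U).

End HigmanThompson.

(* Main.v *)
From HB Require Import structures.
From Pilot Require Import Defs.
From mathcomp Require Import all_boot all_order all_algebra.
From mathcomp Require Import complex.
From mathcomp Require Import all_classical all_reals all_analysis.
From mathcomp Require Import ring lra zify.

Set Implicit Arguments.
Unset Strict Implicit.
Unset Printing Implicit Defensive.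

Import Order.TTheory GRing.Theory Num.Theory.
Import numFieldNormedType.Exports.
Import Pilot.Defs.
Local Open Scope classical_set_scope.

(** The path space X of the k-graph carries the pseudogroup of the maps that locally
    replace one finite prefix by another ([prefix_germ]).  The theorem holds because the
    Higman-Thompson like group acts on X as the full group of this pseudogroup, the group
    of all homeomorphisms with germs in it ([ht_full_group]), and because X is purely
    infinite: strong connectedness lets one embed a copy of all of X, by changes of
    prefix, in any nonempty open set ([path_purely_infinite]).  The rest of the argument
    is dynamics and does not see the graph.

    Passing from the algebra to the full group requires that the vertex projections of
    the universal algebra are not zero ([generator_neq0]).  This is seen in a concrete
    Cuntz-Krieger family, on the square-summable functions on the countable set of paths
    tail equivalent to a fixed one, where the generator of a path l takes the basis vector
    of x to that of l x.  Generators of distinct paths of one degree are orthogonal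
    because projections that sum to a projection are orthogonal
    ([sum_projections_orthogonal]).  Given this, a unitary U of the prescribed form sends
    the generator of each sufficiently long path to the generator of a single path
    ([isometry_single]): aperiodicity provides extensions making the different candidates
    orthogonal, and U being isometric leaves room for only one.  So U is the same thing
    as a finite table of changes of prefix, the tables compose like the homeomorphisms
    that they describe, and by compactness each global homeomorphism that locally changes
    prefixes has such a table ([ht_full]).

    Let G be the full group and K its commutator subgroup.  A commutator of two involutions
    that swap disjoint clopen sets realizes any given isomorphism between disjoint clopen
    sets by an element of K with small support ([derived_realize]); so K compresses clopen
    sets into each other ([derived_compress]), and elements are products of two elements
    with proper supports ([fragmentation]).  If a normal subgroup N contains some h moving
    a clopen set B off itself, then for f and g supported in B the conjugate of g by the
    inverse of h commutes with f, whence the commutator [f, g] lies in N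
    ([higman_trick]).  Compression and fragmentation extend this to all f and g
    ([normal_contains_commutators]), so that N contains K.  The argument works for K in
    place of G and gives that K is perfect and simple.

    For the uniformly recurrent subgroups of K, let x0 be an aperiodic path.  An element
    that fixes x0 fixes a neighbourhood of it, so the stabilizer map is continuous at x0,
    and every limit of stabilizers has the stabilizer of x0 in its orbit closure
    ([stabilizer_in_orbit_closure]): the stabilizer uniformly recurrent subgroup S is the
    orbit closure of this one stabilizer.  Let T be another nontrivial one and H in T.  As T
    is closed and omits the trivial subgroup, some finite set of nontrivial elements
    meets every conjugate of H.  Conjugating by copies of the elements q of K placed
    disjointly in the sets moved by these elements, each q is assigned one of finitely many
    f such that the conjugate of f by the copy of q lies in H.  The
    quotients of the q assigned to one f are realized by H on the copy of X belonging to
    f, and by B. H. Neumann's lemma on coverings by cosets the elements so realized form,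
    for some f, a subgroup of finite index ([neumann_covering]), which is all of K by
    simplicity ([confined_realizes]).  Higman's trick in that copy then shows that H contains a
    whole rigid stabilizer ([confined_contains_rist]), and by compression the members of T
    contain the rigid stabilizers of complements of arbitrarily small open sets.  Shrinking
    these to x0, the members of T approach the stabilizer of x0, for two different such
    rigid stabilizers already generate K ([rist_generate], [confined_stabilizer]).  Hence T
    contains that stabilizer and equals S by minimality. *)

(** * Commutators *)

Section Commutators.
Context {gT : groupType}.
Implicit Types (G N H : set gT).
Local Open Scope group_scope.

Lemma sub_commutator_subgroup G f g : G f -> G g -> commutator_subgroup G [~ f, g].
Proof. by move=> Gf Gg H [_]; apply; exists f, g. Qed.

Lemma commutator_subgroup_min G N : is_subgroup N ->
  (forall f g, G f -> G g -> N [~ f, g]) -> commutator_subgroup G `<=` N.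
Proof. by move=> HN HG x; apply; split=> // _ [f [g [Gf Gg ->]]]; apply: HG. Qed.

Lemma subgroup1 H : is_subgroup H -> H 1. Proof. by case. Qed.
Lemma subgroupM H f g : is_subgroup H -> H f -> H g -> H (f * g).
Proof. by case=> _ + _; apply. Qed.
Lemma subgroupV H f : is_subgroup H -> H f -> H f^-1.
Proof. by case=> _ _; apply. Qed.
Lemma subgroupJ H f g : is_subgroup H -> H f -> H g -> H (f ^ g).
Proof.
by move=> sH Hf Hg; rewrite conjgE; do 2?[apply: (subgroupM sH) => //]; apply: subgroupV.
Qed.
Lemma subgroupR H f g : is_subgroup H -> H f -> H g -> H [~ f, g].
Proof.
move=> sH Hf Hg; rewrite commgEl.
by apply: (subgroupM sH); [exact: subgroupV | exact: subgroupJ].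
Qed.

Lemma commutator_subgroup_sub G : is_subgroup G -> commutator_subgroup G `<=` G.
Proof. by move=> sG; apply: commutator_subgroup_min => // f g *; apply: subgroupR. Qed.

(** A conjugation fixing [H] setwise maps generating commutators of [H] to
    generating commutators, hence preserves the derived subgroup. *)
Lemma commutator_subgroupJ H g : (forall h, H h -> H (h ^ g)) ->
  forall h, commutator_subgroup H h -> commutator_subgroup H (h ^ g).
Proof.
move=> HJ h; have [C1 CM CV] := commutator_subgroupP H.
apply: (commutator_subgroup_min (N := [set h | commutator_subgroup H (h ^ g)])).
  split=> [|x y|x] /=; first by rewrite conj1g.
    by rewrite conjMg; apply: CM.
  by rewrite conjVg; apply: CV.
by move=> x y Hx Hy /=; rewrite conjRg; apply: sub_commutator_subgroup; apply: HJ.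
Qed.

(** Higman's trick: if the conjugate of [g] by [h] commutes with [f], then modulo
    the conjugates of [h] under [K] so does [g]. *)
Lemma higman_trick K N f g h : is_subgroup K -> is_subgroup N ->
  (forall k, K k -> N (h ^ k)) -> K f -> K g -> commute f (g ^ h) -> N [~ f, g].
Proof.
move=> sK sN NhK Kf Kg cf.
have -> : g = (g ^ h) * [~ h, g].
  by rewrite commgEr conjVg mulVKg.
have -> : [~ f, g ^ h * [~ h, g]] = [~ f, [~ h, g]].
  have e : f * g ^ h = g ^ h * f := cf.
  move: (g ^ h) ([~ h, g]) e => d c e; rewrite !commgEl; congr (_ * _).
  by rewrite !(conjgE f) [f * (_ * c)]mulgA e invgM -!mulgA mulKg.
have Nc k : K k -> N ([~ h, g] ^ k).
  move=> Kk; rewrite commgEl conjMg conjVg -conjgM; apply: (subgroupM sN).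
    by apply: (subgroupV sN); exact: NhK.
  by apply/NhK/(subgroupM sK).
rewrite commgEr; apply: (subgroupM sN).
  by rewrite conjVg; apply: (subgroupV sN); exact: Nc.
by rewrite -[X in N X]conjg1; apply/Nc/(subgroup1 sK).
Qed.

Section Modulo.
Variables (K N : set gT).
Hypothesis nN : is_normal_subgroup K N.
Let sN : is_subgroup N := let: And3 h _ _ := nN in h.
Let nNJ g x : K g -> N x -> N (x ^ g).
Proof. by case: nN => _ _; apply. Qed.

Lemma normal_commgM f g h : K g -> K h ->
  N [~ f, g] -> N [~ f, h] -> N [~ f, g * h].
Proof.
move=> Kg Kh Nfg Nfh.
have -> : [~ f, g * h] = [~ f, h] * [~ f, g] ^ h.
  by rewrite !commgEr invgM conjMg [X in _ = _ * X]conjgE !mulgA mulgK.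
by apply: (subgroupM sN) => //; apply: nNJ.
Qed.

Lemma normal_commg_sym f g : N [~ f, g] -> N [~ g, f].
Proof. by move=> /(subgroupV sN); rewrite invgR. Qed.

Lemma normal_commMg f g h : K g -> K h ->
  N [~ g, f] -> N [~ h, f] -> N [~ g * h, f].
Proof.
by move=> Kg Kh Ng Nh; apply: normal_commg_sym; apply: normal_commgM => //;
  apply: normal_commg_sym.
Qed.

End Modulo.
End Commutators.

(** * Full groups on purely infinite spaces *)

Definition clopen_basis (T : topologicalType) : Prop :=
  forall (x : T) (O : set T), open O -> O x -> exists V, [/\ clopen V, V x & V `<=` O].

Definition clopen_separated (T : topologicalType) : Prop :=
  forall x y : T, x <> y -> exists V, [/\ clopen V, V x & ~ V y].

Definition perfect (T : topologicalType) : Prop :=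
  forall (x : T) (O : set T), open O -> O x -> exists y, O y /\ y <> x.

Section Pseudogroup.
Context {X : topologicalType}.
Implicit Types (A B C O V W : set X) (x y z : X) (f t : X -> X).

(** A pseudogroup of local homeomorphisms, presented by the relation saying that
    the germ at [x] of a total map [f] belongs to it. *)
Record germs (loc : (X -> X) -> X -> Prop) : Prop := Germs {
  germ_id : forall x, loc id x;
  germ_comp : forall f t x, loc f x -> loc t (f x) -> loc (t \o f) x;
  germ_ext : forall f t x O, open O -> O x -> (forall y, O y -> f y = t y) ->
    loc f x -> loc t x;
  germ_inv : forall f t x O, open O -> O x -> (forall y, O y -> t (f y) = y) ->
    loc f x -> loc t (f x);
  germ_cont : forall f x O, loc f x -> open O -> O (f x) ->
    exists V, [/\ open V, V x & forall y, V y -> O (f y)];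
  germ_open : forall f x O, loc f x -> open O -> O x ->
    exists V, [/\ open V, V (f x) & V `<=` f @` O]
}.

Definition embedding (loc : (X -> X) -> X -> Prop) t : Prop :=
  [/\ injective t, forall x, loc t x & closed (range t)].

(** Room for the constructions below: any number of disjoint copies of the whole space
    fit in any nonempty open set, since the copies can be placed in disjoint parts of
    it. *)
Definition purely_infinite (loc : (X -> X) -> X -> Prop) : Prop :=
  forall O, open O -> O !=set0 -> exists2 t, embedding loc t & range t `<=` O.

Definition supported (gT : groupType) (act : gT -> X -> X) (g : gT) A : Prop :=
  forall x, ~ A x -> act g x = x.

Record germ_action (loc : (X -> X) -> X -> Prop) (gT : groupType)
    (G : set gT) (act : gT -> X -> X) : Prop := GermAction {
  ga_sub : is_subgroup G;
  ga_act1 : forall x, act 1%g x = x;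
  ga_actM : forall g h x, G g -> G h -> act (g * h)%g x = act g (act h x);
  ga_faithful : forall g, G g -> (forall x, act g x = x) -> g = 1%g;
  ga_germ : forall g x, G g -> loc (act g) x
}.

Record full_group (loc : (X -> X) -> X -> Prop) (gT : groupType)
    (G : set gT) (act : gT -> X -> X) : Prop := FullGroup {
  fg_action : germ_action loc G act;
  fg_full : forall f f', cancel f f' -> cancel f' f -> (forall x, loc f x) ->
    exists2 g, G g & act g =1 f
}.

(** [f] is carried to [t f t^-1], extended by the identity outside [range t]. *)
Definition transports (gT : groupType) (act : gT -> X -> X) t (f f' : gT) : Prop :=
  (forall x, act f' (t x) = t (act f x)) /\ supported act f' (range t).

End Pseudogroup.

Section Sets.
Context {X : topologicalType}.
Hypotheses (Xbasis : clopen_basis X) (Xsep : clopen_separated X) (Xperf : perfect X).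
Implicit Types (A B C O V W : set X) (x y z : X).

Lemma clopenD A B : clopen A -> clopen B -> clopen (A `\` B).
Proof. by move=> cA cB; rewrite setDE; apply: clopenI => //; exact: clopenC. Qed.

Lemma clopen_compl A : clopen A -> clopen (~` A). Proof. exact: clopenC. Qed.

Lemma clopen_open A : clopen A -> open A. Proof. by case. Qed.

Lemma clopen_openC A : clopen A -> open (~` A).
Proof. by move=> cA; apply: clopen_open; exact: clopenC. Qed.

Lemma perfect_avoid (s : seq X) O : open O -> O !=set0 ->
  exists2 x, O x & forall y, y \in s -> y <> x.
Proof.
elim: s O => [|p s IH] O oO [x Ox]; first by exists x.
have [q [Oq qp]] := Xperf oO Ox.
have [z Oz zp] : exists2 z, O z & z <> p.
  by have [e|?] := pselect (x = p); [exists q; rewrite -?e|exists x].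
have [V [cV Vz Vp]] := Xsep zp.
have [||y [Oy Vy] ys] := IH (O `&` V); first by apply: openI => //; case: cV.
  by exists z.
exists y => // w; rewrite inE => /orP[/eqP ->|]; last exact: ys.
by move=> e; apply: Vp; rewrite e.
Qed.

Lemma split_open O : open O -> O !=set0 -> exists V W,
  [/\ clopen V /\ clopen W, V !=set0 /\ W !=set0, V `<=` O, W `<=` O & V `&` W = set0].
Proof.
move=> oO [x Ox]; have [y [Oy yx]] := Xperf oO Ox.
have [U [cU Uy Ux]] := Xsep yx.
have [] := @Xbasis y (O `&` U); [apply: openI => //; exact: clopen_open| by []|].
move=> V [cV Vy VO].
have [] := @Xbasis x (O `&` ~` U); [apply: openI => //; exact: clopen_openC| by []|].
move=> W [cW Wx WO]; exists V, W; split; [by []| by split; [exists y|exists x]| | |].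
- by move=> z /VO [].
- by move=> z /WO [].
- by rewrite -subset0 => z [/VO [_ ?] /WO [_ ?]].
Qed.

End Sets.

Section GermActions.
Context {X : topologicalType}.
Hypotheses (Xbasis : clopen_basis X) (Xsep : clopen_separated X).
Variable loc : (X -> X) -> X -> Prop.
Hypothesis Hloc : germs loc.
Context {gT : groupType} (G : set gT) (act : gT -> X -> X).
Hypothesis HG : germ_action loc G act.
Implicit Types (A B C O V W : set X) (x y z : X) (g h k : gT).
Local Open Scope group_scope.

Let sG := ga_sub HG.
Let G1 : G 1 := subgroup1 sG.
Let GM g h : G g -> G h -> G (g * h) := subgroupM sG.
Let GV g : G g -> G g^-1 := subgroupV sG.

Lemma actK g : G g -> cancel (act g) (act g^-1).
Proof. by move=> Gg x; rewrite -(ga_actM HG) ?mulVg ?(ga_act1 HG) //; exact: GV. Qed.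
Lemma actVK g : G g -> cancel (act g^-1) (act g).
Proof. by move=> Gg x; rewrite -(ga_actM HG) ?mulgV ?(ga_act1 HG) //; exact: GV. Qed.
Lemma act_inj g : G g -> injective (act g).
Proof. by move=> /actK /can_inj. Qed.

Lemma act_eq g h : G g -> G h -> act g =1 act h -> g = h.
Proof.
move=> Gg Gh e; apply: (mulIg h^-1); rewrite mulgV.
apply: (ga_faithful HG) => [|x]; first by apply: GM => //; exact: GV.
by rewrite (ga_actM HG) ?e ?actVK //; exact: GV.
Qed.

Lemma germ_preimage_clopen f A : (forall x, loc f x) -> clopen A -> clopen (f @^-1` A).
Proof.
move=> lf cA; apply: preimage_clopen => // x.
move=> B; rewrite !nbhsE => -[U [oU Ufx] UB].
have [V [oV Vx VU]] := germ_cont Hloc (lf x) oU Ufx.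
by exists V => // y /VU /UB.
Qed.
Lemma act_preimage_clopen g A : G g -> clopen A -> clopen (act g @^-1` A).
Proof. by move=> Gg; apply: germ_preimage_clopen => x; exact: (ga_germ HG). Qed.

Lemma clopen_act g A : G g -> clopen A -> clopen (act g @` A).
Proof.
move=> Gg cA; suff -> : act g @` A = act g^-1 @^-1` A.
  by apply: act_preimage_clopen => //; exact: GV.
rewrite eqEsubset; split=> [_ [x Ax <-]|x Ax]; first by rewrite /= actK.
by exists (act g^-1 x) => //; rewrite actVK.
Qed.

Lemma moved_clopen g x O : G g -> open O -> O x -> act g x <> x ->
  exists V, [/\ clopen V, V x, V `<=` O & V `&` (act g @` V) = set0].
Proof.
move=> Gg oO Ox gx; have [U [cU Ux Ugx]] := Xsep (nesym gx).
have cW : clopen (U `&` act g @^-1` (~` U)).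
  by apply: clopenI => //; apply: act_preimage_clopen => //; exact: clopenC.
have [] := @Xbasis x (O `&` (U `&` act g @^-1` (~` U))).
- by apply: openI => //; exact: clopen_open.
- by [].
move=> V [cV Vx VO]; exists V; split=> //; first by move=> y /VO[].
rewrite -subset0 => z [/VO[_ [Uz _]] [y Vy gy]].
by have [_ [_]] := VO _ Vy; rewrite /= gy.
Qed.

Lemma commute_disjoint f g A B : G f -> G g -> A `&` B = set0 ->
  supported act f A -> supported act g B -> commute f g.
Proof.
have half f' g' A' B' x : G f' -> G g' -> A' `&` B' = set0 ->
    supported act f' A' -> supported act g' B' -> A' x ->
    act f' (act g' x) = act g' (act f' x).
  move=> Gf Gg AB sf sg Ax.
  have Bx y : A' y -> act g' y = y.
    by move=> Ay; apply: sg => By; have : (A' `&` B') y by []; rewrite AB.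
  rewrite (Bx x Ax) Bx //; apply: contrapT => nA.
  have e : act f' (act f' x) = act f' x by exact: sf.
  by apply: nA; rewrite (act_inj Gf e).
move=> Gf Gg AB sf sg; apply: act_eq; rewrite ?GM //; try exact: GM.
move=> x; rewrite !(ga_actM HG) //.
have [Ax|nAx] := pselect (A x); first exact: (half f g A B).
have [Bx|nBx] := pselect (B x).
  by rewrite (half g f B A) // setIC.
by rewrite (sf x) // (sg x) // sf.
Qed.

Lemma supportedJ g h A : G g -> G h -> supported act g A ->
  supported act (g ^ h) (act h @^-1` A).
Proof.
move=> Gg Gh sg x nA; rewrite conjgE !(ga_actM HG) ?sg ?actK //; try exact: GV.
by apply: GM.
Qed.

Lemma transport_uniq t f f1 f2 : G f1 -> G f2 -> transports act t f f1 ->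
  transports act t f f2 -> f1 = f2.
Proof.
move=> Gf1 Gf2 [tf1 s1] [tf2 s2]; apply: act_eq => // x.
have [[y _ <-]|nx] := pselect (range t x); first by rewrite tf1 tf2.
by rewrite s1 ?s2.
Qed.

Lemma transports_1 t : transports act t 1 1.
Proof. by split=> x *; rewrite !(ga_act1 HG). Qed.

Lemma transportsM t f f' g g' : G f -> G f' -> G g -> G g' ->
  transports act t f f' -> transports act t g g' -> transports act t (f * g) (f' * g').
Proof.
move=> Gf Gf' Gg Gg' [tf sf] [tg sg].
by split=> x *; rewrite !(ga_actM HG) ?tg ?tf ?sg ?sf.
Qed.

Lemma transportsV t f f' : G f -> G f' ->
  transports act t f f' -> transports act t f^-1 f'^-1.
Proof.
move=> Gf Gf' [tf sf].
by split=> x *; apply: (act_inj Gf'); rewrite actVK ?tf ?actVK // sf.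
Qed.

Lemma transportsR t f f' g g' : G f -> G f' -> G g -> G g' ->
  transports act t f f' -> transports act t g g' ->
  transports act t [~ f, g] [~ f', g'].
Proof.
move=> Gf Gf' Gg Gg' tf tg; rewrite !commgEl !conjgE.
by do 3?[apply: transportsM; do ?[apply: GM]; do ?[apply: GV] => //];
  do ?[exact: transportsV].
Qed.

End GermActions.

Section FullGroups.
Context {X : topologicalType}.
Hypotheses (Xbasis : clopen_basis X) (Xsep : clopen_separated X) (Xperf : perfect X).
Variable loc : (X -> X) -> X -> Prop.
Hypotheses (Hloc : germs loc) (Hpi : purely_infinite loc).
Context {gT : groupType} (G : set gT) (act : gT -> X -> X).
Hypothesis HG : full_group loc G act.
Implicit Types (A B C O V W : set X) (x y z : X) (g h k : gT).
Local Open Scope group_scope.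

Let HA := fg_action HG.
Let sG := ga_sub HA.
Let G1 : G 1 := subgroup1 sG.
Let GM g h : G g -> G h -> G (g * h) := subgroupM sG.
Let GV g : G g -> G g^-1 := subgroupV sG.
Let K := commutator_subgroup G.
Let sK : is_subgroup K := commutator_subgroupP G.
Let KG : K `<=` G := commutator_subgroup_sub sG.
Let actK g : G g -> _ := @actK X loc gT G act HA g.
Let actVK g : G g -> _ := @actVK X loc gT G act HA g.
Let act_inj g : G g -> _ := @act_inj X loc gT G act HA g.
Let act_eq g h : G g -> G h -> _ := @act_eq X loc gT G act HA g h.

Definition piecewise A (f1 f2 : X -> X) x := if `[< A x >] then f1 x else f2 x.

Lemma piecewise_in A f1 f2 x : A x -> piecewise A f1 f2 x = f1 x.
Proof. by move=> Ax; rewrite /piecewise asboolT. Qed.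
Lemma piecewise_out A f1 f2 x : ~ A x -> piecewise A f1 f2 x = f2 x.
Proof. by move=> Ax; rewrite /piecewise asboolF. Qed.

Lemma germ_piecewise A f1 f2 : clopen A -> (forall x, A x -> loc f1 x) ->
  (forall x, ~ A x -> loc f2 x) -> forall x, loc (piecewise A f1 f2) x.
Proof.
move=> cA l1 l2 x; have [Ax|Ax] := pselect (A x).
  apply: (germ_ext Hloc (clopen_open cA) Ax _ (l1 x Ax)) => y Ay.
  by rewrite piecewise_in.
apply: (germ_ext Hloc (clopen_openC cA) Ax _ (l2 x Ax)) => y Ay.
by rewrite piecewise_out.
Qed.

Definition partial_iso (t t' : X -> X) V W : Prop :=
  (forall x, V x -> [/\ W (t x), t' (t x) = x & loc t x]) /\
  (forall y, W y -> V (t' y) /\ t (t' y) = y).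

Lemma partial_iso_germV t t' V W : open V -> partial_iso t t' V W ->
  forall y, W y -> loc t' y.
Proof.
move=> oV [tP t'P] y Wy; have [Vy <-] := t'P y Wy.
by apply: (germ_inv Hloc oV Vy) => [x /tP[]//|]; case: (tP _ Vy).
Qed.

(** Gluing [t] on [V], its inverse on [W] and the identity elsewhere gives an
    involution with germs in the pseudogroup, which [G] contains by fullness. *)
Lemma swap_exists t t' V W : clopen V -> clopen W -> V `&` W = set0 ->
  partial_iso t t' V W ->
  exists g, [/\ G g, g^-1 = g, forall x, V x -> act g x = t x,
    forall x, W x -> act g x = t' x & supported act g (V `|` W)].
Proof.
move=> cV cW VW /[dup] tt' [tP t'P].
have nWV x : V x -> ~ W x.
  by move=> Vx Wx; suff : set0 x by []; rewrite -VW.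
pose f := piecewise V t (piecewise W t' id).
have fV x : V x -> f x = t x by move=> Vx; rewrite /f piecewise_in.
have fW x : W x -> f x = t' x.
  by move=> Wx; rewrite /f piecewise_out ?piecewise_in // => /nWV.
have fI x : ~ (V `|` W) x -> f x = x.
  by move=> nx; rewrite /f !piecewise_out // => ?; apply: nx; [right|left].
have lf : forall x, loc f x.
  apply: germ_piecewise => // x Hx; first by case: (tP _ Hx).
  apply: (germ_piecewise cW) => y Hy; last exact: germ_id.
  exact: (partial_iso_germV (clopen_open cV) tt').
have ff : involutive f.
  move=> x; have [Vx|nVx] := pselect (V x).
    by have [Wtx ? _] := tP x Vx; rewrite (fV x) // fW.
  have [Wx|nWx] := pselect (W x).
    by have [Vtx ?] := t'P x Wx; rewrite (fW x) // fV.
  by rewrite !fI //; case.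
have [g Gg gE] := fg_full HG ff ff lf; exists g.
split=> // [|x Hx|x Hx|x Hx].
- apply: (act_eq (GV Gg) Gg) => x; apply: (act_inj Gg).
  by rewrite actVK // !gE ff.
- by rewrite gE; exact: fV.
- by rewrite gE; exact: fW.
- by rewrite gE; exact: fI.
Qed.

(** The image is closed in the whole space because an embedding is open and its
    range is closed. *)
Lemma embedding_image_clopen t A : embedding loc t -> clopen A -> clopen (t @` A).
Proof.
case=> ti tl tc cA.
have io B : open B -> open (t @` B).
  move=> oB; rewrite openE => _ [x Bx <-].
  have [V [oV Vx VB]] := germ_open Hloc (tl x) oB Bx.
  by rewrite /interior nbhsE; exists V.
split; first by apply: io; exact: clopen_open.
rewrite -[t @` A]setCK closedC.
suff -> : ~` (t @` A) = t @` (~` A) `|` ~` range t.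
  apply: openU; last by rewrite openC.
  by apply: io; exact: clopen_openC.
rewrite eqEsubset; split=> [y nAy|y [[x nAx <-]|nr]].
- have [[x _ xy]|] := pselect (range t y); last by right.
  by left; exists x => // Ax; apply: nAy; exists x.
- by case=> z Az /ti zx; apply: nAx; rewrite -zx.
- by case=> z _ zy; apply: nr; exists z.
Qed.

Lemma embedding_linv t : embedding loc t -> exists t', cancel t t'.
Proof.
case=> ti _ _; exists (fun y => xget y [set x | t x = y]) => x.
by apply: ti; apply: (@xgetPex _ (t x) [set z | t z = t x]); exists x.
Qed.

(** The commutator of the swap [b] of [V] with [W] and the swap [a] of [V] with a
    small copy [t1 V] inside [O] agrees with [b] on [V]: the swap [a] takes [V] to
    [t1 V], which [b] does not move, and back. *)
Lemma derived_realize t t' V W O : clopen V -> clopen W -> V `&` W = set0 ->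
  partial_iso t t' V W -> open O -> O !=set0 -> (forall x, O x -> ~ (V `|` W) x) ->
  exists k, [/\ K k, forall x, V x -> act k x = t x & supported act k (V `|` W `|` O)].
Proof.
move=> cV cW VW tt' oO O0 OVW; have [t1 et1 t1O] := Hpi oO O0.
have [t1' t1K] := embedding_linv et1.
have cW1 := embedding_image_clopen et1 cV.
have t1V x : (t1 @` V) x -> O x by case=> y _ <-; apply: t1O; exists y.
have VW1 : V `&` (t1 @` V) = set0.
  by rewrite -subset0 => x [Vx /t1V /OVW]; apply; left.
have tt1 : partial_iso t1 t1' V (t1 @` V).
  split; first by move=> x Vx; split; [exists x|exact: t1K|case: et1].
  by move=> _ [x Vx <-]; rewrite t1K.
have [b [Gb invb bV bW bs]] := swap_exists cV cW VW tt'.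
have [a [Ga inva aV aW as_]] := swap_exists cV cW1 VW1 tt1.
exists [~ b, a]; split=> [|x Vx|x nx].
- exact: sub_commutator_subgroup.
- have tW : W (t x) by case: tt' => /(_ x Vx)[].
  have tW1 : (t1 @` V) (t1 x) by exists x.
  rewrite commgEl conjgE invb inva !(ga_actM HA) //; do ?apply: GM => //.
  rewrite (aV x Vx) (bs (t1 x)); last exact: (OVW _ (t1V _ tW1)).
  by rewrite (aW _ tW1) t1K bV.
have nb : act b x = x by apply: bs => VWx; apply: nx; left.
have na : act a x = x.
  apply: as_ => -[Vx|/t1V Ox]; apply: nx; last by right.
  by left; left.
rewrite commgEl conjgE invb inva !(ga_actM HA) //; do ?apply: GM => //.
by rewrite na nb na nb.
Qed.

(** When [C] sticks out of [B], split the excess into two parts: one receives a copy of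
    [B], and [derived_realize] uses the other to realize the copying by an element of
    [K].  When [C] lies inside [B], first move [B] into [A `\` B] in this way; then [C]
    sticks out of the image of [B]. *)
Lemma derived_compress A B C : open A -> clopen B -> open C -> B `<=` A ->
  C `<=` A -> C !=set0 -> (A `\` B) !=set0 ->
  exists k, [/\ K k, supported act k A & forall x, B x -> C (act k x)].
Proof.
have main A' B' C' : clopen B' -> open C' -> B' `<=` A' ->
    C' `<=` A' -> (C' `\` B') !=set0 ->
    exists k, [/\ K k, supported act k A', forall x, B' x -> C' (act k x)
      & exists2 t, embedding loc t & forall x, B' x -> act k x = t x].
  move=> cB oC BA CA C0.
  have oCB : open (C' `\` B') by rewrite setDE; apply: openI => //; exact: clopen_openC.
  have [V [W [[cV cW] [V0 W0] VC WC VW]]] := split_open Xbasis Xsep Xperf oCB C0.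
  have [t et tV] := Hpi (clopen_open cV) V0.
  have [t' tK] := embedding_linv et.
  have BV : B' `&` (t @` B') = set0.
    rewrite -subset0 => x [Bx [y _ yx]].
    have /tV/VC[_] : range t x by exists y.
    by [].
  have iso : partial_iso t t' B' (t @` B').
    split; first by move=> x Bx; split; [exists x|exact: tK|case: et].
    by move=> _ [x Bx <-]; rewrite tK.
  have [|k [Kk kB ks]] := derived_realize cB (embedding_image_clopen et cB) BV iso
      (clopen_open cW) W0.
    move=> x Wx [Bx|[y _ yx]]; first by case: (WC _ Wx).
    suff : set0 x by []. by rewrite -VW; split=> //; apply: tV; exists y.
  exists k; split=> // [x nA|x Bx|]; last by exists t.
    apply: ks => -[[Bx|[y By yx]]|/WC[/CA]//]; first exact/nA/BA.
    have /tV/VC[/CA] : range t x by exists y.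
    by [].
  rewrite kB //; have /tV/VC[] : range t (t x) by exists x.
  by [].
move=> oA cB oC BA CA C0 AB0.
have [CB0|/nonemptyPn CB0] := pselect ((C `\` B) !=set0).
  by have [k [Kk ks kC _]] := main A B C cB oC BA CA CB0; exists k.
have oAB : open (A `\` B).
  by rewrite setDE; apply: openI => //; exact: clopen_openC.
have [V [W [[cV cW] [V0 W0] VA WA VW]]] := split_open Xbasis Xsep Xperf oAB AB0.
have [||k [Kk ks kV [t et kt]]] := main A B V cB (clopen_open cV) BA.
- by move=> x /VA[].
- by case: V0 => x Vx; exists x; split=> //; case: (VA _ Vx).
(* The image of [B] under [k], written through [t] to see that it is clopen. *)
pose B1 := t @` B.
have cB1 : clopen B1 by exact: embedding_image_clopen.
have B1V x : B1 x -> V x by case=> y By <-; rewrite -kt //; exact: kV.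
have [|||h [Kh hs hC _]] := main A B1 C cB1 oC.
- by move=> x /B1V/VA[].
- by [].
- case: C0 => x Cx; exists x; split=> // /B1V/VA[_]; apply.
  by apply: contrapT => nB; have : (C `\` B) x by []; rewrite CB0.
exists (h * k); split; first exact: (subgroupM sK).
  by move=> x nA; rewrite (ga_actM HA) ?ks ?hs //; exact: KG.
move=> x Bx; rewrite (ga_actM HA); try exact: KG.
by apply: hC; exists x => //; rewrite kt.
Qed.

Lemma act_iso g V : G g -> partial_iso (act g) (act g^-1) V (act g @` V).
Proof.
move=> Gg; split; last by move=> _ [x Vx <-]; rewrite actK.
by move=> x Vx; split; [exists x|exact: actK|exact: (ga_germ HA)].
Qed.

(** An element that moves some point outside [A] agrees near that point with an
    element of [K] of small support; what remains of it is trivial near the point. *)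
Lemma fragmentation (K1 : set gT) f A : is_subgroup K1 -> K `<=` K1 -> K1 `<=` G ->
  K1 f -> clopen A -> A <> setT ->
  exists f1 f2 A1 A2, [/\ f = f1 * f2, K1 f1 /\ K1 f2,
    [/\ clopen A1, A `<=` A1, A1 <> setT & supported act f1 A1]
    & [/\ clopen A2, A `<=` A2, A2 <> setT & supported act f2 A2]].
Proof.
move=> sK1 KK1 K1G K1f cA AT; have Gf := K1G _ K1f.
have [sf|] := pselect (supported act f A).
  exists 1, f, A, A; split; [by rewrite mul1g| | |by split].
    by split=> //; exact: subgroup1 sK1.
  by split=> // x _; exact: (ga_act1 HA x).
move=> /existsNP[p /not_implyP[nAp fp]].
have oA : open (~` A) by exact: clopen_openC.
have [q nAq qp] := perfect_avoid Xsep Xperf [:: p; act f p] oA (ex_intro _ p nAp).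
have [U [cU Up Uq]] : exists U, [/\ clopen U, U p & ~ U q].
  by apply: Xsep; apply: qp; rewrite !inE eqxx.
have [U' [cU' Up' Uq']] : exists U, [/\ clopen U, U (act f p) & ~ U q].
  by apply: Xsep; apply: qp; rewrite !inE eqxx orbT.
(* A small [V] around [p] is moved off itself outside [A], and the point [q] stays
   outside [A], [V] and [f V]; near [q] there is room for the support of [k]. *)
have oO : open (~` A `&` (U `&` act f @^-1` U')).
  apply: openI => //; apply: openI; apply: clopen_open => //.
  exact: (act_preimage_clopen Hloc HA).
have [V [cV Vp VO VV]] := moved_clopen Xbasis Xsep Hloc HA Gf oO (conj nAp (conj Up Up')) fp.
set W := act f @` V in VV; have cW : clopen W by exact: (clopen_act Hloc HA).
have WU y : W y -> U' y by case=> z /VO[_ [_ ?]] <-.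
have cR : clopen (~` A `\` (V `|` W)).
  by apply: clopenD; [exact: clopenC|exact: clopenU].
have R0 : (~` A `\` (V `|` W)) !=set0.
  by exists q; split=> // -[/VO[_ [/Uq]]|/WU/Uq'].
have [D1 [D2 [[cD1 cD2] [D10 D20] D1R D2R D12]]] :=
  split_open Xbasis Xsep Xperf (clopen_open cR) R0.
have [|k [Kk kV ks]] := derived_realize cV cW VV (act_iso V Gf) (clopen_open cD1) D10.
  by move=> x /D1R[].
have Gk := KG Kk.
exists k, (k^-1 * f), (A `|` (V `|` W `|` D1)), (~` V); split.
- by rewrite mulVKg.
- by split; [exact: KK1|apply: (subgroupM sK1) => //; apply: (subgroupV sK1); exact: KK1].
- split; [|by move=> x Ax; left| |].
  + by do ?apply: clopenU.
  + have [z D2z] := D20; move=> e; have : setT z by []; rewrite -e.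
    case=> [|[|D1z]]; first by case: (D2R _ D2z).
      by case: (D2R _ D2z).
    by have : (D1 `&` D2) z by []; rewrite D12.
  + by move=> x nx; apply: ks => ?; apply: nx; right.
- split; [exact: clopenC|by move=> x Ax /VO[]| |].
  + by move=> e; have : setT p by []; rewrite -e; apply.
  + move=> x /contrapT Vx; rewrite (ga_actM HA) //; last exact: GV.
    by rewrite -(kV x Vx) actK.
Qed.

(** The normal subgroup theorem for every group [K1] between [K] and [G].  A
    nontrivial [h] in [N] moves some clopen [B] off itself, so by Higman's trick
    commutators of elements supported in [B] lie in [N]; conjugating by
    [derived_compress], the same holds for pairs whose supports together miss an
    open set; fragmentation reduces every pair to such pairs. *)
Theorem normal_contains_commutators (K1 N : set gT) :
  is_subgroup K1 -> K `<=` K1 -> K1 `<=` G -> is_normal_subgroup K1 N ->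
  N <> [set 1] -> commutator_subgroup K1 `<=` N.
Proof.
move=> sK1 KK1 K1G nN N1; have [sN NK1 NJ] := nN.
have [h Nh h1] : exists2 h, N h & h <> 1.
  apply: contrapT => nh; apply: N1; rewrite eqEsubset; split=> [g Ng|_ ->].
    by apply: contrapT => g1; apply: nh; exists g.
  exact: subgroup1 sN.
have Gh : G h by exact/K1G/NK1.
have [p hp] : exists p, act h p <> p.
  apply: contrapT => /forallNP np; apply: h1; apply: (ga_faithful HA) => // x.
  by apply: contrapT; exact: np.
have [B [cB Bp _ BB]] := moved_clopen Xbasis Xsep Hloc HA Gh openT I hp.
(* Here [h] moves the support of [g] off that of [f]. *)
have inB f g : K1 f -> K1 g -> supported act f B -> supported act g B -> N [~ f, g].
  move=> K1f K1g sf sg.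
  have Nh' k : K1 k -> N (h^-1 ^ k) by move=> K1k; apply: NJ => //; exact: (subgroupV sN).
  apply: (higman_trick sK1 sN Nh' K1f K1g).
  apply: (commute_disjoint HA (A := B) (B := act h^-1 @^-1` B)); [exact: K1G| | |by []|].
  - by apply: (subgroupJ sG) => //; [exact: K1G|exact: GV].
  - rewrite -BB; congr (_ `&` _); rewrite eqEsubset; split=> [y By|_ [y By <-]] /=.
      by exists (act h^-1 y) => //; rewrite actVK.
    by rewrite actK.
  - by apply: (supportedJ HA) => //; [exact: K1G|exact: GV].
(* Compressing [E] into [B] conjugates the general case of a common proper support
   into the previous one. *)
have inE f g E : K1 f -> K1 g -> clopen E -> E <> setT ->
    supported act f E -> supported act g E -> N [~ f, g].
  move=> K1f K1g cE ET sf sg.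
  have [||||t [Kt _ tE]] := @derived_compress setT E B openT cE (clopen_open cB).
  - by [].
  - by [].
  - by exists p.
  - apply: contrapT => nE; apply: ET; rewrite eqEsubset; split=> // x _.
    by apply: contrapT => nEx; apply: nE; exists x.
  have K1t := KK1 _ Kt; have K1t' := subgroupV sK1 K1t.
  rewrite -[[~ f, g]](conjgK t^-1) invgK; apply: NJ => //; rewrite conjRg.
  have st k : K1 k -> supported act k E -> supported act (k ^ t^-1) B.
    move=> K1k sk x nBx; have [Gk Gt] := (K1G _ K1k, K1G _ K1t).
    apply: (supportedJ HA Gk (GV Gt) sk) => /= Ex; apply: nBx.
    by rewrite -(actVK Gt x); exact: tE.
  by apply: inB; try exact: st; apply: (subgroupJ sK1).
(* The pieces of [g] have their supports in proper sets containing that of [f]. *)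
have inA f g A : K1 f -> K1 g -> clopen A -> A <> setT ->
    supported act f A -> N [~ f, g].
  move=> K1f K1g cA AT sf.
  have [g1 [g2 [A1 [A2 [-> [K1g1 K1g2] [cA1 AA1 A1T s1] [cA2 AA2 A2T s2]]]]]] :=
    fragmentation sK1 KK1 K1G K1g cA AT.
  apply: (normal_commgM nN) => //.
    by apply: (inE _ _ A1) => // x nx; apply: sf => /AA1.
  by apply: (inE _ _ A2) => // x nx; apply: sf => /AA2.
apply: commutator_subgroup_min => // f g K1f K1g.
have nT : set0 <> [set: X] by move=> e; have : [set: X] p by []; rewrite -e.
have [f1 [f2 [A1 [A2 [-> [K1f1 K1f2] [cA1 _ A1T s1] [cA2 _ A2T s2]]]]]] :=
  fragmentation sK1 KK1 K1G K1f clopen0 nT.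
by apply: (normal_commMg nN) => //; [apply: (inA _ _ A1)|apply: (inA _ _ A2)].
Qed.

Hypothesis X0 : [set: X] !=set0.

(** If [f] moves [V] off itself and [g] is supported in [V], then [g] would be trivial
    if it commuted with [f]. *)
Lemma derived_noncommuting : exists f g, [/\ K f, K g & [~ f, g] <> 1].
Proof.
have [V [W [[cV cW] [V0 W0] _ _ VW]]] := split_open Xbasis Xsep Xperf openT X0.
have [V1 [V2 [[cV1 cV2] [V10 V20] V1V V2V V12]]] :=
  split_open Xbasis Xsep Xperf (clopen_open cV) V0.
have [||||f [Kf _ fV]] := @derived_compress setT V W openT cV (clopen_open cW).
- by [].
- by [].
- by [].
- by case: W0 => z Wz; exists z; split=> // Vz; have : (V `&` W) z by []; rewrite VW.
have [||||g [Kg gs gV]] :=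
  @derived_compress V V1 V2 (clopen_open cV) cV1 (clopen_open cV2).
- by [].
- by [].
- by [].
- case: V20 => z Vz; exists z; split; first exact: V2V.
  by move=> V1z; have : (V1 `&` V2) z by []; rewrite V12.
have [Gf Gg] := (KG Kf, KG Kg).
exists f, g; split=> // /eqP /commgP fg; have [x V1x] := V10.
have gx : act g x = x.
  apply: (act_inj Gf); rewrite -(ga_actM HA) // fg (ga_actM HA) // gs //.
  move=> Vfx; have Wfx : W (act f x) by apply/fV/V1V.
  by have : (V `&` W) (act f x) by []; rewrite VW.
have : (V1 `&` V2) x by split=> //; rewrite -gx; exact: gV.
by rewrite V12.
Qed.

Lemma derived_of_derived_neq1 : commutator_subgroup K <> [set 1].
Proof.
move=> e; have [f [g [Kf Kg]]] := derived_noncommuting; apply.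
have : commutator_subgroup K [~ f, g] by exact: sub_commutator_subgroup.
by rewrite e.
Qed.

Theorem derived_sub_normal (N : set gT) : is_normal_subgroup G N ->
  N <> [set 1] -> K `<=` N.
Proof. by move=> nN N1; exact: (normal_contains_commutators sG _ _ nN N1). Qed.

(** The subgroup [commutator_subgroup K] is characteristic in [K], hence normal in [G],
    and not trivial, so it contains [K]. *)
Theorem derived_perfect : K `<=` commutator_subgroup K.
Proof.
apply: derived_sub_normal; last exact: derived_of_derived_neq1.
split; first exact: commutator_subgroupP.
  by apply: subset_trans KG; exact: commutator_subgroup_sub.
move=> g x Gg; apply: commutator_subgroupJ => h Kh.
by apply: commutator_subgroupJ Kh => z Gz; apply: (subgroupJ sG).
Qed.

Theorem derived_simple (N : set gT) : is_normal_subgroup K N ->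
  N <> [set 1] -> N = K.
Proof.
move=> nN N1; have [_ NK _] := nN; rewrite eqEsubset; split=> //.
apply: subset_trans derived_perfect _.
exact: (normal_contains_commutators sK _ KG nN N1).
Qed.

Lemma transport_exists t f : embedding loc t -> G f ->
  exists2 f', G f' & transports act t f f'.
Proof.
move=> et Gf; have [t' tK] := embedding_linv et.
have cr : clopen (range t) by apply: embedding_image_clopen et clopenT.
pose F g := piecewise (range t) (fun y => t (act g (t' y))) id.
have FT g x : F g (t x) = t (act g x).
  by rewrite /F piecewise_in ?tK //; exists x.
have Fo g x : ~ range t x -> F g x = x by move=> nx; rewrite /F piecewise_out.
have lF g : G g -> forall x, loc (F g) x.
  move=> Gg; apply: germ_piecewise => // y; last by move=> _; exact: germ_id.
  have [ti tl tc] := et; case=> x _ <-.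
  have lt' : loc t' (t x) by apply: (germ_inv Hloc openT I) => // *; exact: tK.
  have lg : loc (act g) (t' (t x)) by exact: (ga_germ HA).
  have h := germ_comp Hloc lt' lg.
  exact: (germ_comp Hloc h (tl _)).
have FK g g' : cancel (act g) (act g') -> cancel (F g) (F g').
  move=> gg' x; have [[y _ <-]|nx] := pselect (range t x).
    by rewrite !FT gg'.
  by rewrite (Fo _ _ nx) Fo.
have [f' Gf' f'E] := fg_full HG (FK _ _ (actK Gf)) (FK _ _ (actVK Gf)) (lF _ Gf).
by exists f' => //; split=> x *; rewrite f'E ?FT // Fo.
Qed.

(** The elements of [G] whose transport lies in [K] form a subgroup, which contains all
    commutators. *)
Lemma transport_derived t f : embedding loc t -> K f ->
  exists2 f', K f' & transports act t f f'.
Proof.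
move=> et Kf.
pose N := [set g | G g /\ exists2 g', K g' & transports act t g g'].
suff /(_ f Kf)[] : K `<=` N by [].
apply: commutator_subgroup_min => [|g h Gg Gh].
  split=> [|g h [Gg [g' Kg' tg]] [Gh [h' Kh' th]]|g [Gg [g' Kg' tg]]].
  - by split=> //; exists 1; [exact: (subgroup1 sK)|exact: (transports_1 HA)].
  - split; first exact: GM.
    exists (g' * h'); first exact: (subgroupM sK).
    by apply: (transportsM HA) => //; exact: KG.
  - split; first exact: GV.
    exists g'^-1; first exact: (subgroupV sK).
    by apply: (transportsV HA) => //; exact: KG.
split; first exact: (subgroupR sG).
have [g' Gg' tg] := transport_exists et Gg.
have [h' Gh' th] := transport_exists et Gh.
exists [~ g', h']; first exact: sub_commutator_subgroup.
exact: (transportsR HA).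
Qed.

End FullGroups.

(** * The space of subsets of a group *)

Section SubsetSpace.
Context {gT : groupType}.
Implicit Types (H : subset_space gT) (T : set (subset_space gT)) (s : seq gT).

Definition agree s H1 H2 : Prop := forall f, f \in s -> H1 f = H2 f.

Lemma subset_space_nbhsP H (A : set (subset_space gT)) :
  nbhs H A <-> exists s, forall H', agree s H' H -> A H'.
Proof.
pose F : set_system (subset_space gT) :=
  filter_from [set: seq gT] (fun s => [set H' | agree s H' H]).
have FF : Filter F.
  apply: filter_from_filter; first by exists [::].
  move=> s1 s2 _ _; exists (s1 ++ s2) => // H' /= h.
  by split=> f fs; apply: h; rewrite mem_cat fs ?orbT.
split=> [|[s sA]].
  suff FH : F --> H by move=> /FH [s _ sA]; exists s.
  apply/cvg_sup => f B [U [[C oC CU] UH] UB].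
  exists [:: f] => // H' /(_ f); rewrite inE eqxx => /(_ isT) e; apply: UB.
  by rewrite -CU /= /proj e; move: UH; rewrite -CU.
apply: (filterS sA).
elim: s {A sA} => [|f s IH]; first by apply: filterS filterT => H' _ g.
have cf := @proj_continuous gT (fun _ => bool) f H.
have nf : nbhs H [set H' | H' f = H f].
  by apply: (cf [set b | b = H f]); rewrite nbhs_principalE; apply/principal_filterP.
apply: filterS2 nf IH => H' /= e h g.
by rewrite inE => /orP[/eqP->|/h].
Qed.

Lemma subset_space_closed T : closed T ->
  forall H, (forall s, exists2 H', T H' & agree s H' H) -> T H.
Proof.
move=> cT H h; apply: cT => B /subset_space_nbhsP[s sB].
by have [H' TH' a] := h s; exists H'; split=> //; exact: sB.
Qed.

Lemma closure_subset_spaceP T H :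
  closure T H <-> forall s, exists2 H', T H' & agree s H' H.
Proof.
split=> [cT s|h B /subset_space_nbhsP[s sB]].
  have [|H' [TH' a]] := cT [set H' | agree s H' H].
    by apply/subset_space_nbhsP; exists s.
  by exists H'.
by have [H' TH' a] := h s; exists H'; split=> //; exact: sB.
Qed.

End SubsetSpace.

(** * Coverings of a group by cosets *)

Section FiniteIndex.
Context {gT : groupType}.
Implicit Types (Q N : set gT).
Local Open Scope group_scope.

Definition finite_index Q : Prop :=
  exists C : seq gT, forall x, exists2 c, c \in C & Q (c^-1 * x).

(** B. H. Neumann's lemma.  If finitely many cosets of [Q 0, ..., Q n] cover the
    group but those of [Q n] alone do not, then some coset of [Q n] is covered by
    the others; translating, so is each coset of [Q n], and [Q n] can be dropped. *)
Lemma neumann_covering (n : nat) (Q : nat -> set gT) (L : seq (nat * gT)) :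
  (forall i, is_subgroup (Q i)) ->
  (forall x, exists2 p, p \in L & (p.1 < n)%N /\ Q p.1 (p.2^-1 * x)) ->
  exists2 i, (i < n)%N & finite_index (Q i).
Proof.
move=> sQ; elim: n L => [|n IH] L cov; first by have [? _ []] := cov 1.
pose Ln := [seq p.2 | p <- L & p.1 == n]; pose L' := [seq p <- L | (p.1 < n)%N].
have [cn|] := pselect (forall x, exists2 c, c \in Ln & Q n (c^-1 * x)).
  by exists n => //; exists Ln.
move=> /existsNP[y ncov].
have {}ncov c : c \in Ln -> ~ Q n (c^-1 * y).
  by move=> cL Qc; apply: ncov; exists c.
pose L2 := L' ++ [seq (p.1, d * y^-1 * p.2) | d <- Ln, p <- L'].
have [x|i ilt fi] := IH L2; last by exists i => //; exact: ltnW.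
have [[i c] pL /= []] := cov x; rewrite ltnS leq_eqVlt => /orP[/eqP ein|ilt] Qx.
  have cLn : c \in Ln.
    by apply/mapP; exists (i, c) => //; rewrite mem_filter pL ein eqxx.
  subst i; pose q := c^-1 * x.
  have [[i e] pL' /= []] := cov (y * q).
  rewrite ltnS leq_eqVlt => /orP[/eqP ein|ilt] Qe.
    have eLn : e \in Ln.
      by apply/mapP; exists (i, e) => //; rewrite mem_filter pL' ein eqxx.
    case: (ncov e eLn); subst i.
    have -> : e^-1 * y = e^-1 * (y * q) * q^-1 by rewrite mulgA mulgK.
    by apply: (subgroupM (sQ n)) => //; apply: (subgroupV (sQ n)).
  exists (i, c * y^-1 * e) => /=.
    rewrite mem_cat; apply/orP; right.
    apply/allpairsP; exists (c, (i, e)) => /=; split=> //.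
    by rewrite mem_filter /= ilt pL'.
  by split=> //; rewrite !invgM invgK -!mulgA.
exists (i, c) => //=; by rewrite mem_cat mem_filter /= ilt pL.
Qed.

(** The core of a subgroup of finite index is the kernel of an action on finitely
    many cosets; in an infinite simple group it cannot be trivial. *)
Lemma simple_no_finite_index Q :
  (forall N, is_normal_subgroup setT N -> N = [set 1] \/ N = setT) ->
  infinite_set [set: gT] -> is_subgroup Q -> finite_index Q -> Q = setT.
Proof.
move=> simple inf sQ [C covC].
pose N := [set g | forall x, Q (g ^ x)].
have nN : is_normal_subgroup setT N.
  split=> //; last by move=> g x _ Nx y; rewrite -conjgM.
  split=> [x|x y Nx Ny z|x Nx z]; first by rewrite conj1g; exact: subgroup1 sQ.
    by rewrite conjMg; apply: (subgroupM sQ).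
  by rewrite conjVg; apply: (subgroupV sQ).
have [N1|NT] := simple N nN; last first.
  rewrite eqEsubset; split=> // g _; rewrite -[g]conjg1.
  by have : N g by rewrite NT.
case: inf.
have ltC x : (find (fun c => `[< Q (c^-1 * x)%g >]) C < size C)%N.
  by rewrite -has_find; apply/hasP; have [c cC Qc] := covC x; exists c => //; apply/asboolP.
pose phi g : (size C).-tuple 'I_(size C) :=
  [tuple Ordinal (ltC (g * tnth (in_tuple C) i)) | i < size C].
have phi_inj : injective phi.
  move=> g h e; have : N (g^-1 * h).
    move=> x; have [c cC Qc] := covC x.
    have [i ci] : exists i, tnth (in_tuple C) i = c.
      by have /tnthP[i ->] : c \in in_tuple C by []; exists i.
    have Qgh : Q ((g^-1 * h) ^ c).
      have /(congr1 val) /= : tnth (phi g) i = tnth (phi h) i by rewrite e.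
      rewrite !tnth_mktuple /= ci => ef.
      have := @nth_find _ 1 (fun b => `[< Q (b^-1 * (g * c)) >]) C.
      have := @nth_find _ 1 (fun b => `[< Q (b^-1 * (h * c)) >]) C.
      rewrite !has_find !ltC ef => /(_ isT)/asboolP Qh /(_ isT)/asboolP Qg.
      have := subgroupM sQ (subgroupV sQ Qg) Qh.
      by rewrite conjgE !invgM invgK -!mulgA mulVKg.
    rewrite -[x](mulVKg c) conjgM conjgE.
    by do ?apply: (subgroupM sQ) => //; apply: (subgroupV sQ).
  by rewrite N1 /= => /mulg1_eq; rewrite invgK.
apply: (@sub_finite_set _ _ ((fun t => xget 1 [set g | phi g = t]) @` setT)).
  move=> g _; exists (phi g) => //; apply: phi_inj.
  by apply: (@xgetPex _ 1 [set z | phi z = phi g]); exists g.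
by apply: finite_image; exact: finite_finset.
Qed.

End FiniteIndex.

(** * Uniformly recurrent subgroups of compressing actions *)

Section Separation.
Context {X : topologicalType}.
Hypotheses (Xbasis : clopen_basis X) (Xsep : clopen_separated X) (Xperf : perfect X).

Lemma nbhs_forall_seq (I : eqType) (s : seq I) (x : X) (A : I -> set X) :
  (forall i, i \in s -> nbhs x (A i)) ->
  nbhs x [set y | forall i, i \in s -> A i y].
Proof.
elim: s => [_|i s IH h]; first by apply: filterS filterT => y _ i.
apply: filterS2 (h i (mem_head _ _)) (IH _) => [y Ay Asy j|j js].
  by rewrite inE => /orP[/eqP->|/Asy].
by apply: h; rewrite inE js orbT.
Qed.

Lemma clopen_nbhs (x : X) (A : set X) : nbhs x A ->
  exists V, [/\ clopen V, V x & V `<=` A].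
Proof.
rewrite nbhsE => -[U [oU Ux] UA]; have [V [cV Vx VU]] := Xbasis oU Ux.
by exists V; split=> //; exact: subset_trans UA.
Qed.

Lemma separated_nbhs (s : seq X) : exists V : X -> set X,
  (forall x, clopen (V x) /\ V x x) /\
  (forall x y, x \in s -> y \in s -> x <> y -> V x `&` V y = set0).
Proof.
have /choice[S SP] : forall p : X * X, exists S : set X,
    p.1 <> p.2 -> [/\ clopen S, S p.1 & ~ S p.2].
  move=> [x y]; have [<-|/eqP /Xsep[S HS]] := eqVneq x y; first by exists set0.
  by exists S.
pose N x := [set z | forall y, y \in s -> x <> y -> S (x, y) z /\ ~ S (y, x) z].
have nN x : nbhs x (N x).
  apply: nbhs_forall_seq => y ys; have [<-|/eqP xy] := eqVneq x y.
    by apply: filterS filterT.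
  have [c1 S1 _] := SP (x, y) xy; have [c2 _ S2] := SP (y, x) (nesym xy).
  apply: filterS (open_nbhs_nbhs (conj (openI (clopen_open c1) (clopen_openC c2))
    (conj S1 S2))).
  by move=> z [].
have /choice[V VP] : forall x, exists V, [/\ clopen V, V x & V `<=` N x].
  by move=> x; exact: clopen_nbhs.
exists V; split=> [x|x y xs ys xy]; first by have [] := VP x.
rewrite -subset0 => z [Vx Vy]; have [_ _ Nx] := VP x; have [_ _ Ny] := VP y.
by have [Sz _] := Nx _ Vx y ys xy; have [_] := Ny _ Vy x xs (nesym xy).
Qed.

End Separation.

Section URS.
Context {X : topologicalType}.
Hypotheses (Xbasis : clopen_basis X) (Xsep : clopen_separated X) (Xperf : perfect X).
Variable loc : (X -> X) -> X -> Prop.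
Hypotheses (Hloc : germs loc) (Hpi : purely_infinite loc).
Context {gT : groupType} (act : gT -> X -> X).
Implicit Types (A B C O V W : set X) (x y z : X) (f g h k : gT).
Local Open Scope group_scope.

(** What the classification of uniformly recurrent subgroups uses of the derived
    subgroup of a full group: it is isolated here because that subgroup need not itself
    be full. *)
Record compressing_action : Prop := CompressingAction {
  ca_action : germ_action loc setT act;
  ca_compress : forall A B C, open A -> clopen B -> open C -> B `<=` A ->
    C `<=` A -> C !=set0 -> (A `\` B) !=set0 ->
    exists k, supported act k A /\ forall x, B x -> C (act k x);
  ca_fragment : forall f, exists f1 f2 A1 A2, [/\ f = f1 * f2,
    clopen A1 /\ clopen A2, A1 <> setT /\ A2 <> setT,
    supported act f1 A1 & supported act f2 A2];
  ca_transport : forall t f, embedding loc t -> exists f', transports act t f f';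
  ca_perfect : commutator_subgroup [set: gT] = setT;
  ca_simple : forall N : set gT, is_normal_subgroup setT N -> N = [set 1] \/ N = setT
}.

Hypothesis HK : compressing_action.
Let HA := ca_action HK.
Let actK g : cancel (act g) (act g^-1) := actK HA (I : setT g).
Let actVK g : cancel (act g^-1) (act g) := actVK HA (I : setT g).
Let act_inj g : injective (act g) := act_inj HA (I : setT g).
Let actM g h x : act (g * h) x = act g (act h x) :=
  ga_actM HA x (I : setT g) (I : setT h).
Let act_eq g h : act g =1 act h -> g = h := act_eq HA (I : setT g) (I : setT h).
Let act_clopen g A : clopen A -> clopen (act g @^-1` A) :=
  act_preimage_clopen Hloc HA (I : setT g).

(** The rigid stabilizer of [A]. *)
Definition rist A : set gT := [set g | supported act g A].

Lemma rist_sub A B : A `<=` B -> rist A `<=` rist B.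
Proof. by move=> AB g sg x nB; apply: sg => /AB. Qed.

Lemma ristJ g h A : rist A g -> rist (act h @^-1` A) (g ^ h).
Proof. exact: (supportedJ HA I I). Qed.

Lemma supported_stable g A x : rist A g -> A x -> A (act g x).
Proof.
move=> sg Ax; apply: contrapT => nA.
by have /act_inj e : act g (act g x) = act g x by [exact: sg]; rewrite e in nA.
Qed.

Lemma act_open_nbhs g x A : clopen A -> A (act g x) -> nbhs x (act g @^-1` A).
Proof.
move=> cA Agx; apply: open_nbhs_nbhs; split=> //.
by apply: clopen_open; exact: act_clopen.
Qed.

(** The rigid stabilizers of the complements of [V] and [W] together generate the group:
    inside the group that they generate, [V] can be pushed into the complement of any
    proper clopen [E], by an element supported off [W] if that complement is not
    contained in [W], and otherwise by moving [V] first off [V] and [W] and then, with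
    an element supported off [V], into the complement of [E].  So the rigid stabilizer
    of [E] is conjugate there into that of the complement of [V]. *)
Lemma rist_generate (H : set gT) V W : is_subgroup H -> clopen V -> clopen W ->
  V `&` W = set0 -> (~` (V `|` W)) !=set0 -> rist (~` V) `<=` H ->
  rist (~` W) `<=` H -> H = setT.
Proof.
move=> sH cV cW VW U0 HV HW.
have nVW x : V x -> ~ W x by move=> Vx Wx; suff : set0 x by []; rewrite -VW.
have rE E : clopen E -> E <> setT -> rist E `<=` H.
  move=> cE ET g gE; have oE := clopen_openC cE.
  have E0 : (~` E) !=set0.
    by apply: contrapT => /nonemptyPn e; apply: ET; rewrite -[E]setCK e setC0.
  suff [m Hm mV] : exists2 m, H m & forall x, V x -> ~ E (act m x).
    rewrite -[g](conjgK m); apply: (subgroupJ sH); last exact: (subgroupV sH).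
    have EV : act m @^-1` E `<=` ~` V by move=> x Ex /mV.
    by apply: HV; apply: (rist_sub EV); exact: ristJ.
  have oW := clopen_openC cW; have oV := clopen_openC cV.
  have [EW0|] := pselect ((~` E `&` ~` W) !=set0).
    have [||||k [sk kV]] := ca_compress HK oW cV (openI oE oW).
    - exact: nVW.
    - by move=> x [].
    - by [].
    - by case: U0 => z nz; exists z; split=> Hz; apply: nz; [right|left].
    by exists k => [|x /kV[]//]; exact: HW.
  move=> /nonemptyPn EW.
  have EsW x : ~ E x -> W x.
    by move=> nE; apply: contrapT => nW; have : set0 x by rewrite -EW.
  have oU : open (~` (V `|` W)) by apply: clopen_openC; exact: clopenU.
  have [||||k1 [sk1 k1V]] := ca_compress HK oW cV oU.
  - exact: nVW.
  - by move=> x nx Wx; apply: nx; right.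
  - by [].
  - by case: U0 => z nz; exists z; split=> Hz; apply: nz; [right|left].
  have [||||k2 [sk2 k2V]] := ca_compress HK oV (act_clopen k1^-1 cV) oE.
  - by move=> x /k1V; rewrite actVK => nx Vx; apply: nx; left.
  - by move=> x /EsW Wx /nVW.
  - by [].
  - case: E0 => z nE; exists z; split=> [/nVW|/k1V]; first by apply; exact: EsW.
    by rewrite actVK; apply; right; exact: EsW.
  exists (k2 * k1); first by apply: (subgroupM sH); [exact: HV|exact: HW].
  by move=> x Vx; rewrite actM; apply: k2V; rewrite /= actK.
rewrite eqEsubset; split=> // f _.
have [f1 [f2 [A1 [A2 [-> [c1 c2] [T1 T2] s1 s2]]]]] := ca_fragment HK f.
by apply: (subgroupM sH); [exact: (rE A1)|exact: (rE A2)].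
Qed.

(** Choose for every [f] in turn a point [p f] that it moves, avoiding the finitely many
    points that would make two of the [p f] and their images coincide, then one more
    point [z] in the same way; small neighbourhoods of these points do.  The set [D]
    around [z] bounds supports away from a fixed nonempty open set later on. *)
Lemma spread_out (F : seq gT) : [set: X] !=set0 -> (forall f, f \in F -> f <> 1) ->
  exists (U : gT -> set X) (D : set X), [/\
    forall f, f \in F -> clopen (U f) /\ U f !=set0,
    forall f g x, f \in F -> g \in F -> U f x -> U g x -> f = g,
    forall f g x, f \in F -> g \in F -> U f x -> ~ U g (act f x),
    clopen D /\ D !=set0
    & forall f g x, f \in F -> g \in F -> D x -> ~ U g x /\ ~ U g (act f x)].
Proof.
move=> X0 F1.
have [p [pm pp pf]] : exists p : gT -> X,
    [/\ forall f, f \in F -> act f (p f) <> p f,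
      forall f g, f \in F -> g \in F -> f <> g -> p f <> p g
      & forall f g, f \in F -> g \in F -> act f (p f) <> p g].
  elim: F F1 => [_|f F IH F1]; first by case: X0 => x _; exists (fun=> x).
  have [|p [pm pp pf]] := IH; first by move=> g gF; apply: F1; rewrite inE gF orbT.
  have [fF|nfF] := boolP (f \in F).
    have E g : g \in f :: F -> g \in F by rewrite inE => /orP[/eqP->|].
    by exists p; split=> *; [apply: pm|apply: pp|apply: pf]; try exact: E.
  have [x fx] : exists x, act f x <> x.
    apply: contrapT => /forallNP h; apply: (F1 f (mem_head _ _)).
    apply: (ga_faithful HA) => // x; apply: contrapT; exact: h.
  have [V [cV Vx _ VV]] := moved_clopen Xbasis Xsep Hloc HA (I : setT f) openT I fx.
  (* The last part of the list keeps [act f z] off the earlier points. *)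
  pose L := [seq p g | g <- F] ++ [seq act g (p g) | g <- F]
    ++ [seq act f^-1 (p g) | g <- F].
  have [z Vz zL] := perfect_avoid Xsep Xperf L (clopen_open cV) (ex_intro _ x Vx).
  have fz : act f z <> z.
    by move=> e; have : set0 z by rewrite -VV; split=> //; exists z.
  have L1 g : g \in F -> p g <> z.
    by move=> gF; apply: zL; rewrite mem_cat map_f.
  have L2 g : g \in F -> act g (p g) <> z.
    by move=> gF; apply: zL; rewrite !mem_cat (map_f (fun g => act g (p g)) gF) orbT.
  have L3 g : g \in F -> act f z <> p g.
    move=> gF e; apply: (zL (act f^-1 (p g))); last by rewrite -e actK.
    by rewrite !mem_cat (map_f (fun g => act f^-1 (p g)) gF) !orbT.
  exists (fun g => if g == f then z else p g); split.
  - move=> g; rewrite inE; case: eqVneq => [->//|_ /= gF]; exact: pm.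
  - move=> g h; rewrite !inE; case: eqVneq => [->|_] /=; case: eqVneq => [->//|_] /=.
    + by move=> _ hF _; apply/nesym/L1.
    + by move=> gF _ _; exact: L1.
    + exact: pp.
  - move=> g h; rewrite !inE; case: eqVneq => [->|_] /=; case: eqVneq => [->//|_] /=.
    + by move=> _ hF; exact: L3.
    + by move=> gF _; exact: L2.
    + exact: pf.
have [z _ zL] := perfect_avoid Xsep Xperf
  ([seq p g | g <- F] ++ [seq act f^-1 (p g) | f <- F, g <- F]) openT X0.
have z1 g : g \in F -> p g <> z by move=> gF; apply: zL; rewrite mem_cat map_f.
have z2 f g : f \in F -> g \in F -> act f z <> p g.
  move=> fF gF e; apply: (zL (act f^-1 (p g))); last by rewrite -e actK.
  rewrite mem_cat; apply/orP; right; apply/allpairsP; by exists (f, g).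
pose s := z :: [seq p g | g <- F] ++ [seq act f (p f) | f <- F] ++ [seq act f z | f <- F].
have sp g : g \in F -> p g \in s.
  by move=> gF; rewrite inE mem_cat map_f ?orbT.
have sf g : g \in F -> act g (p g) \in s.
  by move=> gF; rewrite inE !mem_cat (map_f (fun f => act f (p f)) gF) !orbT.
have sz g : g \in F -> act g z \in s.
  by move=> gF; rewrite inE !mem_cat (map_f (fun f => act f z) gF) !orbT.
have sz0 : z \in s by rewrite inE eqxx.
have [V [VP VV]] := separated_nbhs Xbasis Xsep s.
have disj x y w : x \in s -> y \in s -> x <> y -> V x w -> V y w -> False.
  by move=> xs ys xy Vx Vy; have := VV x y xs ys xy; rewrite -subset0 => /(_ w); apply.
have [D [cD Dz DV]] : exists D, [/\ clopen D, D z &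
    D `<=` [set w | V z w /\ forall f, f \in F -> V (act f z) (act f w)]].
  apply: clopen_nbhs => //; apply: filterI.
    by have [cV Vz] := VP z; apply: open_nbhs_nbhs; split=> //; exact: clopen_open.
  apply: nbhs_forall_seq => f fF; have [cV Vz] := VP (act f z).
  exact: act_open_nbhs.
exists (fun f => V (p f) `&` act f @^-1` V (act f (p f))), D; split.
- move=> f fF; have [c1 v1] := VP (p f); have [c2 v2] := VP (act f (p f)).
  by split; [apply: clopenI => //; exact: act_clopen|exists (p f)].
- move=> f g x fF gF [Vf _] [Vg _]; apply: contrapT => fg.
  by apply: (disj (p f) (p g) x) => //; [exact: sp|exact: sp|exact: pp].
- move=> f g x fF gF [_ Vf] [Vg _].
  by apply: (disj (act f (p f)) (p g) (act f x)) => //; [exact: sf|exact: sp|exact: pf].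
- by split=> //; exists z.
- move=> f g x fF gF /DV[Vz Vf]; split=> -[Vg _].
    by apply: (disj z (p g) x) => //; [exact: sp|exact/nesym/z1].
  apply: (disj (act f z) (p g) (act f x)) => //; [exact: sz|exact: sp|exact: z2|].
  exact: Vf.
Qed.

Lemma multi_transport (F : seq gT) (t : gT -> X -> X) q :
  (forall f, f \in F -> embedding loc (t f)) ->
  (forall f g x y, f \in F -> g \in F -> t f x = t g y -> f = g) ->
  exists c, (forall f x, f \in F -> act c (t f x) = t f (act q x)) /\
    (forall x, (forall f, f \in F -> ~ range (t f) x) -> act c x = x).
Proof.
elim: F => [_ _|f F IH et dt]; first by exists 1; split=> // x _; exact: (ga_act1 HA).
have [||c [cF cs]] := IH.
- by move=> g gF; apply: et; rewrite inE gF orbT.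
- by move=> g h x y gF hF; apply: dt; rewrite inE ?gF ?hF orbT.
have [fF|nfF] := boolP (f \in F).
  exists c; split=> [g x|x nx]; first by rewrite inE => /orP[/eqP->|]; exact: cF.
  by apply: cs => g gF; apply: nx; rewrite inE gF orbT.
have [b [tb sb]] := ca_transport HK q (et f (mem_head _ _)).
exists (b * c); split=> [g x|x nx].
  rewrite inE => /orP[/eqP->|gF]; rewrite actM.
    rewrite cs ?tb // => h hF [y _ yx].
    have e : h = f by apply: (dt h f y x) => //; rewrite inE ?eqxx ?hF ?orbT.
    by rewrite e (negbTE nfF) in hF.
  rewrite cF // sb // => -[y _ yx].
  have e : f = g by apply: (dt f g y (act q x)) => //; rewrite inE ?eqxx ?gF ?orbT.
  by rewrite e gF in nfF.
rewrite actM cs ?sb //; first by apply: nx; rewrite mem_head.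
by move=> g gF; apply: nx; rewrite inE gF orbT.
Qed.

Hypothesis X0 : [set: X] !=set0.

Lemma compress_into B O : clopen B -> B <> setT -> open O -> O !=set0 ->
  exists k, forall x, B x -> O (act k x).
Proof.
move=> cB BT oO O0; have [||||k [_ kB]] := ca_compress HK openT cB oO; last by exists k.
- by [].
- by [].
- by [].
- apply: contrapT => /nonemptyPn e; apply: BT; rewrite eqEsubset; split=> // x _.
  by apply: contrapT => nB; have : set0 x by rewrite -e.
Qed.

Lemma clopen_around x O : open O -> O x ->
  exists V, [/\ clopen V, V x, V `<=` O & V <> setT].
Proof.
move=> oO Ox; have [y [_ yx]] := Xperf openT (I : setT x).
have [U [cU Ux Uy]] := Xsep (nesym yx).
have [V [cV Vx VO]] := Xbasis (openI oO (clopen_open cU)) (conj Ox Ux).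
exists V; split=> // [z /VO[]//|e]; have : V y by rewrite e.
by move=> /VO[].
Qed.

(** Compressing neighbourhoods of one point into disjoint places makes its orbit
    infinite. *)
Lemma gT_infinite : infinite_set [set: gT].
Proof.
move=> /finite_seqP[s sE]; have [x0 _] := X0.
pose l := [seq act g x0 | g <- s].
have lP g : act g x0 \in l.
  by apply: (map_f (fun g => act g x0)); have : [set` s] g by rewrite -sE.
have [z _ zl] := perfect_avoid Xsep Xperf l openT X0.
have [V [VP VV]] := separated_nbhs Xbasis Xsep (z :: l).
have [B [cB Bx _ BT]] := clopen_around openT (I : setT x0).
have [cV Vz] := VP z.
have [k kB] := compress_into cB BT (clopen_open cV) (ex_intro _ z Vz).
have [_ Vk] := VP (act k x0).
have := VV z (act k x0); rewrite -subset0 => /(_ _ _ _ (act k x0)); apply.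
- exact: mem_head.
- by rewrite inE lP orbT.
- exact/nesym/zl.
- by split=> //; exact: kB.
Qed.

Lemma gT_nontrivial : exists g : gT, g <> 1.
Proof.
apply: contrapT => /forallNP h; apply: gT_infinite.
suff -> : [set: gT] = [set 1] by exact: finite_set1.
by rewrite eqEsubset; split=> // g _; apply: contrapT; exact: h.
Qed.

Section Confined.
Variable T : set (subset_space gT).
Hypotheses (T_sub : T `<=` @Sub_space gT) (T_closed : closed T)
  (T_conj : conj_invariant T) (T_ntriv : ~ T (fun f => f == 1)).
Implicit Type H : subset_space gT.

Let sub H : T H -> is_subgroup [set f | H f] := fun TH => T_sub TH.

(** A basic neighbourhood of the trivial subgroup that misses the closed set [T] is
    given by finitely many elements. *)
Lemma uniformly_nontrivial : exists F : seq gT,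
  (forall f, f \in F -> f <> 1) /\ forall H, T H -> exists2 f, f \in F & H f.
Proof.
have [s sP] : exists s, forall H, T H -> ~ agree s H (fun f => f == 1).
  apply: contrapT => /forallNP h; apply: T_ntriv.
  apply: (subset_space_closed T_closed) => s.
  by have /existsNP[H /not_implyP[TH /contrapT a]] := h s; exists H.
exists [seq f <- s | f != 1]; split=> [f|H TH].
  by rewrite mem_filter => /andP[/eqP].
have /existsNP[f /not_implyP[fs Hf]] := sP _ TH.
have f1 : f != 1.
  apply/eqP => e; apply: Hf; rewrite e eqxx.
  by have := subgroup1 (sub TH).
exists f; first by rewrite mem_filter f1.
by move: Hf; rewrite (negbTE f1); case: (H f).
Qed.

(** The key step.  With [U f] as in [spread_out], let [c q] act as [q] on a copy of
    the whole space inside every [U f].  For each [q] some [f] in the finite set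
    satisfies [H (f ^ c q)].  The quotient of two [q] with the same [f] is realized
    in [H] on the copy inside [U f], because [f] moves [U f] off all the copies; so by
    Neumann's lemma the elements realized there have finite index for some [f]. *)
Lemma confined_realizes : exists E, [/\ clopen E, E <> setT &
  forall H, T H -> exists2 t, embedding loc t & forall q, exists h,
    [/\ H h, forall x, act h (t x) = t (act q x) & supported act h E]].
Proof.
have [F [F1 FT]] := uniformly_nontrivial.
have [U [D [UP Udisj Uoff [cD D0] DU]]] := spread_out X0 F1.
exists (~` D); split; first exact: clopenC.
  by move=> e; case: D0 => x Dx; have : (~` D) x by rewrite e.
move=> H TH; have sH := sub TH.
have /choice[t tP] : forall f, exists t, f \in F -> embedding loc t /\ range t `<=` U f.
  move=> f; have [fF|_] := boolP (f \in F); last by exists id.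
  have [cU U0] := UP f fF; have [t et tU] := Hpi (clopen_open cU) U0.
  by exists t.
have tU f x : f \in F -> U f (t f x) by move=> /tP[_]; apply; exists x.
have et f : f \in F -> embedding loc (t f) by move=> /tP[].
have dt f g x y : f \in F -> g \in F -> t f x = t g y -> f = g.
  by move=> fF gF e; apply: (Udisj f g (t f x) fF gF); [|rewrite e]; exact: tU.
have /choice[c cP] : forall q, exists c,
    (forall f x, f \in F -> act c (t f x) = t f (act q x)) /\
    (forall x, (forall f, f \in F -> ~ range (t f) x) -> act c x = x).
  by move=> q; exact: multi_transport.
have coff q x : (forall f, f \in F -> ~ U f x) -> act (c q) x = x.
  by move=> nU; apply: (cP q).2 => f fF [y _ yx]; apply: (nU f fF); rewrite -yx; exact: tU.
have cV q f x : f \in F -> act (c q)^-1 (t f x) = t f (act q^-1 x).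
  by move=> fF; apply: (@act_inj (c q)); rewrite actVK (cP q).1 // actVK.
have cVoff q x : (forall f, f \in F -> ~ U f x) -> act (c q)^-1 x = x.
  by move=> nU; apply: (@act_inj (c q)); rewrite actVK coff.
(* [P f] collects the elements realized by [H] on the copy [t f], and the classes
   [Y f], which cover the group, have their quotients [q^-1 * q'] in [P f]. *)
pose P f := [set q | exists h, [/\ H h, forall x, act h (t f x) = t f (act q x)
  & supported act h (~` D)]].
have sP f : is_subgroup (P f).
  split=> [|q q' [h [Hh hq hs]] [h' [Hh' hq' hs']]|q [h [Hh hq hs]]].
  - by exists 1; split=> [|x|x _]; [exact: (subgroup1 sH)| |];
      rewrite ?(ga_act1 HA).
  - exists (h * h'); split=> [|x|x nx]; first exact: (subgroupM sH Hh Hh').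
      by rewrite !actM hq' hq.
    by rewrite actM hs' // hs.
  - exists h^-1; split=> [|x|x nx]; first exact: (subgroupV sH Hh).
      by apply: (@act_inj h); rewrite actVK hq actVK.
    by apply: (@act_inj h); rewrite actVK hs.
pose Y f := [set q | H (f ^ c q)].
have YP f q q' : f \in F -> Y f q -> Y f q' -> P f (q^-1 * q').
  move=> fF Yq Yq'; exists ((f ^ c q)^-1 * (f ^ c q')).
  split; first exact: (subgroupM sH (subgroupV sH Yq) Yq').
    move=> x; rewrite !conjgE !invgM invgK !actM (cP q').1 //.
    have Ufx : U f (t f (act q' x)) by exact: tU.
    have off g : g \in F -> ~ U g (act f (t f (act q' x))) by move=> gF; exact: Uoff.
    by rewrite (cVoff q') // (coff q) // actK cV.
  move=> x /contrapT Dx; rewrite !conjgE !invgM invgK !actM.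
  have off1 g : g \in F -> ~ U g x by move=> gF; case: (DU f g x fF gF Dx).
  have off2 g : g \in F -> ~ U g (act f x) by move=> gF; case: (DU f g x fF gF Dx).
  by rewrite (coff q') // (cVoff q') // (coff q) // actK cVoff.
have Ycov q : exists2 f, f \in F & Y f q.
  by have [f fF Hf] := FT _ (T_conj (c q) TH); exists f.
have /choice[r rP] : forall f, exists r, forall q, Y f q -> Y f r.
  move=> f; have [[r Yr]|nY] := pselect (exists r, Y f r); first by exists r.
  by exists 1 => q Yq; case: nY; exists q.
pose L := [seq (index f F, r f) | f <- F].
have [|i iF fi] := @neumann_covering gT (size F) (fun i => P (nth 1 F i)) L (fun=> sP _).
  move=> q; have [f fF Yf] := Ycov q; exists (index f F, r f); first exact: map_f.
  by rewrite /= index_mem fF nth_index //; split=> //; apply: YP => //; exact: rP Yf.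
set f := nth 1 F i in fi; have fF : f \in F by exact: mem_nth.
have PT : P f = setT.
  exact: simple_no_finite_index (ca_simple HK) gT_infinite (sP f) fi.
by exists (t f); [exact: et|move=> q; have : P f q by rewrite PT].
Qed.

(** [H] is conjugated into a position where the set [E] of [confined_realizes], which
    is the same for all members of [T], lies in [O]. *)
Lemma confined_small H O : T H -> open O -> O !=set0 ->
  exists h, [/\ H h, h <> 1 & supported act h O].
Proof.
move=> TH oO O0; have [E [cE ET EP]] := confined_realizes.
have [k kE] := compress_into cE ET oO O0; have [q q1] := gT_nontrivial.
have [t et tP] := EP _ (T_conj k^-1 TH); have [h [Hh hq hs]] := tP q.
exists (h ^ k^-1); split=> //.
  move=> e; apply: q1; apply: act_eq => x; rewrite (ga_act1 HA).
  have h1 : h = 1 by rewrite -[h](conjgK k^-1) e conj1g.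
  by have [ti _ _] := et; apply: ti; rewrite -hq h1 (ga_act1 HA).
apply: rist_sub (ristJ hs) => x /= /kE; by rewrite actVK.
Qed.

(** Higman's trick inside the copy [Kt] of the group carried by [range t].  A small
    element [h] of [H], supported in [range t], has the same conjugates under [Kt] as
    under elements of [H], so they lie in [H].  If [B] is moved off itself by [h], the
    commutators of elements of [Kt] supported in [B] lie in [H]; since the group is
    perfect, so do all its copies inside [B]. *)
Lemma confined_contains_copy H : T H -> exists B, [/\ clopen B, B !=set0 &
  forall r q f, embedding loc r -> range r `<=` B -> transports act r q f -> H f].
Proof.
move=> TH; have sH := sub TH; have [E [cE ET EP]] := confined_realizes.
have [t et tP] := EP _ TH.
have crt : clopen (range t) by apply: (embedding_image_clopen Hloc et); exact: clopenT.
have [|h [Hh h1 hs]] := confined_small TH (clopen_open crt).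
  by case: X0 => x _; exists (t x); exists x.
have [p hp] : exists p, act h p <> p.
  apply: contrapT => /forallNP np; apply: h1; apply: (ga_faithful HA) => // x.
  by apply: contrapT; exact: np.
have rp : range t p by apply: contrapT => /hs.
have [B [cB Bp Bt BB]] :=
  moved_clopen Xbasis Xsep Hloc HA (I : setT h) (clopen_open crt) rp hp.
pose Kt := [set f | exists q, transports act t q f].
have sKt : is_subgroup Kt.
  split=> [|f g [q tf] [q' tg]|f [q tf]].
  - by exists 1; exact: (transports_1 HA).
  - by exists (q * q'); exact: (transportsM HA).
  - by exists q^-1; exact: (transportsV HA).
have HJ f : Kt f -> H (h ^ f).
  move=> [q [tf sf]]; have [k [Hk kq _]] := tP q.
  have -> : h ^ f = h ^ k.
    have kr x : range t (act k x) -> range t x.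
      by case=> y _ e; exists (act q^-1 y) => //; apply: (@act_inj k); rewrite kq actVK.
    apply: act_eq => x; rewrite !conjgE !actM.
    have [[y _ <-]|nx] := pselect (range t x).
      rewrite tf kq; have [z _ <-] : range t (act h (t (act q y))).
        by apply: (supported_stable hs); exists (act q y).
      have -> : t z = t (act q (act q^-1 z)) by rewrite actVK.
      by rewrite -tf actK tf -kq actK.
    rewrite (sf x nx) (hs x nx) hs; last by move=> /kr.
    by rewrite actK -[in LHS](sf x nx) actK.
  exact: (subgroupJ sH Hh Hk).
have comm f g : Kt f -> Kt g -> supported act f B -> supported act g B -> H [~ f, g].
  move=> Kf Kg sf sg; apply: (@higman_trick _ Kt [set f | H f] f g h^-1 sKt sH) => //.
    by move=> k Kk; rewrite conjVg; apply: (subgroupV sH); exact: HJ.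
  apply: (commute_disjoint HA (A := B) (B := act h^-1 @^-1` B)) => //.
    rewrite -BB; congr (_ `&` _); rewrite eqEsubset.
    split=> [y By|_ [y By <-]] /=; last by rewrite actK.
    by exists (act h^-1 y) => //; rewrite actVK.
  exact: ristJ.
exists B; split=> // [|r q f er rB tf]; first by exists p.
have [t' tK] := embedding_linv et.
have tt' x : t (t' (r x)) = r x.
  by have /rB/Bt[y _ <-] : range r (r x) by []; rewrite tK.
have ew : embedding loc (t' \o r).
  have [ri rl rc] := er; have [ti tl tc] := et; split.
  - by move=> x y /= e; apply: ri; rewrite -(tt' x) -(tt' y) e.
  - move=> x; apply: (germ_comp Hloc (rl x)); rewrite -(tt' x).
    by apply: (germ_inv Hloc openT I) => // *; exact: tK.
  - have -> : range (t' \o r) = t @^-1` (range r).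
      rewrite eqEsubset; split=> [_ [x _ <-]|x [y _ yx]] /=; first by exists x.
      by exists y => //=; rewrite yx tK.
    apply: (germ_preimage_clopen Hloc tl _).2.
    by apply: (embedding_image_clopen Hloc er); exact: clopenT.
(* A copy of the group along [r] factors through the one along [t], so that it lies
   in [Kt]. *)
have lift q' : exists g, [/\ Kt g, transports act r q' g & supported act g B].
  have [a [wa sa]] := ca_transport HK q' ew; have [g [tg sg]] := ca_transport HK a et.
  have tr : transports act r q' g.
    split=> [x|x nx]; first by rewrite -tt' tg wa /= tt'.
    have [[y _ yx]|] := pselect (range t x); last exact: sg.
    rewrite -yx tg sa // => -[z _ zy]; apply: nx; exists z => //.
    by rewrite -yx -zy /= tt'.
  exists g; split=> //; first by exists a.
  by move=> x nB; apply: tr.2 => /rB.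
pose N := [set q | exists g, H g /\ transports act r q g].
have /(_ q I)[g [Hg tg]] : [set: gT] `<=` N.
  rewrite -(ca_perfect HK); apply: commutator_subgroup_min => [|a b _ _].
    split=> [|a b [g [Hg tg]] [g' [Hg' tg']]|a [g [Hg tg]]].
    - by exists 1; split; [exact: (subgroup1 sH)|exact: (transports_1 HA)].
    - exists (g * g'); split; first exact: (subgroupM sH Hg Hg').
      exact: (transportsM HA).
    - by exists g^-1; split; [exact: (subgroupV sH Hg)|exact: (transportsV HA)].
  have [g [Kg tg sg]] := lift a; have [g' [Kg' tg' sg']] := lift b.
  by exists [~ g, g']; split; [exact: comm|exact: (transportsR HA)].
by rewrite (transport_uniq HA I I tf tg).
Qed.

(** Let [B] be as in [confined_contains_copy] and [C] a clopen proper part of it.  The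
    embedding [r] that fixes [C] and squeezes the rest of the space into [B] carries
    every element supported in [C] to itself. *)
Lemma confined_contains_rist H : T H ->
  exists C, [/\ clopen C, C !=set0 & rist C `<=` [set f | H f]].
Proof.
move=> TH; have [B [cB B0 BP]] := confined_contains_copy TH.
have [C [P [[cC cP] [C0 P0] CB PB CP]]] :=
  split_open Xbasis Xsep Xperf (clopen_open cB) B0.
have [e ee eP] := Hpi (clopen_open cP) P0; have [ei el ec] := ee.
exists C; split=> // a sa.
pose r := piecewise C id e.
have rC x : C x -> r x = x by move=> Cx; rewrite /r piecewise_in.
have rN x : ~ C x -> r x = e x by move=> nC; rewrite /r piecewise_out.
have nCe x : ~ C (e x).
  move=> Cx; have : (C `&` P) (e x) by split=> //; apply: eP; exists x.
  by rewrite CP.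
have er : embedding loc r.
  split.
  - move=> x y; have [Cx|nCx] := pselect (C x); have [Cy|nCy] := pselect (C y).
    + by rewrite !rC.
    + by rewrite (rC x) // (rN y) // => xe; case: (nCe y); rewrite -xe.
    + by rewrite (rN x) // (rC y) // => xe; case: (nCe x); rewrite xe.
    + by rewrite !rN // => /ei.
  - by apply: (germ_piecewise Hloc) => // x _; exact: germ_id.
  - have -> : range r = C `|` (e @` (~` C)).
      rewrite eqEsubset; split=> [_ [x _ <-]|x [Cx|[y nC <-]]].
      + have [Cx|nC] := pselect (C x); first by rewrite rC //; left.
        by rewrite rN //; right; exists x.
      + by exists x => //; rewrite rC.
      + by exists y => //; rewrite rN.
    apply: (clopenU cC _).2; apply: (embedding_image_clopen Hloc ee).
    exact: clopenC.
apply: (BP r a a er).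
  move=> _ [x _ <-]; have [Cx|nC] := pselect (C x); first by rewrite rC //; exact: CB.
  by rewrite rN //; apply: PB; apply: eP; exists x.
split=> x; last by move=> nr; apply: sa => Cx; apply: nr; exists x => //; rewrite rC.
have [Cx|nC] := pselect (C x).
  by rewrite (rC x) // rC //; exact: (supported_stable sa).
by rewrite (rN x) // (sa x nC) rN // sa.
Qed.

Hypothesis T0 : T !=set0.

Lemma confined_contains_big_rist O : open O -> O !=set0 ->
  exists2 H, T H & rist (~` O) `<=` [set f | H f].
Proof.
move=> oO O0; have [H TH] := T0; have [C [cC [c Cc] CH]] := confined_contains_rist TH.
have [|k kC] := compress_into (clopen_compl cC) _ oO O0.
  by move=> e; have : (~` C) c by rewrite e.
exists (conj_sub k H); first exact: T_conj.
move=> g sg; apply: CH; apply: rist_sub (ristJ sg) => x /= nO.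
by apply: contrapT => /kC.
Qed.

Hypothesis T_proper : ~ T (fun=> true).

(** If [H] contains the rigid stabilizer of the complement of a small neighbourhood
    [V] of a regular point, it contains every stabilizing element of a given finite
    set; and it contains no other element [f] of that set, since otherwise it would
    contain the rigid stabilizers of the complements of [V] and [f V]. *)
Lemma confined_stabilizer x0 :
  (forall g, act g x0 = x0 -> nbhs x0 [set y | act g y = y]) ->
  T (stabilizer act x0).
Proof.
move=> reg; apply: (subset_space_closed T_closed) => s.
have [z _ zs] := perfect_avoid Xsep Xperf (x0 :: [seq act f x0 | f <- s]) openT X0.
have zx0 : x0 <> z by apply: zs; rewrite mem_head.
have zf f : f \in s -> act f x0 <> z.
  by move=> fs; apply: zs; rewrite inE (map_f (fun f => act f x0) fs) orbT.
have [Z [cZ Zx Zz]] := Xsep zx0.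
have /choice[S SP] : forall f, exists S, f \in s -> act f x0 <> x0 ->
    [/\ clopen S, S x0, ~ S (act f x0) & nbhs x0 [set y | act f y <> z]].
  move=> f; have [fs|_] := boolP (f \in s); last by exists set0.
  have [e|fx] := pselect (act f x0 = x0); first by exists set0.
  have [S [cS Sx Sf]] := Xsep (nesym fx); exists S => _ _; split=> //.
  have [U [cU Uf Uz]] := Xsep (zf f fs).
  by apply: filterS (act_open_nbhs cU Uf) => y /= Uy e; apply: Uz; rewrite -e.
(* Points near [x0] that [f] treats as it treats [x0]; [z] is a point left outside [V]
   and [f V]. *)
pose A f := [set y | (act f x0 = x0 -> act f y = y) /\
  (act f x0 <> x0 -> [/\ S f y, ~ S f (act f y) & act f y <> z])].
have nA f : f \in s -> nbhs x0 (A f).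
  move=> fs; have [e|fx] := pselect (act f x0 = x0).
    by apply: filterS (reg f e) => y fy; split=> // /(_ e).
  have [cS Sx Sf nz] := SP f fs fx.
  have n1 : nbhs x0 (S f).
    by apply: open_nbhs_nbhs; split=> //; exact: clopen_open.
  have n2 := act_open_nbhs (clopen_compl cS) Sf.
  apply: filterS (filterI (filterI n1 n2) nz) => y [[? ?] ?].
  by split=> [/fx//|_]; split.
have [V [cV Vx VA]] : exists V, [/\ clopen V, V x0 &
    V `<=` Z `&` [set y | forall f, f \in s -> A f y]].
  apply: clopen_nbhs => //; apply: filterI; last exact: nbhs_forall_seq.
  by apply: open_nbhs_nbhs; split=> //; exact: clopen_open.
have [H TH VH] := confined_contains_big_rist (clopen_open cV) (ex_intro _ x0 Vx).
exists H => // f fs; rewrite /stabilizer; case: eqP => [fx|fx].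
  apply: VH => y /contrapT Vy; by have [_ /(_ f fs)[/(_ fx)]] := VA y Vy.
apply/negP => Hf; apply: T_proper; have sH := sub TH.
have cW : clopen (act f^-1 @^-1` V) by exact: act_clopen.
have HT : [set f | H f] = setT.
  apply: (rist_generate sH cV cW); rewrite -?subset0.
  - move=> y [Vy Vfy]; have [_ /(_ f fs)[_ /(_ fx)[Sy _ _]]] := VA y Vy.
    by have [_ /(_ f fs)[_ /(_ fx)[_]]] := VA _ Vfy; rewrite actVK.
  - exists z => -[/VA[/Zz]//|/= Vfz].
    by have [_ /(_ f fs)[_ /(_ fx)[_ _]]] := VA _ Vfz; rewrite actVK.
  - exact: VH.
  - move=> g sg; rewrite /= -[g](conjgK f).
    apply: (subgroupJ sH); last exact: (subgroupV sH Hf).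
    apply: VH; apply: rist_sub (ristJ sg) => y /= nV Vy; apply: nV.
    by rewrite actK.
suff <- : H = fun=> true by [].
by apply/funext => g; have : [set f | H f] g by rewrite HT.
Qed.

End Confined.

Section StabilizerURS.
Variable x0 : X.
Hypothesis reg : forall g, act g x0 = x0 -> nbhs x0 [set y | act g y = y].
Implicit Types (H : subset_space gT) (T : set (subset_space gT)).

Let stab : X -> subset_space gT := stabilizer act.
Let orbit : set (subset_space gT) := [set stab (act g x0) | g in setT].
(* The stabilizer uniformly recurrent subgroup, as the orbit closure of the stabilizer
   of a regular point. *)
Let S : set (subset_space gT) := closure orbit.

Lemma conj_stabilizer g x : conj_sub g (stab x) = stab (act g x).
Proof.
apply/funext => h; rewrite /conj_sub /stab /stabilizer conjgE !actM.
by apply/eqP/eqP => [{2}<-|->]; rewrite ?actVK ?actK.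
Qed.

Lemma stab_sub x : Sub_space (stab x).
Proof.
rewrite /Sub_space /stab /stabilizer /=; split=> [|g h /= /eqP gx /eqP hx|g /= /eqP gx].
- by rewrite /= (ga_act1 HA).
- by rewrite /= actM hx gx.
- by rewrite /= -{1}gx actK.
Qed.

(** At the regular point the stabilizer map is continuous, so compressing the two
    halves of a clopen partition into a small neighbourhood of [x0] shows that
    every limit of stabilizers has the stabilizer of [x0] in its orbit closure. *)
Lemma stabilizer_in_orbit_closure H T : closed T -> conj_invariant T -> T H ->
  closure (range stab) H -> T (stab x0).
Proof.
move=> cT iT TH /closure_subset_spaceP CH; apply: (subset_space_closed cT) => s.
have [V [cV Vx VP]] : exists V, [/\ clopen V, V x0 & V `<=`
    [set y | forall f, f \in s -> stab y f = stab x0 f]].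
  apply: clopen_nbhs => //; apply: nbhs_forall_seq => f fs.
  rewrite /stab /stabilizer; case: (eqVneq (act f x0) x0) => [fx|/eqP fx].
    by apply: filterS (reg fx) => y /= fy; apply/eqP.
  have [U [cU Ux Uf]] := Xsep (nesym fx).
  have n1 : nbhs x0 U by apply: open_nbhs_nbhs; split=> //; exact: clopen_open.
  apply: filterS (filterI n1 (act_open_nbhs (clopen_compl cU) Uf)) => y /= [Uy nUy].
  by apply/eqP => e; rewrite e in nUy.
have [B [cB Bx _ BT]] := clopen_around openT (I : setT x0).
have V0 : V !=set0 by exists x0.
have [k1 k1B] := compress_into cB BT (clopen_open cV) V0.
have BT' : ~` B <> setT by move=> e; have : (~` B) x0 by rewrite e.
have [k2 k2B] := compress_into (clopen_compl cB) BT' (clopen_open cV) V0.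
have [_ [y _ <-] yH] := CH ([seq f ^ k1 | f <- s] ++ [seq f ^ k2 | f <- s]).
have main k : (forall f, f \in s -> stab y (f ^ k) = H (f ^ k)) -> V (act k y) ->
    exists2 H', T H' & agree s H' (stab x0).
  move=> a Vky; exists (conj_sub k H); first exact: iT.
  move=> f fs; rewrite /conj_sub -a // -(VP _ Vky f fs).
  by rewrite -conj_stabilizer.
have [By|nBy] := pselect (B y).
  by apply: (main k1); [move=> f fs; apply: yH;
    rewrite mem_cat (map_f (fun f => f ^ k1) fs)|exact: k1B].
apply: (main k2); last exact: k2B.
by move=> f fs; apply: yH; rewrite mem_cat (map_f (fun f => f ^ k2) fs) orbT.
Qed.

Lemma orbit_range : orbit `<=` range stab.
Proof. by move=> _ [g _ <-]; exists (act g x0). Qed.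

Lemma closed_conj_contains_S T : closed T -> conj_invariant T -> T (stab x0) -> S `<=` T.
Proof.
move=> cT iT Tx; rewrite (closure_id T).1 //; apply: closureS.
by move=> _ [g _ <-]; rewrite -conj_stabilizer; exact: iT.
Qed.

Lemma S_stab : S (stab x0).
Proof. by apply: subset_closure; exists 1 => //; rewrite (ga_act1 HA). Qed.

Lemma S_conj : conj_invariant S.
Proof.
move=> g H /closure_subset_spaceP SH; apply/closure_subset_spaceP => s.
have [_ [h _ <-] a] := SH [seq f ^ g | f <- s].
exists (stab (act (g * h) x0)); first by exists (g * h).
rewrite actM -conj_stabilizer => f fs; rewrite /conj_sub; apply: a.
exact: (map_f (fun f => f ^ g)).
Qed.

Lemma S_closed : closed S. Proof. exact: closed_closure. Qed.

Lemma S_urs : is_urs S.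
Proof.
split.
- move=> H /closure_subset_spaceP SH; split=> [|f g /= Hf Hg|f /= Hf].
  + have [_ [h _ <-] a] := SH [:: 1]; rewrite /= -a ?inE //.
    by have [] := stab_sub (act h x0).
  + have [_ [h _ <-] a] := SH [:: f; g; f * g]; move: Hf Hg.
    rewrite -!a ?inE ?eqxx ?orbT //.
    by have [_ sM _] := stab_sub (act h x0); exact: sM.
  + have [_ [h _ <-] a] := SH [:: f; f^-1]; move: Hf.
    rewrite -!a ?inE ?eqxx ?orbT //.
    by have [_ _ sV] := stab_sub (act h x0); exact: sV.
- by exists (stab x0); exact: S_stab.
- exact: S_closed.
- exact: S_conj.
- move=> T TS [H TH] cT iT; rewrite eqEsubset; split=> //.
  apply: closed_conj_contains_S => //.
  apply: (stabilizer_in_orbit_closure cT iT TH).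
  by apply: closureS (TS _ TH); exact: orbit_range.
Qed.

Lemma urs_eq_S T : is_urs T -> T (stab x0) -> T = S.
Proof.
move=> [_ T0' cT iT minT] Tx; apply/esym/minT; last 2 first.
- exact: S_closed.
- exact: S_conj.
- exact: closed_conj_contains_S.
- by exists (stab x0); exact: S_stab.
Qed.

Lemma urs_singleton T H : is_urs T -> T H -> (forall g, conj_sub g H = H) -> T = [set H].
Proof.
move=> [Tsub T0' cT iT minT] TH gH; apply/esym/minT; last 2 first.
- move=> H' cH; apply/funext => f.
  by have /closure_subset_spaceP/(_ [:: f])[_ -> /(_ f (mem_head _ _))] := cH.
- by move=> g _ ->; rewrite gH.
- by move=> _ ->.
- by exists H.
Qed.

Theorem stabilizer_urs_classification : exists S,
  is_stabilizer_urs act S /\ forall T, is_nontrivial_urs T <-> T = S.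
Proof.
exists S; split.
  split; [exact: S_urs|by apply: closureS; exact: orbit_range|].
  move=> T uT TC; apply: urs_eq_S => //; have [_ [H TH] cT iT _] := uT.
  by apply: (stabilizer_in_orbit_closure cT iT TH); exact: TC.
move=> T; split=> [[uT T1 TT]|->].
  apply: urs_eq_S => //; have [Tsub T0' cT iT _] := uT.
  apply: confined_stabilizer => // TH.
    by apply: T1; apply: urs_singleton => // g; apply/funext => f;
      rewrite /conj_sub conjg_eq1.
  by apply: TT; apply: urs_singleton.
split; first exact: S_urs.
  (* The stabilizer of [x0] is not trivial: it contains an element moving a part of
     a clopen set that misses [x0]. *)
  have [y [_ yx]] := Xperf openT (I : setT x0).
  have [U [cU Uy Ux]] := Xsep yx.
  have [V [W [[cV cW] [V0 W0] VU WU VW]]] :=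
    split_open Xbasis Xsep Xperf (clopen_open cU) (ex_intro _ y Uy).
  have disj z : V z -> W z -> False.
    by move=> Vz Wz; have : set0 z by rewrite -VW.
  have [||k [sk kV]] := ca_compress HK (clopen_open cU) cV (clopen_open cW) VU WU.
  - by [].
  - by case: W0 => z Wz; exists z; split; [exact: WU|move=> /disj; apply].
  move=> e; have := S_stab; rewrite e => /(congr1 (fun H => H k)).
  rewrite /stab /stabilizer (sk x0 Ux) eqxx => /esym/eqP k1.
  case: V0 => z Vz; apply: (disj z) => //.
  by have := kV z Vz; rewrite k1 (ga_act1 HA).
(* It is not the whole group: some element moves a neighbourhood of [x0] off itself. *)
have [B [cB Bx _ BT]] := clopen_around openT (I : setT x0).
have [|k kB] := compress_into cB BT (clopen_openC cB).
  apply: contrapT => /nonemptyPn h; apply: BT.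
  by rewrite -[B]setCK h setC0.
move=> e; have := S_stab; rewrite e => /(congr1 (fun H => H k)).
rewrite /stab /stabilizer => /eqP kx.
by have := kB x0 Bx; rewrite kx; apply.
Qed.

End StabilizerURS.

End URS.

(** * Finite and infinite paths *)

Section FinitePaths.
Context {k : nat} {L : kgraph k}.
Implicit Types (m n p q : degree k) (l a b : mor L).
Local Open Scope ring_scope.

Lemma deg_addI p q r : p + q = p + r -> q = r :> degree k.
Proof.
move=> e; apply/ffunP => i; have /ffunP/(_ i) := e.
by rewrite !ffunE; exact: addnI.
Qed.

Lemma le_degE p q : le_deg p q -> exists r, q = p + r.
Proof. by move=> pq; exists (sub_deg q p); rewrite sub_degK. Qed.

Lemma le_deg_addl p q : le_deg p (q + p).
Proof. by rewrite addrC le_deg_addr. Qed.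

(** The factorization of a path into an initial segment of degree [n] and the
    rest; a junk pair when the path is too short. *)
Definition cut n l : mor L * mor L :=
  xget (l, l) [set ab | [/\ l = comp ab.1 ab.2, deg ab.1 = n & src ab.1 = rng ab.2]].

Lemma cutP n l : le_deg n (deg l) ->
  [/\ l = comp (cut n l).1 (cut n l).2, deg (cut n l).1 = n
    & src (cut n l).1 = rng (cut n l).2].
Proof.
move=> nl; have e : deg l = n + sub_deg (deg l) n by rewrite sub_degK.
have [ab [[abl abn _ abs] _]] := factorization e.
by apply: (@xgetPex _ (l, l) [set ab | [/\ l = comp ab.1 ab.2, deg ab.1 = n
  & src ab.1 = rng ab.2]]); exists ab.
Qed.

Lemma comp_inj a b a' b' : src a = rng b -> src a' = rng b' -> deg a = deg a' ->
  comp a b = comp a' b' -> a = a' /\ b = b'.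
Proof.
move=> s s' d e; have dE : deg (comp a b) = deg a + deg b by exact: deg_comp.
have db : deg b' = deg b.
  by apply: (@deg_addI (deg a)); rewrite [in LHS]d -!deg_comp // e.
have [ab [_ abU]] := factorization dE.
have e1 : ab = (a, b) by exact: abU.
have e2 : ab = (a', b') by apply: abU.
by move: e2; rewrite e1 => -[].
Qed.

Lemma cut_comp a b : src a = rng b -> cut (deg a) (comp a b) = (a, b).
Proof.
move=> s; have [|e d s'] := @cutP (deg a) (comp a b).
  by rewrite deg_comp // le_deg_addr.
have [e1 e2] := comp_inj s s' (esym d) e.
by rewrite [LHS]surjective_pairing -e1 -e2.
Qed.

Lemma cut_compE n a b : src a = rng b -> deg a = n -> cut n (comp a b) = (a, b).
Proof. by move=> s <-; exact: cut_comp. Qed.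

Lemma cut_deg n l : le_deg n (deg l) -> deg l = n + deg (cut n l).2.
Proof. by move=> nl; have [e d s] := cutP nl; rewrite [in LHS]e deg_comp // d. Qed.

End FinitePaths.

Section InfinitePaths.
Context {k : nat} {L : kgraph k}.
Implicit Types (m n p q : degree k) (l a b : mor L) (x y z : infpath L).
Local Open Scope ring_scope.

Definition seg x n : mor L := segment x (le0_deg n).

Lemma deg_seg x n : deg (seg x n) = n. Proof. exact: segment_deg. Qed.

Lemma rng_seg x n : rng (seg x n) = start x.
Proof. by rewrite /seg /segment fmor_rng. Qed.

Lemma src_seg x n : src (seg x n) = start (shift n x).
Proof. by rewrite /seg /segment fmor_src /start /= add0r. Qed.

Lemma seg_add x p q : seg x (p + q) = comp (seg x p) (seg (shift p x) q).
Proof.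
rewrite /seg /segment /= /segment -fmor_comp; last first.
  by rewrite /= /omega_src /omega_rng /= add0r.
congr fmor; apply: val_inj.
by rewrite [RHS]omega_compE /omega_src /omega_rng /= ?add0r // addrC.
Qed.

Lemma src_seg_rng x p q : src (seg x p) = rng (seg (shift p x) q).
Proof. by rewrite rng_seg src_seg. Qed.

Lemma path_ext x y : (forall n, seg x n = seg y n) -> x = y.
Proof.
move=> xy; apply: kgraph_functor_eq => -[[p q] pq] /=.
have E z : cut p (seg z q) = (seg z p, segment z pq).
  have -> : seg z q = comp (seg z p) (segment z pq).
    rewrite /seg /segment -fmor_comp //; congr fmor; apply: val_inj.
    by rewrite [RHS]omega_compE.
  by rewrite cut_compE ?deg_seg // /segment /seg /segment fmor_rng fmor_src.
by have := E x; rewrite xy E => -[_ /esym].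
Qed.

Lemma seg_le x y p q : le_deg p q -> seg x q = seg y q -> seg x p = seg y p.
Proof. exact: segment_eq. Qed.

Lemma seg0 x : seg x 0 = idm (start x).
Proof.
rewrite -(rng_seg x 0) /seg /segment fmor_rng -fmor_idm.
by congr fmor; apply: val_inj.
Qed.

Lemma shift0 x : shift 0 x = x.
Proof.
apply: path_ext => n; have := seg_add x 0 n; rewrite add0r seg0 => ->.
have -> : start x = rng (seg (shift 0 x) n).
  by rewrite rng_seg -src_seg seg0 src_idm.
by rewrite comp_idl.
Qed.

Lemma shift_shift p q x : shift p (shift q x) = shift (q + p) x.
Proof.
apply: path_ext => n; have := seg_add x (q + p) n.
rewrite -addrA !seg_add => e.
have s1 : src (seg x q) = rng (seg (shift q x) p) by exact: src_seg_rng.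
have s2 := src_seg_rng (shift q x) p n.
have s3 : src (seg (shift q x) p) = rng (seg (shift (q + p) x) n).
  by rewrite -src_seg_rng seg_add src_comp.
rewrite compA // in e.
have [||//|//] := comp_inj _ _ _ e.
- by rewrite src_comp.
- by rewrite src_comp.
Qed.

(** The value at [(p, q)] of the functor is what remains of the path of degree [q] after
    cutting off the initial segment of degree [p]; uniqueness of factorizations makes it
    a functor. *)
Lemma path_of_segments (f : degree k -> mor L) : (forall n, deg (f n) = n) ->
  (forall p q, le_deg p q -> (cut p (f q)).1 = f p) ->
  exists x, forall n, seg x n = f n.
Proof.
move=> df cf.
have fP p q : le_deg p q -> [/\ f q = comp (f p) (cut p (f q)).2,
    src (f p) = rng (cut p (f q)).2 & deg (cut p (f q)).2 = sub_deg q p].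
  move=> pq; have [|e _ s] := @cutP k L p (f q); first by rewrite df.
  rewrite -(cf p q pq); split=> //.
  apply: (@deg_addI k p); rewrite sub_degK // -{2}(df q) -cut_deg ?df //.
pose mo (a : omega_mor k) := (cut (val a).1 (f (val a).2)).2.
have leP (a : omega_mor k) : le_deg (val a).1 (val a).2 by case: a.
have h1 (a : mor (Omega k)) : rng (mo a) = src (f (omega_rng a)).
  by have [_ <-] := fP _ _ (leP a).
have h2 (a : mor (Omega k)) : src (mo a) = src (f (omega_src a)).
  by have [e s _] := fP _ _ (leP a); rewrite [in RHS]e src_comp.
have h3 (v : vertex (Omega k)) : mo (omega_id v) = idm (src (f v)).
  have e : f v = comp (f v) (idm (src (f v))) by rewrite comp_idr.
  by rewrite /mo /= {1}e cut_compE ?rng_idm.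
have h4 (a b : mor (Omega k)) : omega_src a = omega_rng b ->
    mo (omega_comp a b) = comp (mo a) (mo b).
  move=> ab; rewrite /mo omega_compE //=.
  have [e1 s1 _] := fP _ _ (leP a); have [e2 s2 _] := fP _ _ (leP b).
  have ab' : (val a).2 = (val b).1 := ab; rewrite -ab' in e2 s2 *.
  set X := (cut (val a).1 _).2 in e1 s1 *; set Y := (cut (val a).2 _).2 in e2 s2 *.
  have sXY : src X = rng Y by rewrite -s2 e1 src_comp.
  have -> : f (val b).2 = comp (f (val a).1) (comp X Y).
    by rewrite e2 {1}e1 compA.
  by rewrite cut_compE //= rng_comp.
have h5 (a : mor (Omega k)) : deg (mo a) = omega_deg a.
  by have [_ _ ->] := fP _ _ (leP a).
exists (@KGraphFunctor k (Omega k) L (fun v => src (f v)) mo h1 h2 h3 h4 h5) => n.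
rewrite /seg /segment /= /mo /=.
have e : f n = comp (idm (rng (f n))) (f n) by rewrite comp_idl.
by rewrite {1}e cut_compE ?src_idm // deg_idm.
Qed.

(** The segment of degree [p] of the path [l x] is cut from [l] followed by the segment
    of degree [p] of [x], which is long enough. *)
Lemma prefixed_exists l x : src l = start x -> exists y, prefixed l x y.
Proof.
move=> lx; pose f p := (cut p (comp l (seg x p))).1.
have sx p : src l = rng (seg x p) by rewrite rng_seg.
have lef p : le_deg p (deg (comp l (seg x p))).
  by rewrite deg_comp // deg_seg le_deg_addl.
have df n : deg (f n) = n by have [_ ->] := cutP (lef n).
have ff p q a b : comp l (seg x q) = comp a b -> src a = rng b -> deg a = p ->
    le_deg p q -> f p = a.
  move=> e s d /le_degE[r qE]; have [e1 e2 s1] := cutP (lef p).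
  have sp : src (seg x p) = rng (seg (shift p x) r) by exact: src_seg_rng.
  have sc : src (cut p (comp l (seg x p))).2 = rng (seg (shift p x) r).
    by rewrite -sp -(src_comp (sx p)) [in RHS]e1 src_comp.
  move: e; rewrite qE seg_add compA // e1 -compA // => e.
  by have [] := comp_inj _ s _ e; rewrite ?d ?e2 // rng_comp.
have [|y yf] := path_of_segments df.
  move=> p q pq; have [e d s] := cutP (lef q); rewrite -/(f q) in e d s.
  have [|e' d' s'] := @cutP k L p (f q); first by rewrite df.
  apply/esym/(ff p q _ (comp (cut p (f q)).2 (cut q (comp l (seg x q))).2)) => //.
    rewrite compA // -?e' //.
    by rewrite -s [in RHS]e' src_comp.
  by rewrite rng_comp // -s [in RHS]e' src_comp.
exists y.
have fl n : f (deg l + n) = comp l (seg x n).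
  apply: (ff _ (deg l + n) _ (seg (shift n x) (deg l))).
  - by rewrite addrC seg_add compA //; exact: src_seg_rng.
  - by rewrite src_comp // (src_seg_rng _ _ (deg l)).
  - by rewrite deg_comp // deg_seg.
  - exact: le_deg_refl.
have y0 : seg y (deg l) = l.
  rewrite yf -[deg l]addr0 fl.
  by rewrite seg0 -lx comp_idr.
split=> //; apply: path_ext => n.
have := seg_add y (deg l) n; rewrite yf fl y0 => /comp_inj[] //.
  by rewrite -{1}y0 -src_seg_rng.
Qed.

Definition pre l x : infpath L := xget x [set y | prefixed l x y].

Lemma preP l x : src l = start x -> prefixed l x (pre l x).
Proof. by move=> /prefixed_exists ex; exact: (@xgetPex _ x [set y | prefixed l x y]). Qed.

Lemma seg_pre_deg l x : src l = start x -> seg (pre l x) (deg l) = l.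
Proof. by move=> /preP[]. Qed.

Lemma shift_pre l x : src l = start x -> shift (deg l) (pre l x) = x.
Proof. by move=> /preP[]. Qed.

Lemma seg_pre l x n : src l = start x -> seg (pre l x) (deg l + n) = comp l (seg x n).
Proof. by move=> lx; rewrite seg_add seg_pre_deg // shift_pre. Qed.

Lemma start_pre l x : src l = start x -> start (pre l x) = rng l.
Proof. by move=> lx; rewrite -(rng_seg _ (deg l)) seg_pre_deg. Qed.

Lemma path_ext_shift n x y : seg x n = seg y n -> shift n x = shift n y -> x = y.
Proof.
move=> s t; apply: path_ext => m; apply: (@seg_le _ _ _ (n + m)).
  exact: le_deg_addl.
by rewrite !seg_add s t.
Qed.

Lemma pre_seg n x : pre (seg x n) (shift n x) = x.
Proof.
have s : src (seg x n) = start (shift n x) by exact: src_seg.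
have e1 := seg_pre_deg s; have e2 := shift_pre s; rewrite deg_seg in e1 e2.
exact: path_ext_shift e1 e2.
Qed.

Lemma pre_idm x : pre (idm (start x)) x = x.
Proof. by have := pre_seg 0 x; rewrite seg0 shift0. Qed.

Lemma prefixedE l x y : prefixed l x y <-> src l = start x /\ y = pre l x.
Proof.
split=> [[lx s t]|[lx ->]]; last exact: preP.
split=> //; apply: (@path_ext_shift (deg l)); last by rewrite t shift_pre.
by rewrite seg_pre_deg.
Qed.

Lemma pre_comp a b x : src a = rng b -> src b = start x ->
  pre (comp a b) x = pre a (pre b x).
Proof.
move=> ab bx; have s : src (comp a b) = start x by rewrite src_comp.
have s' : src a = start (pre b x) by rewrite start_pre.
apply: (@path_ext_shift (deg a + deg b)).
  by rewrite -{1}deg_comp // seg_pre_deg // seg_pre // seg_pre_deg.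
by rewrite -{1}deg_comp // shift_pre // -shift_shift !shift_pre.
Qed.

Lemma cylinder_pre l y : cylinder l y <-> exists2 x, src l = start x & y = pre l x.
Proof.
split=> [[x e /prefixedE[? ->]]|[x e ->]]; first by exists x.
by exists x => //; exact: preP.
Qed.

Lemma cylinder_seg l y : cylinder l y <-> seg y (deg l) = l.
Proof. exact: cylinderE. Qed.

End InfinitePaths.

(** * The path space and its prefix changes *)

Section PathTopology.
Context {k : nat} {L : kgraph k}.
Implicit Types (n p q : degree k) (l a b : mor L) (x y z : infpath L).
Implicit Types (O A : set (infpath L)) (f t : infpath L -> infpath L).
Local Open Scope ring_scope.

Lemma cylinder_open l : open (cylinder l).
Proof.
exists [set cylinder l]; first by move=> _ ->; exists l.
by rewrite bigcup_set1.
Qed.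

Lemma open_pathP O : open O <->
  forall x, O x -> exists n, forall y, seg y n = seg x n -> O y.
Proof.
split=> [[D DR <-] x [C DC Cx]|h].
  have [l _ lC] := DR C DC; exists (deg l) => y yx; exists C => //=.
  rewrite /= -lC; apply/cylinder_seg; rewrite yx; apply/cylinder_seg.
  by rewrite lC.
rewrite openE => x /h[n nP]; rewrite /interior nbhsE /=.
exists (cylinder (seg x n)); last first.
  by move=> y /cylinder_seg; rewrite deg_seg; exact: nP.
by split; [exact: cylinder_open|apply/cylinder_seg; rewrite deg_seg].
Qed.

Lemma cylinder_clopen l : clopen (cylinder l).
Proof.
split; first exact: cylinder_open.
rewrite -[cylinder l]setCK closedC; apply/open_pathP => x nx.
exists (deg l) => y yx /cylinder_seg ly; apply: nx; apply/cylinder_seg.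
by rewrite -yx.
Qed.

Lemma path_clopen_basis : clopen_basis (infpath L).
Proof.
move=> x A /open_pathP oA /oA[n nP]; exists (cylinder (seg x n)).
split; [exact: cylinder_clopen|by apply/cylinder_seg; rewrite deg_seg|].
by move=> y /cylinder_seg; rewrite deg_seg; exact: nP.
Qed.

Lemma path_clopen_separated : clopen_separated (infpath L).
Proof.
move=> x y xy; have [n nP] : exists n, seg x n <> seg y n.
  by apply: contrapT => /forallNP h; apply: xy; apply: path_ext => n; apply: contrapT.
exists (cylinder (seg x n)); split; first exact: cylinder_clopen.
  by apply/cylinder_seg; rewrite deg_seg.
by move=> /cylinder_seg; rewrite deg_seg => e; apply: nP.
Qed.

Lemma path_perfect : isolated [set: infpath L] = set0 -> perfect (infpath L).
Proof.
move=> iso x A oA Ax; apply: contrapT => /forallNP h.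
suff : isolated [set: infpath L] x by rewrite iso.
split; first by rewrite inE.
exists A; first exact: open_nbhs_nbhs.
rewrite setIT eqEsubset; split=> [y Ay|_ -> //].
by apply: contrapT => yx; apply: (h y).
Qed.

Definition swaps_prefix f x a b : Prop :=
  [/\ src a = src b, cylinder b x & forall y, src b = start y -> f (pre b y) = pre a y].

(** The germs that form the groupoid of tail equivalence with lag on the path space. *)
Definition prefix_germ f x : Prop := exists a b, swaps_prefix f x a b.

Lemma swaps_prefix_extend f x a b n : swaps_prefix f x a b ->
  let l := seg (shift (deg b) x) n in
  swaps_prefix f x (comp a l) (comp b l) /\ src b = rng l.
Proof.
move=> [ab /cylinder_pre[z bz xz] fP] l.
have lz : l = seg z n by rewrite /l xz shift_pre.
have bl : src b = rng l by rewrite lz rng_seg.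
have al : src a = rng l by rewrite ab.
split=> //; split; first by rewrite !src_comp.
  apply/cylinder_pre; exists (shift n z); first by rewrite src_comp // lz src_seg.
  by rewrite pre_comp // lz ?pre_seg // src_seg.
move=> y; rewrite src_comp // => ly.
by rewrite !pre_comp // fP // start_pre.
Qed.

Lemma swaps_prefix_refine f x n : prefix_germ f x ->
  exists a b, swaps_prefix f x a b /\ le_deg n (deg b) /\ le_deg n (deg a).
Proof.
move=> [a [b fab]]; have [h bl] := swaps_prefix_extend n fab.
set l := seg _ n in h bl; exists (comp a l), (comp b l); split=> //.
have [ab _ _] := fab.
by rewrite !deg_comp ?ab // deg_seg !le_deg_addl.
Qed.

Lemma swaps_prefix_act f x a b : swaps_prefix f x a b -> cylinder a (f x).
Proof.
move=> [ab /cylinder_pre[z bz ->] fP]; rewrite fP //.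
by apply/cylinder_pre; exists z => //; rewrite ab.
Qed.

Lemma cylinder_sub l x y n : le_deg n (deg l) -> cylinder l x -> cylinder l y ->
  seg y n = seg x n.
Proof.
move=> nl /cylinder_seg lx /cylinder_seg ly; apply: seg_le nl _.
by rewrite lx ly.
Qed.

Lemma open_refine f x O : open O -> O x -> prefix_germ f x ->
  exists a b, swaps_prefix f x a b /\ cylinder b `<=` O.
Proof.
move=> /open_pathP oO /oO[n nP] /(swaps_prefix_refine n)[a [b [fab [nb _]]]].
exists a, b; split=> // y yb; apply: nP; apply: cylinder_sub nb _ yb.
by case: fab.
Qed.

Lemma prefix_germs : germs (@prefix_germ).
Proof.
split.
- move=> x; exists (seg x 0), (seg x 0); split=> //.
  by apply/cylinder_seg; rewrite deg_seg.
- move=> f t x [a [b fab]] [a' [b' tab]].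
  have fx := swaps_prefix_act fab.
  have [h bl] := swaps_prefix_extend (deg b') fab.
  have [h' bl'] := swaps_prefix_extend (deg a) tab.
  set l := seg _ _ in h bl; set l' := seg _ _ in h' bl'.
  have [ab /cylinder_pre[z bz xz] fP] := fab.
  have [ab' fxb tP] := tab.
  have e : comp a l = comp b' l'.
    have -> : comp a l = seg (f x) (deg a + deg b').
      by rewrite seg_add xz fP // seg_pre_deg ?ab // shift_pre ?ab // /l xz shift_pre.
    by rewrite addrC seg_add; congr comp; apply/cylinder_seg.
  have [s1 c1 P1] := h; have [s2 c2 P2] := h'.
  exists (comp a' l'), (comp b l); split=> //; first by rewrite s2 -e.
  move=> y ly /=; rewrite P1 // e P2 //.
  by rewrite -e s1.
- move=> f t x A oA Ax ft lf; have [a [b [[ab bx fP] bA]]] := open_refine oA Ax lf.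
  exists a, b; split=> // y by_; rewrite -ft ?fP //; apply: bA.
  by apply/cylinder_pre; exists y.
- move=> f t x A oA Ax tf lf; have [a [b [fab bA]]] := open_refine oA Ax lf.
  have fx := swaps_prefix_act fab; have [ab bx fP] := fab.
  exists b, a; split=> // y ay; have by_ : src b = start y by rewrite -ab.
  by rewrite -fP // tf //; apply: bA; apply/cylinder_pre; exists y.
- move=> f x A lf oA Afx; move: oA => /open_pathP/(_ _ Afx)[n nP].
  have [a [b [fab [_ na]]]] := swaps_prefix_refine n lf.
  have fx := swaps_prefix_act fab; have [ab bx fP] := fab.
  exists (cylinder b); split=> //; first exact: cylinder_open.
  move=> y /cylinder_pre[z bz ->]; rewrite fP //; apply: nP.
  apply: cylinder_sub na fx _; apply/cylinder_pre; exists z => //.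
  by rewrite ab.
- move=> f x A lf oA Ax; have [a [b [fab bA]]] := open_refine oA Ax lf.
  have fx := swaps_prefix_act fab; have [ab bx fP] := fab.
  exists (cylinder a); split=> //; first exact: cylinder_open.
  move=> _ /cylinder_pre[z az ->]; have bz : src b = start z by rewrite -ab.
  by exists (pre b z); [apply: bA; apply/cylinder_pre; exists z|exact: fP].
Qed.

Lemma choose_distinct (I : eqType) (s : seq I) O :
  perfect (infpath L) -> open O -> O !=set0 -> exists p : I -> infpath L,
    (forall i, i \in s -> O (p i)) /\
    (forall i j, i \in s -> j \in s -> p i = p j -> i = j).
Proof.
move=> perf oO O0; elim: s => [|i s [p [pO pI]]].
  by have [x _] := O0; exists (fun=> x).
have [z Oz zp] := perfect_avoid path_clopen_separated perf (map p s) oO O0.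
have nz j : j \in s -> p j <> z by move=> js; apply: zp; exact: map_f.
exists (fun j => if j == i then z else p j); split=> [j|j j'].
  by rewrite inE; case: eqP => //= _; exact: pO.
rewrite !inE; case: eqP => [->|_] /=; case: eqP => [->|_] //=.
- by move=> _ js e; case: (nz _ js).
- by move=> js _ e; case: (nz _ js).
- exact: pI.
Qed.

(** By strong connectedness every open set contains a cylinder [Z(l)] with [src l] any
    given vertex.  For finitely many vertices these cylinders can be chosen disjoint;
    prefixing each path with the one for its initial vertex embeds the path space. *)
Lemma path_purely_infinite : finite_set [set: vertex L] -> strongly_connected L ->
  perfect (infpath L) -> purely_infinite prefix_germ.
Proof.
move=> /finite_seqP[vs vsE] sc perf A oA A0.
have vsP v : v \in vs by have : [set` vs] v by rewrite -vsE.
have [p [pA pI]] := choose_distinct vs perf oA A0.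
have [V [VP VV]] := separated_nbhs path_clopen_basis path_clopen_separated (map p vs).
have /choice[nu nuP] : forall v, exists l, src l = v /\ cylinder l `<=` A `&` V (p v).
  move=> v; have [cV Vp] := VP (p v).
  have /open_pathP/(_ (p v)) [] : open (A `&` V (p v)).
    by apply: openI => //; exact: clopen_open.
    by split=> //; apply: pA.
  move=> n nP; have [l [rl sl]] := sc (src (seg (p v) n)) v.
  exists (comp (seg (p v) n) l); split; first by rewrite src_comp.
  move=> y /cylinder_pre[z]; rewrite src_comp // => lz ->; apply: nP.
  have e : src (seg (p v) n) = start (pre l z) by rewrite start_pre.
  by rewrite pre_comp //; have := seg_pre_deg e; rewrite deg_seg.
pose t x := pre (nu (start x)) x.
have ns x : src (nu (start x)) = start x by have [] := nuP (start x).
have tV x : (A `&` V (p (start x))) (t x).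
  by have [_] := nuP (start x); apply; apply/cylinder_pre; exists x.
exists t; last by move=> _ [x _ <-]; have [] := tV x.
split.
- move=> x y e; have sxy : start x = start y.
    apply: pI => //; apply: contrapT => pxy.
    have [_ Vx] := tV x; have [_ Vy] := tV y; rewrite -e in Vy.
    have := VV _ _ (map_f p (vsP (start x))) (map_f p (vsP (start y))) pxy.
    by rewrite -subset0 => /(_ (t x)); apply.
  by rewrite -(shift_pre (ns x)) -[RHS](shift_pre (ns y)) -/(t x) -/(t y) e sxy.
- move=> x; exists (nu (start x)), (idm (start x)); rewrite /swaps_prefix src_idm.
  split; first exact: ns.
    by apply/cylinder_pre; exists x; rewrite ?src_idm // pre_idm.
  by move=> y xy; rewrite xy pre_idm.
- have rE : range t = [set y | exists2 v, v \in vs & cylinder (nu v) y].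
    rewrite eqEsubset; split=> [_ [x _ <-]|y [v _ /cylinder_pre[x vx ->]]].
      by exists (start x) => //; apply/cylinder_pre; exists x.
    have [sv _] := nuP v; exists x => //; rewrite /t -sv.
    by congr pre; congr nu; rewrite -vx.
  rewrite -[range t]setCK closedC openE => y ny; rewrite rE in ny.
  have n1 : nbhs y [set z | forall v, v \in vs -> ~ cylinder (nu v) z].
    apply: nbhs_forall_seq => v vvs; apply: open_nbhs_nbhs; split.
      exact: clopen_openC (cylinder_clopen _).
    by move=> yv; apply: ny; exists v.
  apply: filterS n1 => z zn; rewrite rE => -[v vvs].
  exact: zn.
Qed.

(** Prefixes of equal degree are determined by the resulting path; if the degrees
    differed, deleting the other prefix on both sides would exhibit a period of [z]. *)
Lemma aperiodic_pre_inj z a b : (forall m n, m <> n -> shift m z <> shift n z) ->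
  src a = start z -> src b = start z -> pre a z = pre b z -> a = b.
Proof.
move=> zap az bz e; have [d|/eqP d] := eqVneq (deg a) (deg b).
  by rewrite -(seg_pre_deg az) e d seg_pre_deg.
case: (zap _ _ d); rewrite -{1}(shift_pre bz) -{2}(shift_pre az) -e.
by rewrite !shift_shift addrC.
Qed.

(** At an aperiodic fixed point the germ can only replace a prefix by itself, so it is
    the germ of the identity. *)
Lemma aperiodic_regular z f : (forall m n, m <> n -> shift m z <> shift n z) ->
  prefix_germ f z -> f z = z -> nbhs z [set y | f y = y].
Proof.
move=> zap [a [b fab]] fz; have az := swaps_prefix_act fab; rewrite fz in az.
have [ab bz fP] := fab.
have e : a = b.
  have /cylinder_seg za := az; have /cylinder_seg zb := bz.
  have [d|/eqP d] := eqVneq (deg a) (deg b); first by rewrite -za d zb.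
  case: (zap _ _ d); have [y by_ yz] := (cylinder_pre b z).1 bz.
  rewrite -{1}fz yz fP // shift_pre ?ab // -yz.
  by rewrite {1}yz shift_pre.
apply: filterS (open_nbhs_nbhs (conj (cylinder_open b) bz)) => y.
by move=> /cylinder_pre[w bw ->] /=; rewrite fP // e.
Qed.

End PathTopology.

(** * Projections and the unit of a C*-algebra *)

Local Open Scope cstar_scope.

Section CstarBasics.
Context {R : realType} {A : cstar_algebra R}.
Implicit Types (x y z : A) (c : R[i]).
Local Open Scope ring_scope.

Lemma cs_mul0l x : 0 ** x = 0.
Proof. by apply: (addrI (0 ** x)); rewrite -cs_mulDl !addr0. Qed.
Lemma cs_mul0r x : x ** 0 = 0.
Proof. by apply: (addrI (x ** 0)); rewrite -cs_mulDr !addr0. Qed.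
Lemma cs_mulNl x y : (- x) ** y = - (x ** y).
Proof. by apply: (addrI (x ** y)); rewrite -cs_mulDl !subrr cs_mul0l. Qed.
Lemma cs_mulNr x y : x ** (- y) = - (x ** y).
Proof. by apply: (addrI (x ** y)); rewrite -cs_mulDr !subrr cs_mul0r. Qed.
Lemma cs_mulBl x y z : (x - y) ** z = x ** z - y ** z.
Proof. by rewrite cs_mulDl cs_mulNl. Qed.
Lemma cs_mulBr x y z : x ** (y - z) = x ** y - x ** z.
Proof. by rewrite cs_mulDr cs_mulNr. Qed.

Lemma cs_mul_suml (I : Type) (r : seq I) (P : pred I) (F : I -> A) y :
  (\sum_(i <- r | P i) F i) ** y = \sum_(i <- r | P i) (F i ** y).
Proof.
by apply: (big_morph (fun x => x ** y)) => [u v|]; rewrite ?cs_mulDl ?cs_mul0l.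
Qed.
Lemma cs_mul_sumr (I : Type) (r : seq I) (P : pred I) (F : I -> A) y :
  y ** (\sum_(i <- r | P i) F i) = \sum_(i <- r | P i) (y ** F i).
Proof.
by apply: (big_morph (fun x => y ** x)) => [u v|]; rewrite ?cs_mulDr ?cs_mul0r.
Qed.

Lemma cs_star0 : (0 : A)^† = 0.
Proof. by apply: (addrI ((0 : A)^†)); rewrite -cs_starD !addr0. Qed.
Lemma cs_starN x : (- x)^† = - x^†.
Proof. by apply: (addrI (x^†)); rewrite -cs_starD !subrr cs_star0. Qed.
Lemma cs_star_sum (I : Type) (r : seq I) (P : pred I) (F : I -> A) :
  (\sum_(i <- r | P i) F i)^† = \sum_(i <- r | P i) (F i)^†.
Proof. by apply: big_morph => [u v|]; rewrite ?cs_starD ?cs_star0. Qed.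

Lemma cs_star_mul_eq0 x : x^† ** x = 0 -> x = 0.
Proof.
move=> e; apply/eqP; rewrite -normr_eq0 -sqrf_eq0 -cs_norm_star e.
by rewrite normr0.
Qed.

Definition is_projection x := x ** x = x /\ x^† = x.

Lemma projection_norm_le1 x : is_projection x -> `|x| <= 1.
Proof.
move=> [xx xs]; have := cs_norm_star x; rewrite xs xx expr2 => e.
have [->|x0] := eqVneq `|x| 0; first by rewrite ler01.
suff -> : `|x| = 1 by [].
by apply: (mulfI x0); rewrite -e mulr1.
Qed.

End CstarBasics.

Section ExtremePoint.
Context {R : realType} {A : cstar_algebra R} (e : A).
Hypothesis pe : is_projection e.
Local Open Scope ring_scope.
Implicit Types (a x y : A) (c d : R[i]).

Let ee : e ** e = e := pe.1.
Let es : e^† = e := pe.2.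

(** The self-adjoint elements of the corner [e A e], of which [e] is the unit. *)
Definition corner_sa a := [/\ e ** a = a, a ** e = a & a^† = a].

Lemma norm_mul_le1 x y : `|x| <= 1 -> `|y| <= 1 -> `|x ** y| <= 1.
Proof.
move=> hx hy; apply: (le_trans (cs_normM x y)).
by rewrite -[1]mulr1; apply: ler_pM.
Qed.

Section Cubic.
Variable a : A.
Hypothesis sa : corner_sa a.
Let ea : e ** a = a. Proof. by case: sa. Qed.
Let ae : a ** e = a. Proof. by case: sa. Qed.
Let as_ : a^† = a. Proof. by case: sa. Qed.

Definition cubic c0 c1 c2 c3 : A :=
  c0 *: e + c1 *: a + c2 *: (a ** a) + c3 *: (a ** a ** a).

Lemma cubicD c0 c1 c2 c3 d0 d1 d2 d3 : cubic c0 c1 c2 c3 + cubic d0 d1 d2 d3 =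
  cubic (c0 + d0) (c1 + d1) (c2 + d2) (c3 + d3).
Proof. by rewrite /cubic !scalerDl [LHS]addrACA [X in X + _]addrACA [X in X + _ + _]addrACA. Qed.

Lemma cubicZ c c0 c1 c2 c3 :
  c *: cubic c0 c1 c2 c3 = cubic (c * c0) (c * c1) (c * c2) (c * c3).
Proof. by rewrite /cubic !scalerDr !scalerA. Qed.

Lemma cubicB c0 c1 c2 c3 d0 d1 d2 d3 : cubic c0 c1 c2 c3 - cubic d0 d1 d2 d3 =
  cubic (c0 - d0) (c1 - d1) (c2 - d2) (c3 - d3).
Proof. by rewrite -[- cubic _ _ _ _]scaleN1r cubicZ cubicD !mulN1r. Qed.

Lemma cubic_a c : c *: a = cubic 0 c 0 0.
Proof. by rewrite /cubic !scale0r add0r !addr0. Qed.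

Lemma cubic_mul c0 c1 c2 d : cubic c0 c1 c2 0 ** (e + d *: a) =
  cubic c0 (c1 + c0 * d) (c2 + c1 * d) (c2 * d).
Proof.
rewrite /cubic scale0r addr0 cs_mulDr !cs_mulDl !cs_mulZl !cs_mulZr ee ae.
rewrite -(cs_mulA a a e) ae ea !scalerA !scalerDl.
rewrite -!addrA; congr (_ + _); congr (_ + _).
by rewrite addrCA; congr (_ + _).
Qed.

Lemma cubicE1 d : e + d *: a = cubic 1 d 0 0.
Proof. by rewrite /cubic !scale0r scale1r !addr0. Qed.

Lemma cubicE2 c d : (e + c *: a) ** (e + d *: a) = cubic 1 (c + d) (c * d) 0.
Proof. by rewrite [X in X ** _](cubicE1 c) cubic_mul mul0r mul1r add0r. Qed.

Lemma cubicE3 d : (e + d *: a) ** (e + d *: a) ** (e + d *: a) =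
  cubic 1 (3%:R * d) (3%:R * d ^+ 2) (d ^+ 3).
Proof.
by rewrite cubicE2 cubic_mul; congr cubic; ring.
Qed.

End Cubic.

Definition in_ball a := [/\ corner_sa a, `|e + a| <= 1 & `|e - a| <= 1].

(** If [e + a] and [e - a] lie in the unit ball, so do [e + i a] and [e - i a],
    because the square of the norm of [e + i a] is the norm of [e + a ^ 2], the
    mean of the squares of [e + a] and [e - a]. *)
Lemma in_ball_unit a : in_ball a -> forall c, c ^+ 4 = 1 -> `|e + c *: a| <= 1.
Proof.
move=> [sa hp hm].
have h1 : `|e + 1 *: a| <= 1 by rewrite scale1r.
have h2 : `|e + (-1) *: a| <= 1 by rewrite scaleN1r.
have hi c : c ^+ 2 = -1 -> Num.conj c = - c -> `|e + c *: a| <= 1.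
  move=> c2 cc; rewrite -(@expr_le1 _ 2) // -cs_norm_star.
  have [ea ae as_] := sa.
  have -> : (e + c *: a)^† ** (e + c *: a) =
      2%:R^-1 *: ((e + 1 *: a) ** (e + 1 *: a) + (e + (-1) *: a) ** (e + (-1) *: a)).
    rewrite cs_starD cs_starZ es as_ cc.
    rewrite !(cubicE2 sa) cubicD cubicZ addr0 mulr0.
    by congr cubic; rewrite ?mulNr -?expr2 ?c2; field.
  rewrite normrZ ger0_norm ?invr_ge0 ?ler0n //.
  rewrite ler_pdivrMl ?ltr0n // mulr1; apply: (le_trans (ler_normD _ _)).
  by rewrite -[2%:R]/(1 + 1); apply: lerD; exact: norm_mul_le1.
move=> c c4; have : (c ^+ 2 - 1) * (c ^+ 2 + 1) = 0 by rewrite -subr_sqr -exprM c4 expr1n subrr.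
move/eqP; rewrite mulf_eq0 => /orP[|].
  by rewrite subr_eq0 sqrf_eq1 => /orP[/eqP->|/eqP->].
rewrite addr_eq0 => /eqP c2; apply: hi => //.
have : (c - 'i) * (c + 'i) = 0 by rewrite -subr_sqr c2 sqrCi subrr.
move/eqP; rewrite mulf_eq0 subr_eq0 addr_eq0 => /orP[/eqP->|/eqP->].
  exact: conjCi.
by rewrite rmorphN; congr (- _); exact: conjCi.
Qed.

Let E a d := (e + d *: a) ** (e + d *: a) ** (e + d *: a).

Lemma in_ball_cube a d : in_ball a -> d ^+ 4 = 1 -> `|E a d| <= 1.
Proof.
move=> ba d4; have h := in_ball_unit ba d4.
by apply: norm_mul_le1 => //; exact: norm_mul_le1.
Qed.

Let i4 : 'i ^+ 4 = 1 :> R[i].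
Proof. by rewrite (exprM _ 2 2) sqrCi sqrrN !expr1n. Qed.
Let Ni4 : (- 'i) ^+ 4 = 1 :> R[i].
Proof. by rewrite (exprM _ 2 2) sqrrN -exprM i4. Qed.
Let i3 : 'i ^+ 3 = - 'i :> R[i].
Proof. by rewrite exprSr sqrCi mulN1r. Qed.
Let Ni3 : (- 'i) ^+ 3 = 'i :> R[i].
Proof. by rewrite exprSr sqrrN sqrCi mulN1r opprK. Qed.
Let N13 : (- 1) ^+ 3 = - 1 :> R[i].
Proof. by rewrite exprSr sqrrN expr1n mul1r. Qed.
Let N14 : (- 1) ^+ 4 = 1 :> R[i].
Proof. by rewrite (exprM _ 2 2) sqrrN !expr1n. Qed.

(** Averaging cubes over the fourth roots of unity isolates the linear term. *)
Lemma in_ball_bound a : in_ball a -> `|a| *+ 3 <= 1.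
Proof.
move=> ba; have [sa _ _] := ba.
have e1 : 12%:R *: a = (E a 1 - E a (-1)) - 'i *: (E a 'i - E a (- 'i)).
  rewrite /E !(cubicE3 sa) !cubicB cubicZ cubicB (cubic_a a).
  have i2 : 'i * 'i = -1 :> R[i] by rewrite -expr2 sqrCi.
  by congr cubic; rewrite ?Ni3 ?i3 ?N13 ?sqrrN ?sqrCi ?expr1n; ring: i2.
have : `|12%:R *: a| <= 4%:R.
  have -> : 4%:R = (1 + 1) + (1 + 1) :> R[i] by ring.
  rewrite e1.
  have ha d : d ^+ 4 = 1 -> `|E a d| <= 1 by exact: in_ball_cube.
  apply: (le_trans (ler_normB _ _)); apply: lerD.
    by apply: (le_trans (ler_normB _ _)); apply: lerD; apply: ha => //; exact: expr1n.
  rewrite normrZ normCi mul1r.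
  by apply: (le_trans (ler_normB _ _)); apply: lerD; apply: ha.
rewrite normrZ normr_nat => h.
rewrite -(ler_pM2l (x := 4%:R)) ?ltr0n // mulr1.
have -> : 4%:R * (`|a| *+ 3) = 12%:R * `|a| by ring.
exact: h.
Qed.

(** The map [a |-> (3 a + a ^ 3) / 2] preserves the set, since [e + (3 a + a ^ 3) / 2]
    is the mean of [(e + a) ^ 3] and of the mean of the two cubes [(e + i a) ^ 3] and
    [(e - i a) ^ 3], and it stretches norms by a factor of at least [4 / 3]. *)
Lemma in_ball_stretch a : in_ball a ->
  exists2 b, in_ball b & `|a| *+ 4 <= `|b| *+ 3.
Proof.
move=> ba; have [sa hp hm] := ba; have [ea ae as_] := sa.
pose b := cubic a 0 (3%:R / 2%:R) 0 (2%:R^-1).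
have ha d : d ^+ 4 = 1 -> `|E a d| <= 1 by exact: in_ball_cube.
have half (u v w : A) : `|u| <= 1 -> `|v| <= 1 -> `|w| <= 1 ->
    `|2%:R^-1 *: (u + 2%:R^-1 *: (v + w))| <= 1.
  move=> hu hv hw; have h2 x y : `|x| <= 1 -> `|y| <= 1 -> `|2%:R^-1 *: (x + y)| <= 1.
    move=> hx hy; rewrite normrZ ger0_norm ?invr_ge0 ?ler0n //.
    rewrite ler_pdivrMl ?ltr0n // mulr1; apply: (le_trans (ler_normD _ _)).
    by rewrite -[2%:R]/(1 + 1); exact: lerD.
  by apply: (h2) => //; exact: h2.
have bP d : d ^+ 2 = 1 -> e + d *: b =
    2%:R^-1 *: (E a d + 2%:R^-1 *: (E a 'i + E a (- 'i))).
  move=> d2; have d3 : d ^+ 3 = d by rewrite exprSr d2 mul1r.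
  have -> : E a 'i + E a (- 'i) = cubic a 2%:R 0 (- 6%:R) 0.
    rewrite /E !(cubicE3 sa) cubicD.
    by congr cubic; rewrite ?Ni3 ?i3 ?sqrrN ?sqrCi; ring.
  have -> : E a d = cubic a 1 (3%:R * d) 3%:R d by rewrite /E (cubicE3 sa) d2 d3 mulr1.
  have eE : e = cubic a 1 0 0 0 by rewrite /cubic !scale0r scale1r !addr0.
  rewrite [X in X + _ = _]eE /b cubicZ cubicD cubicZ [in RHS]cubicD [in RHS]cubicZ.
  by congr cubic; field.
have sb : corner_sa b.
  have aa : (a ** a)^† = a ** a by rewrite cs_starM as_.
  have aaa : (a ** a ** a)^† = a ** a ** a by rewrite cs_starM aa as_ cs_mulA.
  have c3 : Num.conj (3%:R / 2%:R : R[i]) = 3%:R / 2%:R.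
    by rewrite fmorph_div !rmorph_nat.
  have c2 : Num.conj (2%:R^-1 : R[i]) = 2%:R^-1 by rewrite fmorphV rmorph_nat.
  rewrite /b /cubic !scale0r add0r addr0; split.
  - by rewrite cs_mulDr !cs_mulZr !cs_mulA ea.
  - by rewrite cs_mulDl !cs_mulZl -!cs_mulA ae.
  - by rewrite cs_starD !cs_starZ as_ aaa c3 c2.
exists b.
  split=> //.
    rewrite -[b]scale1r bP ?expr1n //; apply: half; apply: ha => //.
    exact: expr1n.
  by rewrite -scaleN1r bP ?sqrrN ?expr1n //; apply: half; apply: ha.
have e3 : 3%:R *: a = 2%:R *: b - a ** a ** a.
  have h2 : 2%:R != 0 :> R[i] by rewrite pnatr_eq0.
  rewrite /b /cubic !scale0r add0r addr0 scalerDr !scalerA divff // scale1r addrK.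
  by rewrite [X in _ = X *: _]mulrC divfK.
have h3 : `|a ** a ** a| *+ 9 <= `|a|.
  have le3 := in_ball_bound ba.
  have n1 : `|a ** a ** a| <= `|a| * `|a| * `|a|.
    apply: (le_trans (cs_normM _ _)); apply: ler_wpM2r => //.
    exact: cs_normM.
  apply: (le_trans (ler_wMn2r 9 n1)).
  have -> : `|a| * `|a| * `|a| *+ 9 = `|a| *+ 3 * (`|a| *+ 3 * `|a|) by ring.
  have p3 : 0 <= `|a| *+ 3 by rewrite mulrn_wge0.
  have n0 : 0 <= `|a| by [].
  rewrite -[X in _ <= X]mul1r; apply: (ler_pM p3 (mulr_ge0 p3 n0) le3).
  by rewrite -[X in _ <= X]mul1r; apply: ler_wpM2r.
have : `|3%:R *: a| <= `|b| *+ 2 + `|a ** a ** a|.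
  rewrite e3; apply: (le_trans (ler_normB _ _)).
  by rewrite normrZ normr_nat mulr_natl.
rewrite normrZ normr_nat mulr_natl => h.
have : `|a| *+ 27 <= `|b| *+ 18 + `|a|.
  have -> : `|a| *+ 27 = `|a| *+ 3 *+ 9 by rewrite -mulrnA.
  apply: (le_trans (ler_wMn2r 9 h)); rewrite mulrnDl -mulrnA.
  exact: lerD.
have -> : `|a| *+ 27 = `|a| *+ 26 + `|a| by rewrite -mulrSr.
rewrite lerD2r => h26; rewrite -(ler_pMn2r (n := 6)) // -!mulrnA.
by apply: le_trans h26; apply: ler_wpMn2l.
Qed.

Lemma natmul_bounded_eq0 (c : R[i]) : 0 <= c -> (forall n, c *+ n <= 1) -> c = 0.
Proof.
move=> c0 h; apply/eqP; rewrite eq_le c0 andbT.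
have [r cr] : exists r : R, c = r%:C%C.
  exists (complex.Re c); move: c0; rewrite lecE /= => /andP[/eqP im _].
  by case: (c) im => x y /= ->.
rewrite cr lecR leNgt; apply/negP => r0.
have := h (Num.truncn r^-1).+1; rewrite cr -rmorphMn -(rmorph1 (real_complex R)) lecR.
apply/negP; rewrite -ltNge -mulr_natr -ltr_pdivrMl // mulr1.
exact: truncnS_gt.
Qed.

(** The unit of a C*-algebra is an extreme point of the self-adjoint part of the
    unit ball: repeated stretching would otherwise exceed the bound [1 / 3].  It
    stands in below for the order on self-adjoint elements. *)
Lemma unit_extreme a : in_ball a -> a = 0.
Proof.
move=> ba; apply/eqP; rewrite -normr_eq0; apply/eqP.
apply: natmul_bounded_eq0 => // n.
have : forall a, in_ball a -> `|a| *+ 3 *+ 4 ^ n <= 3%:R ^+ n.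
  elim: n => [|n IH] x bx; first by rewrite expr0; exact: in_ball_bound.
  have [y by_ xy] := in_ball_stretch bx.
  have -> : `|x| *+ 3 *+ 4 ^ n.+1 = `|x| *+ 4 *+ (3 * 4 ^ n).
    by rewrite -!mulrnA expnS mulnCA.
  apply: (le_trans (ler_wMn2r _ xy)); rewrite mulnC mulrnA exprS mulr_natl.
  by apply: ler_wMn2r; exact: IH.
move=> /(_ a ba) h.
rewrite -(ler_pM2l (x := 3%:R ^+ n)) ?exprn_gt0 ?ltr0n // mulr1.
apply: le_trans h; rewrite -natrX mulr_natl -!mulrnA.
apply: ler_wpMn2l; rewrite // ?leEnat.
have : (n * 3 ^ n <= 3 * 4 ^ n)%N.
  elim: (n) => [//|m IH]; rewrite !expnS.
  have : (3 ^ m <= 4 ^ m)%N by case: (m) => // j; rewrite leq_exp2r.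
  by move: (3 ^ m)%N (4 ^ m)%N IH => u v; nia.
by rewrite mulnC.
Qed.

End ExtremePoint.

Section Projections.
Context {R : realType} {A : unital_cstar_algebra R}.
Local Open Scope ring_scope.
Implicit Types (x p : A).

Lemma cs_star1 : (cs_one : A)^† = cs_one.
Proof. by rewrite -[LHS]cs_mul1 -[X in X ** _]cs_starK -cs_starM cs_mul1 cs_starK. Qed.

Lemma projection_compl p : is_projection p -> is_projection (cs_one - p).
Proof.
move=> [pp ps]; split; last by rewrite cs_starD cs_starN cs_star1 ps.
by rewrite cs_mulBl cs_mul1 cs_mulBr cs_mulr1 pp subrr subr0.
Qed.

(** Compressing by [e] turns the projections into positive elements [e q e] of the
    corner of [e]; if they sum to zero, each of them, scaled, is at once positive
    and negative, so it vanishes because the unit of the corner is extreme. *)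
Lemma sum_compressions_eq0 (I : eqType) (r : seq I) (q : I -> A) (e : A) :
  is_projection e -> (forall i, i \in r -> is_projection (q i)) -> uniq r ->
  \sum_(i <- r) (e ** q i ** e) = 0 -> forall i, i \in r -> q i ** e = 0.
Proof.
move=> pe pq ur sum0 j jr; have [ee es] := pe; have [qq qs] := pq j jr.
set x := e ** q j ** e.
suff x0 : x = 0.
  by apply: cs_star_mul_eq0; rewrite cs_starM es qs cs_mulA -(cs_mulA e) qq.
pose n := size r; have n0 : (0 < n)%N by rewrite /n; case: (r) jr.
have le1 i : i \in r -> `|e - e ** q i ** e| <= 1.
  move=> ir; have -> : e - e ** q i ** e = e ** (cs_one - q i) ** e.
    by rewrite cs_mulBr cs_mulr1 cs_mulBl ee.
  have pc := projection_norm_le1 (projection_compl (pq i ir)).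
  have p1 := projection_norm_le1 pe.
  by apply: norm_mul_le1 => //; exact: norm_mul_le1.
have p1 := projection_norm_le1 pe.
have nn : (n%:R : R[i]) != 0 by rewrite pnatr_eq0 -lt0n.
have scaled (y : A) : `|y| <= n%:R -> `|n%:R^-1 *: y| <= 1.
  move=> hy; rewrite normrZ ger0_norm ?invr_ge0 ?ler0n //.
  by rewrite ler_pdivrMl ?ltr0n // mulr1.
have sumle (s : seq I) : {subset s <= r} ->
    `|\sum_(i <- s) (e - e ** q i ** e)| <= (size s)%:R.
  elim: s => [|i s IH] sr; first by rewrite big_nil normr0.
  rewrite big_cons /= -natr1 addrC; apply: (le_trans (ler_normD _ _)); apply: lerD.
    by apply: IH => z zs; apply: sr; rewrite inE zs orbT.
  by apply: le1; apply: sr; rewrite mem_head.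
suff : n%:R^-1 *: x = 0.
  by move/eqP; rewrite scaler_eq0 invr_eq0 (negPf nn) /= => /eqP.
have E (y : A) : n%:R^-1 *: (n%:R *: y) = y by rewrite scalerA mulVf // scale1r.
apply: (unit_extreme pe); split.
- split; rewrite ?cs_mulZr ?cs_mulZl /x.
  + by rewrite !cs_mulA ee.
  + by rewrite -!cs_mulA ee.
  + by rewrite cs_starZ !cs_starM es qs cs_mulA fmorphV rmorph_nat.
- rewrite -{1}[e]E -scalerDr; apply: scaled.
  (* Up to sign [x] is the sum of the other compressions, each compensated by an [e]. *)
  have -> : n%:R *: e + x = \sum_(i <- rem j r) (e - e ** q i ** e) + e.
    have := sum0; rewrite (big_rem j jr) /= => /eqP; rewrite addr_eq0 => /eqP sx.
    rewrite big_split /= sumrN -/x {1}[x]sx big_const_seq count_predT.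
    rewrite size_rem // iter_addr addr0 -/n -{1}(prednK n0) scaler_nat mulrSr.
    by rewrite addrAC.
  rewrite -(prednK n0) -natr1; apply: (le_trans (ler_normD _ _)); apply: lerD => //.
  by rewrite /n -(size_rem jr); apply: sumle => z; exact: mem_rem.
- rewrite -{1}[e]E -scalerBr; apply: scaled.
  have -> : n%:R *: e - x = n.-1%:R *: e + (e - x).
    by rewrite -{1}(prednK n0) -natr1 scalerDl scale1r addrA.
  rewrite -{2}(prednK n0) -natr1; apply: (le_trans (ler_normD _ _)); apply: lerD.
    by rewrite normrZ normr_nat ler_piMr ?ler0n.
  exact: le1.
Qed.

(** Compressing the equation of the sum by one of the projections, [e = q j], and
    subtracting the term [e] itself leaves a sum of compressions equal to zero. *)
Lemma sum_projections_orthogonal (I : eqType) (r : seq I) (q : I -> A) (p : A) :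
  (forall i, i \in r -> is_projection (q i)) -> uniq r ->
  p = \sum_(i <- r) q i -> (forall i, i \in r -> p ** q i = q i) ->
  forall i j, i \in r -> j \in r -> i != j -> q i ** q j = 0.
Proof.
move=> pq ur pE dom i j ir jr ij; have [qq qs] := pq j jr.
apply: (@sum_compressions_eq0 _ (rem j r) q (q j)) => //.
- by move=> z /mem_rem; exact: pq.
- exact: rem_uniq.
- rewrite -cs_mul_suml -cs_mul_sumr.
  have -> : \sum_(z <- rem j r) q z = p - q j by rewrite pE (big_rem j jr) addrC addKr.
  by rewrite -cs_mulA cs_mulBl dom // qq subrr cs_mul0r.
- by rewrite mem_rem_uniq // inE ij.
Qed.

End Projections.

(** * The Higman-Thompson like group as a full group *)

Section CuntzKrieger.
Context {R : realType} {k : nat} {L : kgraph k} {A : unital_cstar_algebra R}.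
Variable s : mor L -> A.
Hypotheses (sCK : is_ck_family s) (sgen : cstar_generated s).
Hypotheses (Lrow : row_finite L) (Lfin : finite_set [set: vertex L]).
Local Open Scope ring_scope.
Implicit Types (m n : degree k) (a b c l : mor L) (x y z : infpath L).

Lemma finite_paths n : finite_set [set l : mor L | deg l = n].
Proof.
have -> : [set l : mor L | deg l = n] = \bigcup_(v in [set: vertex L]) paths_from v n.
  rewrite eqEsubset; split=> [l ln|l [v _ []//]].
  by exists (rng l).
by apply: bigcup_finite => // v _; exact: Lrow.
Qed.

Definition paths n : seq (mor L) := finmap.enum_fset (fset_set [set l : mor L | deg l = n]).

Lemma mem_paths n l : (l \in paths n) = (deg l == n).
Proof.
rewrite /paths in_fset_set; last exact: finite_paths.
by apply/idP/eqP => [/set_mem|h]; rewrite ?inE.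
Qed.

Lemma uniq_paths n : uniq (paths n). Proof. exact: finmap.fset_uniq. Qed.

Let q l := s l ** (s l)^†.

Lemma ck_rng l : s (idm (rng l)) ** s l = s l.
Proof. by rewrite -(ck_comp sCK) ?src_idm // comp_idl. Qed.

Lemma ck_src_mul l : s l ** s (idm (src l)) = s l.
Proof. by rewrite -(ck_comp sCK) ?rng_idm // comp_idr. Qed.

Lemma ck_projection l : is_projection (q l).
Proof.
split; last by rewrite /q cs_starM cs_starK.
by rewrite /q cs_mulA (ck_isometry sCK).
Qed.

Lemma ck_vertex v : is_projection (s (idm v)).
Proof. by have [] := ck_proj sCK v. Qed.

Lemma ck_vertex_sum v n : s (idm v) = \sum_(l <- paths n | rng l == v) q l.
Proof.
rewrite (ck_sum sCK v n) fsbig_finite /=; last exact: Lrow.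
rewrite -[in RHS]big_filter; apply: perm_big; apply: uniq_perm.
- exact: finmap.fset_uniq.
- by rewrite filter_uniq // uniq_paths.
- move=> l; rewrite mem_filter mem_paths in_fset_set; last exact: Lrow.
  by apply/idP/andP => [/set_mem[-> ->]|[/eqP h /eqP d]]; rewrite ?inE ?eqxx.
Qed.

Lemma ck_rng_neq a b : rng a <> rng b -> (s a)^† ** s b = 0.
Proof.
move=> ab; rewrite -(ck_rng a) -(ck_rng b) cs_starM.
have [_ ->] := ck_vertex (rng a).
rewrite cs_mulA -(cs_mulA _ (s (idm (rng a)))) (ck_orth sCK ab).
by rewrite cs_mul0r cs_mul0l.
Qed.

(** The range projections of the paths of one degree from one vertex sum to the vertex
    projection, so they are orthogonal. *)
Lemma ck_orthogonal a b : deg a = deg b -> a <> b -> (s a)^† ** s b = 0.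
Proof.
move=> d ab; have [r|/eqP r] := eqVneq (rng a) (rng b); last exact: ck_rng_neq.
pose rs := [seq l <- paths (deg a) | rng l == rng a].
have ars : a \in rs by rewrite mem_filter mem_paths !eqxx.
have brs : b \in rs by rewrite mem_filter mem_paths r d !eqxx.
have qq : q a ** q b = 0.
  apply: (@sum_projections_orthogonal _ _ _ rs q (s (idm (rng a)))) => //.
  - by move=> *; exact: ck_projection.
  - by rewrite filter_uniq // uniq_paths.
  - by rewrite (ck_vertex_sum _ (deg a)) big_filter.
  - move=> l; rewrite mem_filter => /andP[/eqP <- _].
    by rewrite /q cs_mulA ck_rng.
  - exact/eqP.
have e l : (s l)^† ** q l = (s l)^†.
  by rewrite /q -[in RHS](ck_isometry sCK l) !cs_starM cs_starK cs_mulA.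
rewrite -(e a) -(ck_isometry sCK b) -[s b ** _ ** _]/(q b ** s b).
by rewrite cs_mulA -(cs_mulA _ (q a)) qq cs_mul0r cs_mul0l.
Qed.

(** The sum [P] of the range projections acts as a unit on the generators; the elements
    on which it does so form a closed *-subalgebra, hence everything. *)
Lemma ck_one n : \sum_(l <- paths n) q l = cs_one.
Proof.
set P := \sum_(l <- paths n) q l.
have Ps : P^† = P.
  by rewrite /P cs_star_sum; apply: eq_bigr => l _; have [_ ->] := ck_projection l.
have Pl a : P ** s a = s a.
  rewrite /P cs_mul_suml (bigID (fun l => rng l == rng a)) /= [X in _ + X]big1 ?addr0.
    by rewrite -cs_mul_suml -ck_vertex_sum ck_rng.
  by move=> l /eqP h; rewrite /q -cs_mulA ck_rng_neq ?cs_mul0r.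
have Pv v : s (idm v) ** P = s (idm v).
  have [_ vs] := ck_vertex v.
  by rewrite -[LHS]cs_starK cs_starM vs Ps Pl vs.
have Pr a : s a ** P = s a by rewrite -(ck_src_mul a) -cs_mulA Pv.
have PP : P ** P = P.
  by rewrite {2}/P cs_mul_sumr; apply: eq_bigr => l _; rewrite /q cs_mulA Pl.
have P1 : `|P| <= 1 by apply: projection_norm_le1.
pose D := [set x : A | P ** x = x /\ x ** P = x].
have Dcl : closed D.
  have small (x : A) : (forall e : R[i], 0 < e -> `|x| <= e) -> x = 0.
    move=> h; apply/eqP; rewrite -normr_eq0; apply/eqP/le_anti; rewrite normr_ge0 andbT.
    by apply/ler_addgt0Pr => e /h; rewrite add0r.
  move=> x cx; have near e : 0 < e -> exists2 y, D y & `|x - y| < e.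
    move=> e0; have [y [Dy xy]] := cx _ (nbhsx_ballx x e e0).
    by exists y => //; move: xy; rewrite -ball_normE.
  have twice (u v : A) e : `|u| <= e / 2%:R -> `|v| <= e / 2%:R -> `|u - v| <= e.
    move=> hu hv; apply: (le_trans (ler_normB _ _)).
    by rewrite [X in _ <= X]splitr lerD.
  split; apply/eqP; rewrite -subr_eq0; apply/eqP; apply: small => e e0.
    have [y [Py _] xy] := near (e / 2%:R) (divr_gt0 e0 (ltr0Sn _ 1)).
    have -> : P ** x - x = P ** (x - y) - (x - y) by rewrite cs_mulBr Py opprB addrA subrK.
    apply: twice; last exact: ltW.
    apply: (le_trans (cs_normM _ _)); rewrite -[X in _ <= X]mul1r.
    by apply: ler_pM => //; exact: ltW.
  have [y [_ yP] xy] := near (e / 2%:R) (divr_gt0 e0 (ltr0Sn _ 1)).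
  have -> : x ** P - x = (x - y) ** P - (x - y) by rewrite cs_mulBl yP opprB addrA subrK.
  apply: twice; last exact: ltW.
  apply: (le_trans (cs_normM _ _)); rewrite -[X in _ <= X]mulr1.
  by apply: ler_pM => //; exact: ltW.
have DT : D = setT.
  apply: sgen => //.
  - by split; rewrite ?cs_mul0l ?cs_mul0r.
  - by move=> x y [h1 h2] [h3 h4]; split; rewrite ?cs_mulDl ?cs_mulDr ?h1 ?h2 ?h3 ?h4.
  - by move=> c x [h1 h2]; split; rewrite ?cs_mulZl ?cs_mulZr ?h1 ?h2.
  - by move=> x y [h1 h2] [h3 h4]; split; rewrite ?cs_mulA ?h1 // -cs_mulA h4.
  - by move=> x [h1 h2]; split; rewrite -{1}Ps -cs_starM ?h1 ?h2.
have [h _] : D cs_one by rewrite DT.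
by rewrite -[RHS]h cs_mulr1.
Qed.

Hypothesis (Lap : aperiodic L).
Hypothesis s_neq0 : forall v, s (idm v) != 0.

Lemma aperiodic_at v : exists2 z : infpath L, start z = v &
  forall m n, m <> n -> shift m z <> shift n z.
Proof. exact: Lap. Qed.

Lemma ck_star_comp b c : src b = rng c -> (s b)^† ** s (comp b c) = s c.
Proof. by move=> bc; rewrite (ck_comp sCK bc) cs_mulA (ck_src sCK) bc ck_rng. Qed.

Lemma ck_star_self b : (s b)^† ** s b = s (idm (src b)).
Proof. exact: ck_src sCK b. Qed.

Lemma ck_star_cut b l : le_deg (deg b) (deg l) ->
  (s b)^† ** s l = if (cut (deg b) l).1 == b then s (cut (deg b) l).2 else 0.
Proof.
move=> bl; have [e d sr] := cutP bl; case: eqP => [h|h].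
  by rewrite h in sr *; rewrite [in LHS]e h ck_star_comp.
rewrite [in LHS]e (ck_comp sCK sr) cs_mulA.
have -> : (s b)^† ** s (cut (deg b) l).1 = 0; last exact: cs_mul0l.
by apply: ck_orthogonal => // /esym.
Qed.

Lemma ck_ext (u v : A) n : (forall l, deg l = n -> u ** s l = v ** s l) -> u = v.
Proof.
move=> h; rewrite -[u]cs_mulr1 -[v]cs_mulr1 -(ck_one n) !cs_mul_sumr.
by apply: eq_big_seq => l; rewrite mem_paths => /eqP /h; rewrite /q !cs_mulA => ->.
Qed.

(** Paths whose cylinders are disjoint have orthogonal ranges: extend both to the
    same degree. *)
Lemma ck_disjoint a b : (forall y, cylinder a y -> cylinder b y -> False) ->
  (s a)^† ** s b = 0.
Proof.
move=> dis.
have exp l n : s l = \sum_(c <- paths n) (s l ** s c) ** (s c)^†.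
  rewrite -[LHS]cs_mulr1 -(ck_one n) cs_mul_sumr.
  by apply: eq_bigr => c _; rewrite /q cs_mulA.
rewrite (exp a (deg b)) (exp b (deg a)) cs_star_sum cs_mul_suml big_seq.
apply: big1 => c; rewrite mem_paths => /eqP dc.
rewrite cs_mul_sumr big_seq; apply: big1 => c'; rewrite mem_paths => /eqP dc'.
have comp0 (l d : mor L) : src l <> rng d -> s l ** s d = 0.
  move=> ld; rewrite -(ck_src_mul l) -(ck_rng d) cs_mulA -(cs_mulA (s l)).
  by rewrite (ck_orth sCK) // cs_mul0r cs_mul0l.
suff e : (s a ** s c)^† ** (s b ** s c') = 0.
  by rewrite cs_starM cs_starK -cs_mulA [X in _ ** X]cs_mulA e ?cs_mul0l ?cs_mul0r.
have [ac|/eqP ac] := eqVneq (src a) (rng c); last first.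
  by rewrite comp0 // cs_star0 cs_mul0l.
have [bc|/eqP bc] := eqVneq (src b) (rng c'); last by rewrite (comp0 b c') // cs_mul0r.
rewrite -!(ck_comp sCK) //; apply: ck_orthogonal.
  by rewrite !deg_comp // dc dc' addrC.
move=> e; have [z zc _] := aperiodic_at (src (comp a c)).
have h (d d' : mor L) : src d = rng d' -> src (comp d d') = start z ->
    cylinder d (pre (comp d d') z).
  move=> dd; rewrite src_comp // => d'z; rewrite pre_comp //.
  by apply/cylinder_pre; exists (pre d' z) => //; rewrite start_pre.
apply: (dis (pre (comp a c) z)); first exact: h.
by rewrite e; apply: h; rewrite // -e.
Qed.

Lemma degM_le (I : eqType) (r : seq I) (F : I -> degree k) i :
  i \in r -> le_deg (F i) (\sum_(j <- r) F j).
Proof. by move=> ir; rewrite (big_rem i ir) /= le_deg_addr. Qed.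

(** Prefixing different paths to an aperiodic path gives different infinite paths, so a
    long initial segment of the aperiodic path already separates finitely many of them. *)
Lemma separating_extension (r : seq (mor L)) v : (forall a, a \in r -> src a = v) ->
  exists c, rng c = v /\ forall a b, a \in r -> b \in r -> a <> b ->
    (s (comp a c))^† ** s (comp b c) = 0.
Proof.
move=> rv; have [z zv zap] := aperiodic_at v.
have az a : a \in r -> src a = start z by move=> ar; rewrite rv.
have /choice[M MP] : forall p : mor L * mor L, exists n, p.1 \in r -> p.2 \in r ->
    p.1 <> p.2 -> seg (pre p.1 z) n <> seg (pre p.2 z) n.
  move=> [a b] /=; apply: contrapT => /forallNP h.
  have [ar [br ab]] : a \in r /\ b \in r /\ a <> b.
    by have := h 0 => /not_implyP[ar /not_implyP[br /not_implyP[ab _]]].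
  apply: ab; apply: (aperiodic_pre_inj zap); [exact: az|exact: az|].
  apply: path_ext => n.
  by have /not_implyP[_ /not_implyP[_ /not_implyP[_ /contrapT]]] := h n.
pose n := \sum_(p <- [seq (a, b) | a <- r, b <- r]) M p.
have nP a b : a \in r -> b \in r -> le_deg (M (a, b)) n.
  by move=> ar br; apply: degM_le; apply/allpairsP; exists (a, b).
exists (seg z n); split=> [|a b ar br ab]; first by rewrite rng_seg.
have rz d : d \in r -> src d = rng (seg z n) by move=> dr; rewrite rng_seg az.
have long d m y : d \in r -> le_deg m n -> cylinder (comp d (seg z n)) y ->
    seg y m = seg (pre d z) m.
  move=> dr mn yd; apply: (@cylinder_sub _ _ (comp d (seg z n))) _ yd.
    by rewrite deg_comp ?rz // deg_seg; apply: le_deg_trans mn (le_deg_addl _ _).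
  apply/cylinder_seg; rewrite deg_comp ?rz // deg_seg seg_pre ?az //.
apply: ck_disjoint => y ya yb; have mn := nP a b ar br.
by apply: (MP (a, b)) => //=; rewrite -(long a _ y) // -(long b _ y).
Qed.

(** The entry [(l, c)] belongs to the table of [U]: on the cylinder of [l] it replaces the
    prefix [l] by [c]. *)
Definition tab (U : A) l c : Prop := src l = src c /\ U ** s l = s c.

Lemma tab_extend U l c d : tab U l c -> src l = rng d -> tab U (comp l d) (comp c d).
Proof.
move=> [lc Ul] ld; have cd : src c = rng d by rewrite -lc.
by split; rewrite ?src_comp // !(ck_comp sCK) // cs_mulA Ul.
Qed.

Lemma tab_one l : tab cs_one l l. Proof. by split; rewrite ?cs_mul1. Qed.

Lemma tab_mul U V l c d : tab U c d -> tab V l c -> tab (U ** V) l d.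
Proof. by move=> [cd Uc] [lc Vl]; split; rewrite ?lc // -cs_mulA Vl. Qed.

(** If [s c = s c'], extend [c] and [c'] by a separating path: two nonzero partial
    isometries with orthogonal ranges would be equal. *)
Lemma tab_uniq U l c c' : tab U l c -> tab U l c' -> c = c'.
Proof.
move=> [lc Uc] [lc' Uc']; apply: contrapT => cc'.
have [|d [dl dP]] := @separating_extension [:: c; c'] (src l).
  by move=> a; rewrite !inE => /orP[/eqP->|/eqP->].
have e : s (comp c d) = s (comp c' d).
  by rewrite !(ck_comp sCK) -?lc -?lc' // -Uc Uc'.
have := dP c c'; rewrite !inE !eqxx orbT => /(_ isT isT cc').
rewrite -e ck_star_self => /eqP; apply/negP; exact: s_neq0.
Qed.

(** After extending by a separating path [d], the inner product of the sum with itself is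
    the vertex projection at [src d] on one side and, on the other, an integer multiple
    [N] of it, with [N] at least the number of summands.  So [N] equals one. *)
Lemma isometry_single (U : A) l (r : seq (mor L)) : U^† ** U = cs_one ->
  (forall c, c \in r -> src c = src l) -> U ** s l = \sum_(c <- r) s c ->
  exists c, r = [:: c].
Proof.
move=> Uiso rl Ul; have [d [dl dP]] := separating_extension rl.
have rd c : c \in r -> src c = rng d by move=> cr; rewrite rl.
have Uld : U ** s (comp l d) = \sum_(c <- r) s (comp c d).
  rewrite (ck_comp sCK) // cs_mulA Ul cs_mul_suml.
  by apply: eq_big_seq => c cr; rewrite (ck_comp sCK) // rd.
pose p := s (idm (src d)); pose N := (\sum_(a <- r) count_mem a r)%N.
have : p = N%:R *: p.
  have e1 : (U ** s (comp l d))^† ** (U ** s (comp l d)) = p.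
    rewrite cs_starM -cs_mulA (cs_mulA U^†) Uiso cs_mul1 ck_star_self.
    by rewrite src_comp.
  rewrite -[LHS]e1 Uld cs_star_sum cs_mul_suml natr_sum scaler_suml.
  apply: eq_big_seq => a ar; rewrite cs_mul_sumr -sum1_count natr_sum scaler_suml.
  rewrite [RHS]big_mkcond; apply: eq_big_seq => b br.
  rewrite /=; case: eqP => [->|ba]; last by apply: dP => //; exact: nesym.
  by rewrite scale1r ck_star_self src_comp //; exact: rd.
move/eqP; rewrite -{1}[p]scale1r -subr_eq0 -scalerBl scaler_eq0.
rewrite (negPf (s_neq0 _)) orbF subr_eq0 eq_sym pnatr_eq1 => /eqP N1.
have le : (size r <= N)%N.
  rewrite -sum1_size /N big_seq [X in (_ <= X)%N]big_seq; apply: leq_sum => a ar.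
  by rewrite -has_count has_pred1.
rewrite N1 in le; rewrite /N in N1.
case: (r) N1 le => [|c [|c' r']] //; first by rewrite big_nil.
by exists c.
Qed.

Section Table.
Variables (U : A) (n : nat) (a b : 'I_n -> mor L).
Hypotheses (Uform : ht_form s U a b) (Uiso : U^† ** U = cs_one).

Let N : degree k := \sum_i deg (b i).

Lemma ht_form_deg i : le_deg (deg (b i)) N.
Proof. by apply: degM_le; rewrite mem_index_enum. Qed.

Let rest i l := (cut (deg (b i)) l).2.
Let fits l i := (cut (deg (b i)) l).1 == b i.

Lemma ht_form_act l : le_deg N (deg l) ->
  U ** s l = \sum_(i | fits l i) s (comp (a i) (rest i l)) /\
  forall i, fits l i -> src (a i) = rng (rest i l) /\ src (rest i l) = src l.
Proof.
move=> Nl; have bl i := le_deg_trans (ht_form_deg i) Nl.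
have fitsP i : fits l i -> src (a i) = rng (rest i l) /\ src (rest i l) = src l.
  move=> /eqP h; have [e _ sr] := cutP (bl i); rewrite h in e sr.
  by rewrite (Uform.1 i) sr; split=> //; rewrite [in RHS]e src_comp.
split=> //; rewrite Uform.2 cs_mul_suml [RHS]big_mkcond; apply: eq_bigr => i _.
rewrite -cs_mulA ck_star_cut // -/(fits l i) -/(rest i l).
case: ifP => [/fitsP[h _]|_]; last by rewrite cs_mul0r.
by rewrite (ck_comp sCK).
Qed.

(** A long path [l] extends some of the [b i], and [U] sends [s l] to the sum of the
    corresponding generators; by [isometry_single] exactly one term occurs. *)
Lemma ht_form_tab l : le_deg N (deg l) ->
  (exists i, fits l i) /\
  forall i, fits l i -> [/\ l = comp (b i) (rest i l), src (a i) = rng (rest i l)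
    & tab U l (comp (a i) (rest i l))].
Proof.
move=> Nl; have [Ul fitsP] := ht_form_act Nl.
pose r := [seq comp (a i) (rest i l) | i <- enum 'I_n & fits l i].
have Ur : U ** s l = \sum_(c <- r) s c.
  by rewrite Ul /r big_map big_filter big_enum_cond.
have rl c : c \in r -> src c = src l.
  rewrite /r => /mapP[j]; rewrite mem_filter => /andP[/fitsP[h1 h2] _] ->.
  by rewrite src_comp.
have [c rc] := isometry_single Uiso rl Ur.
split.
  have : c \in r by rewrite rc mem_head.
  by rewrite /r => /mapP[j]; rewrite mem_filter => /andP[fi _] _; exists j.
move=> i fi; have [h1 h2] := fitsP i fi.
have ir : comp (a i) (rest i l) \in r.
  by apply/mapP; exists i => //; rewrite mem_filter fi mem_enum.
have ic : comp (a i) (rest i l) = c by move: ir; rewrite rc inE => /eqP.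
split=> //.
  have [e _ _] := cutP (le_deg_trans (ht_form_deg i) Nl).
  by rewrite -(eqP fi).
by split; rewrite ?src_comp ?h2 // Ur rc big_seq1 ic.
Qed.

End Table.

Lemma table_form (U : A) N (f : mor L -> mor L) :
  (forall l, deg l = N -> tab U l (f l)) ->
  exists (p : nat) (a b : 'I_p -> mor L), ht_form s U a b /\
    forall l, deg l = N -> exists j, b j = l /\ a j = f l.
Proof.
move=> fP; pose b j := tnth (in_tuple (paths N)) j.
have bP j : deg (b j) = N by apply/eqP; rewrite -mem_paths mem_tnth.
exists (size (paths N)), (fun j => f (b j)), b; split.
  split=> [j|]; first by have [] := fP _ (bP j).
  rewrite -[LHS]cs_mulr1 -(ck_one N) cs_mul_sumr big_tnth.
  apply: eq_bigr => j _; rewrite /q cs_mulA.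
  by have [_ ->] := fP _ (bP j).
move=> l lN; have /tnthP[j lj] : l \in in_tuple (paths N) by rewrite mem_paths lN.
by exists j; rewrite /b -lj.
Qed.

Implicit Types (U V : unitary A).

Lemma unitary_isometry U : (val U)^† ** val U = cs_one.
Proof. by case: U => u /= /asboolP[]. Qed.

Lemma ht_tab U : ht s U -> exists N, forall l, le_deg N (deg l) ->
  exists c, tab (val U) l c /\ le_deg (deg l) (deg c + N).
Proof.
move=> [n [a [b Uf]]]; exists (\sum_i deg (b i)) => l Nl.
have [[j fj] tj] := ht_form_tab Uf (unitary_isometry U) Nl.
have [e ar t] := tj j fj; eexists; split; first exact: t.
rewrite deg_comp // {1}e deg_comp; last by rewrite -ar (Uf.1 j).
have /le_degE[d ->] := ht_form_deg b j.
by rewrite [X in le_deg _ X]addrC [X in le_deg _ (_ + X)]addrC addrACA le_deg_addr.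
Qed.

Lemma tab_ht U N : (forall l, deg l = N -> exists c, tab (val U) l c) -> ht s U.
Proof.
move=> tU; have /choice[f fP] : forall l, exists c, deg l = N -> tab (val U) l c.
  move=> l; have [/tU[c t]|h] := pselect (deg l = N); first by exists c.
  by exists l.
by have [n [a [b [Uf _]]]] := table_form fP; exists n, a, b.
Qed.

Lemma ht_graphP U x y : ht s U -> ht_graph s U x y <->
  exists l c z, [/\ tab (val U) l c, src l = start z, x = pre l z & y = pre c z].
Proof.
move=> hU; split.
  move=> [n [a [b [Uf [j [z [/prefixedE[bz ->] /prefixedE[az ->]]]]]]]].
  pose N := \sum_i deg (b i); pose d := seg z N.
  have bd : src (b j) = rng d by rewrite rng_seg.
  have ad : src (a j) = rng d by rewrite rng_seg.
  have [|_ /(_ j)] := @ht_form_tab _ _ _ _ Uf (unitary_isometry U) (comp (b j) d).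
    by rewrite deg_comp // deg_seg le_deg_addl.
  rewrite cut_comp //= eqxx => /(_ isT)[_ _ t].
  have dz : src d = start (shift N z) by rewrite src_seg.
  exists (comp (b j) d), (comp (a j) d), (shift N z); split=> //.
  - by rewrite src_comp.
  - by rewrite pre_comp // pre_seg.
  - by rewrite pre_comp // pre_seg.
move=> [l [c [z [t lz -> ->]]]]; have [N tN] := ht_tab hU.
pose M := deg l + N.
have /choice[f fP] : forall l', exists c', deg l' = M -> tab (val U) l' c'.
  move=> l'; have [e|h] := pselect (deg l' = M); last by exists l'.
  by have [|c' [t' _]] := tN l'; [rewrite e le_deg_addl|exists c'].
have [n [a [b [Uf ab]]]] := table_form fP.
pose d := seg z N; have ld : src l = rng d by rewrite rng_seg.
have dM : deg (comp l d) = M by rewrite deg_comp // deg_seg.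
have [j [bj aj]] := ab _ dM; exists n, a, b; split=> //.
have fd : f (comp l d) = comp c d := tab_uniq (fP _ dM) (tab_extend t ld).
have dz : src d = start (shift N z) by rewrite src_seg.
have cd : src c = rng d by have [<-] := t.
exists j, (shift N z); rewrite bj aj fd; split; apply/prefixedE.
  by rewrite src_comp // pre_comp // pre_seg.
by rewrite src_comp // pre_comp // pre_seg.
Qed.

(** Two table entries [l], [l'] that describe [U] at one point have a common extension,
    on which the table is single-valued by [tab_uniq]. *)
Lemma ht_graph_fun U x y y' : ht s U -> ht_graph s U x y -> ht_graph s U x y' -> y = y'.
Proof.
move=> hU /ht_graphP-/(_ hU)[l [c [z [t lz -> ->]]]].
move=> /ht_graphP-/(_ hU)[l' [c' [z' [t' lz' e ->]]]].
pose d := seg z (deg l'); pose d' := seg z' (deg l).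
have ld : src l = rng d by rewrite rng_seg.
have ld' : src l' = rng d' by rewrite rng_seg.
have e1 : comp l d = comp l' d'.
  by rewrite -(seg_pre _ lz) -(seg_pre _ lz') e addrC.
have e2 : shift (deg l') z = shift (deg l) z'.
  by rewrite -{1}(shift_pre lz) -{1}(shift_pre lz') !shift_shift e addrC.
have ce : comp c d = comp c' d'.
  by apply: tab_uniq (tab_extend t ld) _; rewrite e1; exact: tab_extend.
have [cz _] := t; have [cz' _] := t'.
have pE (g : mor L) n (w : infpath L) : src g = start w -> pre g w = pre (comp g (seg w n)) (shift n w).
  by move=> gw; rewrite pre_comp ?src_seg ?rng_seg // pre_seg.
rewrite (pE c (deg l') z) -?cz // (pE c' (deg l) z') -?cz' //.
by rewrite -/d -/d' ce e2.
Qed.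

Lemma ht_act_tab U l c z : ht s U -> tab (val U) l c -> src l = start z ->
  ht_act s U (pre l z) = pre c z.
Proof.
move=> hU t lz.
have g : ht_graph s U (pre l z) (pre c z) by apply/ht_graphP => //; exists l, c, z.
apply: (ht_graph_fun hU _ g).
by apply: (@xgetPex _ (pre l z) [set y | ht_graph s U (pre l z) y]); exists (pre c z).
Qed.

Lemma ht_tab_at U x n : ht s U -> exists l c z,
  [/\ tab (val U) l c, src l = start z, x = pre l z & le_deg n (deg c)].
Proof.
move=> hU; have [N tN] := ht_tab hU.
have [|c [t cn]] := tN (seg x (N + n)); first by rewrite deg_seg le_deg_addr.
exists (seg x (N + n)), c, (shift (N + n) x); split=> //.
- exact: src_seg.
- by rewrite pre_seg.
rewrite deg_seg [deg c + N]addrC in cn.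
apply/le_degP => j; have /le_degP/(_ j) := cn; rewrite !ffunE.
by rewrite (leq_add2l (N j) (n j) (deg c j)).
Qed.

Local Notation act := (ht_act s).

Lemma ht_subgroup : is_subgroup (ht s).
Proof.
split.
- by apply: (@tab_ht _ 0) => l _; exists l; exact: tab_one.
- move=> U V hU hV; have [N tN] := ht_tab hU; have [N' tN'] := ht_tab hV.
  apply: (@tab_ht _ (N' + N)) => l lN.
  have [|c [t cl]] := tN' l; first by rewrite lN le_deg_addr.
  have [|d [t' _]] := tN c.
    rewrite lN [deg c + N']addrC in cl.
    apply/le_degP => j; have /le_degP/(_ j) := cl; rewrite !ffunE.
    by rewrite (leq_add2l (N' j) (N j) (deg c j)).
  by exists d; exact: tab_mul t' t.
- move=> U [p [a [b [ab Uf]]]]; exists p, b, a; split=> [j|]; first by rewrite ab.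
  rewrite /= Uf cs_star_sum; apply: eq_bigr => j _.
  by rewrite cs_starM cs_starK.
Qed.

Lemma ht_act_germ U x : ht s U -> prefix_germ (act U) x.
Proof.
move=> hU; have [l [c [z [t lz xz _]]]] := ht_tab_at x 0 hU.
exists c, l; split; first by case: t.
  by apply/cylinder_pre; exists z.
by move=> y ly; exact: ht_act_tab.
Qed.

Lemma ht_act1 x : act 1%g x = x.
Proof.
have [h1 _ _] := ht_subgroup; rewrite -{1}(pre_idm x).
by rewrite (ht_act_tab h1 (tab_one _)) ?src_idm // pre_idm.
Qed.

Lemma ht_actM U V x : ht s U -> ht s V -> act (U * V)%g x = act U (act V x).
Proof.
move=> hU hV; have [_ hM _] := ht_subgroup.
have [N tN] := ht_tab hU.
have [l [c [z [t lz -> Nc]]]] := ht_tab_at x N hV.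
have [d [t' _]] := tN c Nc; have [lc _] := t.
rewrite (ht_act_tab hV t lz) (ht_act_tab hU t') -?lc //.
by rewrite (ht_act_tab (hM _ _ hU hV) (tab_mul t' t)).
Qed.

Lemma ht_act_faithful U : ht s U -> (forall x, act U x = x) -> U = 1%g.
Proof.
move=> hU Ux; apply: val_inj; have [N tN] := ht_tab hU.
apply: (@ck_ext _ _ N) => l lN; have [|c [t _]] := tN l.
  by rewrite lN le_deg_refl.
have [lc Ul] := t; have [z zl zap] := aperiodic_at (src l).
rewrite /= cs_mul1 Ul; congr s; apply: (aperiodic_pre_inj zap); rewrite -?lc //.
by rewrite -(ht_act_tab hU t) // Ux.
Qed.

Lemma ht_germ_action : germ_action prefix_germ (ht s) act.
Proof.
split.
- exact: ht_subgroup.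
- exact: ht_act1.
- exact: ht_actM.
- exact: ht_act_faithful.
- exact: ht_act_germ.
Qed.

Hypothesis Lcompact : compact [set: infpath L].

(** The description by changes of prefix of a given degree [N] is inherited by longer
    degrees, so compactness of the path space yields one degree for all points. *)
Lemma prefix_germ_uniform f : (forall x, prefix_germ f x) -> exists N, forall l,
  le_deg N (deg l) -> exists c, [/\ src l = src c, le_deg (deg l) (deg c + N)
    & forall z, src l = start z -> f (pre l z) = pre c z].
Proof.
move=> fg.
pose P (N : degree k) x := forall l, cylinder l x -> le_deg N (deg l) -> exists c,
  [/\ src l = src c, le_deg (deg l) (deg c + N)
    & forall z, src l = start z -> f (pre l z) = pre c z].
pose F : set_system (degree k) :=
  filter_from [set: degree k] (fun N => [set n | le_deg N n]).
have FF : Filter F.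
  apply: filter_from_filter; first by exists 0.
  move=> m n _ _; exists (m + n) => // p mnp.
  by split; apply: le_deg_trans mnp; [exact: le_deg_addr|exact: le_deg_addl].
have /compact_near_coveringP/(_ _ F P FF) [x _|N _ NP] := Lcompact.
  have [a [b [ab bx fP]]] := fg x.
  exists (cylinder b, [set n | le_deg (deg b) n]).
    split; last by exists (deg b).
    by apply: open_nbhs_nbhs; split=> //; exact: cylinder_open.
  move=> [x' N] [/= bx' bN] l xl Nl.
  have [e d sr] := cutP (le_deg_trans bN Nl); set r := (cut _ _).2 in e sr.
  have hb : (cut (deg b) l).1 = b.
    have /le_degE[w lw] := le_deg_trans bN Nl.
    have xb := (cylinder_seg b x').1 bx'; have xl' := (cylinder_seg l x').1 xl.
    have -> : l = comp b (seg (shift (deg b) x') w) by rewrite -{1}xl' lw seg_add xb.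
    by rewrite cut_comp // -[X in src X]xb; exact: src_seg_rng.
  rewrite hb in e sr; have ar : src a = rng r by rewrite ab.
  exists (comp a r); split; first by rewrite e !src_comp.
    rewrite e !deg_comp //; have /le_degE[w ->] := bN.
    by rewrite [X in le_deg _ X]addrC [X in le_deg _ (_ + X)]addrC addrACA le_deg_addr.
  move=> z lz; have rz : src r = start z by rewrite -lz e src_comp.
  by rewrite e !pre_comp // fP // start_pre.
exists N => l Nl; have [z0 z0l _] := aperiodic_at (src l).
apply: (NP N _ (pre l z0)) => //; first exact: le_deg_refl.
by apply/cylinder_pre; exists z0.
Qed.

Lemma table_sum N (f : mor L -> mor L) : (forall l, deg l = N -> src l = src (f l)) ->
  forall l, deg l = N -> tab (\sum_(d <- paths N) s (f d) ** (s d)^†) l (f l).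
Proof.
move=> fs l lN; split; first exact: fs.
have lp : l \in paths N by rewrite mem_paths lN.
rewrite cs_mul_suml (big_rem l lp) /= -cs_mulA ck_star_self fs // ck_src_mul.
rewrite big_seq big1 ?addr0 // => d; rewrite (mem_rem_uniq _ (uniq_paths N)) inE.
rewrite mem_paths => /andP[dl /eqP dN].
by rewrite -cs_mulA ck_orthogonal ?cs_mul0r ?dN // => e; rewrite e eqxx in dl.
Qed.

(** A global homeomorphism and its inverse yield two tables whose sums [u] and [v]
    are inverse to each other, and [u] is an isometry because the images of disjoint
    cylinders are disjoint; hence [u] is unitary. *)
Lemma ht_full f f' : cancel f f' -> cancel f' f -> (forall x, prefix_germ f x) ->
  exists2 U, ht s U & act U =1 f.
Proof.
move=> fK f'K fg.
have f'g x : prefix_germ f' x.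
  rewrite -(f'K x); apply: (germ_inv prefix_germs openT I) => // y _; exact: fK.
have elem h : (forall x, prefix_germ h x) -> exists N (u : A), forall l,
    le_deg N (deg l) -> exists c, [/\ tab u l c, le_deg (deg l) (deg c + N)
    & forall z, src l = start z -> h (pre l z) = pre c z].
  move=> /prefix_germ_uniform[N hN].
  have /choice[g gP] : forall l, exists c, le_deg N (deg l) -> [/\ src l = src c,
      le_deg (deg l) (deg c + N)
      & forall z, src l = start z -> h (pre l z) = pre c z].
    move=> l; have [Nl|h'] := pselect (le_deg N (deg l)); last by exists l.
    by have [c hc] := hN l Nl; exists c.
  pose u := \sum_(d <- paths N) s (g d) ** (s d)^†.
  have ut l : deg l = N -> tab u l (g l).
    apply: table_sum => d dN; have [|//] := gP d.
    by rewrite dN le_deg_refl.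
  exists N, u => l Nl; have [e d sr] := cutP Nl; set l0 := (cut N l).1 in e d sr.
  set r := (cut N l).2 in e sr.
  have [|s0 d0 h0] := gP l0; first by rewrite d le_deg_refl.
  have t := tab_extend (ut l0 d) sr; have gr : src (g l0) = rng r by rewrite -s0.
  exists (comp (g l0) r); rewrite e; split=> //.
    rewrite !deg_comp // [X in le_deg X _]addrC [X in le_deg _ (X + _)]addrC -addrA.
    apply/le_degP => j; have /le_degP/(_ j) := d0; rewrite !ffunE.
    by rewrite (leq_add2l (deg r j)).
  move=> z; rewrite src_comp // => rz.
  by rewrite !pre_comp // h0 // start_pre.
have [N [u uP]] := elem f fg; have [N' [v vP]] := elem f' f'g.
have inv (g g' : infpath L -> infpath L) M M' (w w' : A) : cancel g g' ->
    (forall l, le_deg M (deg l) -> exists c, [/\ tab w l c, le_deg (deg l) (deg c + M)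
      & forall z, src l = start z -> g (pre l z) = pre c z]) ->
    (forall l, le_deg M' (deg l) -> exists c, [/\ tab w' l c,
      le_deg (deg l) (deg c + M')
      & forall z, src l = start z -> g' (pre l z) = pre c z]) -> w' ** w = cs_one.
  move=> gK wP wP'; apply: (@ck_ext _ _ (M + M')) => l lM.
  have [|c [t lc gl]] := wP l; first by rewrite lM le_deg_addr.
  have [|d [t' _ gc]] := wP' c.
    rewrite lM [deg c + M]addrC in lc.
    apply/le_degP => j; have /le_degP/(_ j) := lc; rewrite !ffunE.
    by rewrite (leq_add2l (M j) (M' j) (deg c j)).
  have [lcs _] := t; have [cds _] := t'; have [z zl zap] := aperiodic_at (src l).
  have ld : l = d.
    apply: (aperiodic_pre_inj zap); rewrite -?cds -?lcs //.
    by rewrite -gc -?lcs // -gl // gK.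
  by have [_ ->] := tab_mul t' t; rewrite cs_mul1 ld.
have vu : v ** u = cs_one := inv _ _ _ _ _ _ fK uP vP.
have uv : u ** v = cs_one := inv _ _ _ _ _ _ f'K vP uP.
(* Having an inverse is not enough for [u] to be unitary. *)
have uu : u^† ** u = cs_one.
  have /choice[g gP] : forall l, exists c, deg l = N ->
      tab u l c /\ forall z, src l = start z -> f (pre l z) = pre c z.
    move=> l; have [lN|h'] := pselect (deg l = N); last by exists l.
    by have [|c [? _ ?]] := uP l; [rewrite lN le_deg_refl|exists c].
  have uE : u = \sum_(l <- paths N) s (g l) ** (s l)^†.
    rewrite -[u]cs_mulr1 -(ck_one N) cs_mul_sumr; apply: eq_big_seq => l.
    by rewrite mem_paths => /eqP/gP[[_ ul] _]; rewrite /q cs_mulA ul.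
  rewrite {1}uE cs_star_sum cs_mul_suml -(ck_one N); apply: eq_big_seq => l lp.
  have /eqP lN : deg l == N by rewrite -mem_paths.
  have [[lg _] fl] := gP l lN.
  rewrite uE cs_mul_sumr (big_rem l lp) /= big_seq big1 ?addr0.
    by rewrite cs_starM cs_starK -cs_mulA [X in _ ** X]cs_mulA ck_star_self -lg ?ck_rng;
      rewrite /q cs_mulA ck_src_mul.
  move=> d; rewrite (mem_rem_uniq _ (uniq_paths N)) inE mem_paths => /andP[dl /eqP dN].
  have [[dg _] fd] := gP d dN.
  rewrite cs_starM cs_starK -cs_mulA [X in _ ** X]cs_mulA ck_disjoint ?cs_mul0l ?cs_mul0r //.
  move=> y /cylinder_pre[z lz yz] /cylinder_pre[w dw yw].
  rewrite -lg in lz; rewrite -dg in dw.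
  have e : pre l z = pre d w by rewrite -[LHS]fK fl // -yz yw -fd // fK.
  move/eqP: dl; apply; rewrite -(seg_pre_deg dw) -(seg_pre_deg lz) e.
  by rewrite lN dN.
have uu' : u ** u^† = cs_one.
  suff -> : u^† = v by [].
  by rewrite -[LHS]cs_mulr1 -uv cs_mulA uu cs_mul1.
have uU : `[< is_unitary u >] by apply/asboolP.
pose U : unitary A := exist _ u uU.
have hU : ht s U.
  apply: (@tab_ht _ N) => l lN; have [|c [t _ _]] := uP l; last by exists c.
  by rewrite lN le_deg_refl.
exists U => // x; have [|c [t _ fl]] := uP (seg x N); first by rewrite deg_seg le_deg_refl.
have lz : src (seg x N) = start (shift N x) by exact: src_seg.
by rewrite -{1}(pre_seg N x) (ht_act_tab hU t lz) -fl // pre_seg.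
Qed.

Theorem ht_full_group : full_group prefix_germ (ht s) act.
Proof. by split; [exact: ht_germ_action|exact: ht_full]. Qed.

End CuntzKrieger.

(** * Bounded operators on a Hilbert space *)

Section HilbertSpaces.
Local Open Scope complex_scope.
Local Open Scope ring_scope.

(** Hilbert spaces over the complex numbers, through the real part [ip] of the inner
    product; [ip_scale] says that the adjoint of multiplication by a scalar is
    multiplication by its conjugate. *)
Record hilbert (R : realType) := Hilbert {
  hcar :> lmodType R[i];
  ip : hcar -> hcar -> R;
  ip_sym : forall f g, ip f g = ip g f;
  ipDl : forall f g h, ip (f + g) h = ip f h + ip g h;
  ip_scale : forall (c : R[i]) f g, ip (c *: f) g = ip f (Num.conj c *: g);
  ip_real : forall (r : R) f g, ip (r%:C *: f) g = r * ip f g;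
  ip_ge0 : forall f, 0 <= ip f f;
  ip_eq0 : forall f, ip f f = 0 -> f = 0;
  hilbert_complete : forall (I : Type) (F : set_system I) (u : I -> hcar),
    ProperFilter F ->
    (forall e, 0 < e -> exists2 P, F P & forall i j, P i -> P j ->
      ip (u i - u j) (u i - u j) <= e ^+ 2) ->
    exists l, forall e, 0 < e -> exists2 P, F P & forall i, P i ->
      ip (u i - l) (u i - l) <= e ^+ 2
}.

End HilbertSpaces.

Section HilbertTheory.
Local Open Scope complex_scope.
Local Open Scope ring_scope.
Context {R : realType} (H : hilbert R).
Implicit Types (f g h : H) (c : R[i]) (r : R).

Lemma ipDr f g h : ip h (f + g) = ip h f + ip h g.
Proof. by rewrite ip_sym ipDl !(ip_sym h). Qed.
Lemma ipNl f g : ip (- f) g = - ip f g.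
Proof. by rewrite -scaleN1r -(rmorph1 (real_complex R)) -rmorphN ip_real mulN1r. Qed.
Lemma ipNr f g : ip f (- g) = - ip f g.
Proof. by rewrite ip_sym ipNl ip_sym. Qed.
Lemma ipBl f g h : ip (f - g) h = ip f h - ip g h.
Proof. by rewrite ipDl ipNl. Qed.
Lemma ipBr f g h : ip h (f - g) = ip h f - ip h g.
Proof. by rewrite ipDr ipNr. Qed.
Lemma ip_realr r f g : ip f (r%:C *: g) = r * ip f g.
Proof. by rewrite ip_sym ip_real ip_sym. Qed.
Lemma ip0l f : ip 0 f = 0.
Proof. by rewrite -(subrr f) ipBl subrr. Qed.

Lemma ip_ext f g : (forall h, ip f h = ip g h) -> f = g.
Proof.
move=> e; apply/eqP; rewrite -subr_eq0; apply/eqP/ip_eq0.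
by rewrite ipBl e subrr.
Qed.

Definition nrm f : R := Num.sqrt (ip f f).

Lemma nrm_ge0 f : 0 <= nrm f. Proof. exact: sqrtr_ge0. Qed.
Lemma nrm_sq f : nrm f ^+ 2 = ip f f. Proof. by rewrite sqr_sqrtr ?ip_ge0. Qed.
Lemma nrm0 : nrm 0 = 0. Proof. by rewrite /nrm ip0l sqrtr0. Qed.
Lemma nrm_eq0 f : nrm f = 0 -> f = 0.
Proof. by move=> e; apply: ip_eq0; rewrite -nrm_sq e expr0n. Qed.

Lemma nrm_le r f : 0 <= r -> (nrm f <= r) = (ip f f <= r ^+ 2).
Proof. by move=> r0; rewrite -nrm_sq ler_pXn2r ?nnegrE ?nrm_ge0. Qed.

Lemma nrmN f : nrm (- f) = nrm f.
Proof. by rewrite /nrm ipNl ipNr opprK. Qed.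
Lemma nrm_subC f g : nrm (f - g) = nrm (g - f).
Proof. by rewrite -nrmN opprB. Qed.

Lemma norm_real_part c : `|c| = (complex.Re `|c|)%:C.
Proof. by case: c => x y; rewrite normc_def. Qed.

Lemma nrmZ c f : nrm (c *: f) = complex.Re `|c| * nrm f.
Proof.
have c0 : 0 <= complex.Re `|c| by have := normr_ge0 c; rewrite norm_real_part lecR.
rewrite /nrm ip_scale scalerA mulrC -normCK norm_real_part -rmorphXn ip_realr.
by rewrite sqrtrM ?sqr_ge0 // sqrtr_sqr ger0_norm.
Qed.

Lemma nrmZr r f : 0 <= r -> nrm (r%:C *: f) = r * nrm f.
Proof.
by move=> r0; rewrite nrmZ normc_def /= expr0n addr0 sqrtr_sqr ger0_norm.
Qed.

Lemma cauchy_schwarz f g : ip f g <= nrm f * nrm g.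
Proof.
have [g0|g0] := eqVneq (nrm g) 0.
  by rewrite g0 mulr0 (nrm_eq0 g0) ip_sym ip0l.
have gg : 0 < ip g g by rewrite -nrm_sq exprn_gt0 // lt_neqAle eq_sym g0 nrm_ge0.
have := ip_ge0 ((ip g g)%:C *: f - (ip f g)%:C *: g).
rewrite ipBl !ipBr !ip_real !ip_realr (ip_sym g f) => h.
have h2 : ip f g ^+ 2 <= ip f f * ip g g by nra.
have [n0|n0] := leP (ip f g) 0.
  by apply: (le_trans n0); rewrite mulr_ge0 ?nrm_ge0.
rewrite -(@ler_pXn2r _ 2) ?nnegrE ?(ltW n0) ?mulr_ge0 ?nrm_ge0 //.
by rewrite exprMn !nrm_sq.
Qed.

Lemma nrmD f g : nrm (f + g) <= nrm f + nrm g.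
Proof.
rewrite nrm_le ?addr_ge0 ?nrm_ge0 // ipDl !ipDr (ip_sym g f) sqrrD !nrm_sq.
have := cauchy_schwarz f g; lra.
Qed.

Lemma nrmB f g : nrm (f - g) <= nrm f + nrm g.
Proof. by rewrite -(nrmN g) nrmD. Qed.

Lemma abs_ip f g : `|ip f g| <= nrm f * nrm g.
Proof.
rewrite ler_norml cauchy_schwarz andbT lerNl -ipNl -(nrmN f).
exact: cauchy_schwarz.
Qed.

End HilbertTheory.

Section Operators.
Local Open Scope complex_scope.
Local Open Scope ring_scope.
Context {R : realType} (H : hilbert R).
Implicit Types (T S : H -> H) (f g h : H) (c : R[i]).

Definition adjoint_to T S : Prop := forall f g, ip (T f) g = ip f (S g).

Definition bounded_by T (M : R) : Prop := forall f, nrm (T f) <= M * nrm f.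

(** Having an adjoint is made part of the definition, in place of the Riesz
    representation theorem. *)
Definition is_bop T : Prop :=
  [/\ forall c f g, T (c *: f + g) = c *: T f + T g,
      exists2 M, 0 <= M & bounded_by T M &
      exists S, adjoint_to T S].

Definition bop_pred : {pred H -> H} := fun T => `[< is_bop T >].

Lemma bop_closed : submod_closed bop_pred.
Proof.
split.
  apply/asboolP; split.
  - by move=> c f g; rewrite scaler0 addr0.
  - by exists 0 => // f; rewrite mul0r nrm0.
  - by exists (fun=> 0) => f g; rewrite ip0l ip_sym ip0l.
move=> a T1 T2 /asboolP[l1 [M1 M10 b1] [S1 s1]] /asboolP[l2 [M2 M20 b2] [S2 s2]].
apply/asboolP; split.
- move=> c f g; rewrite ![(a *: T1 + T2) _]/(a *: T1 _ + T2 _) l1 l2.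
  by rewrite !scalerDr !scalerA addrACA mulrC.
- have a0 : 0 <= complex.Re `|a| by have := normr_ge0 a; rewrite norm_real_part lecR.
  exists (complex.Re `|a| * M1 + M2); first by rewrite addr_ge0 ?mulr_ge0.
  move=> f; rewrite [(a *: T1 + T2) _]/(a *: T1 _ + T2 _).
  apply: (le_trans (nrmD _ _)); rewrite nrmZ mulrDl -mulrA.
  by apply: lerD => //; exact: ler_wpM2l.
- exists (fun g => S1 (Num.conj a *: g) + S2 g) => f g.
  by rewrite [(a *: T1 + T2) _]/(a *: T1 _ + T2 _) ipDl ip_scale s1 s2 ipDr.
Qed.

HB.instance Definition _ := GRing.isSubmodClosed.Build _ _ bop_pred bop_closed.

Definition bop : Type := {T : H -> H | T \in bop_pred}.
HB.instance Definition _ := Choice.on bop.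
HB.instance Definition _ := SubType.on bop.
HB.instance Definition _ := [SubChoice_isSubLmodule of bop by <:].

Lemma bopP (T : bop) : is_bop (val T).
Proof. by case: T => T /= /asboolP. Qed.

Lemma bop_mem T : is_bop T -> T \in bop_pred.
Proof. by move=> h; apply/asboolP. Qed.

Definition mk_bop T (h : is_bop T) : bop := exist _ T (bop_mem h).

Lemma bop_eq (T S : bop) : (forall f, val T f = val S f) -> T = S.
Proof. by move=> e; apply: val_inj; apply/funext. Qed.

Lemma valD (T S : bop) f : val (T + S) f = val T f + val S f. Proof. by []. Qed.
Lemma valZ c (T : bop) f : val (c *: T) f = c *: val T f. Proof. by []. Qed.
Lemma valB (T S : bop) f : val (T - S) f = val T f - val S f. Proof. by []. Qed.

Section OneOperator.
Variable T : bop.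

Lemma bop_lin c f g : val T (c *: f + g) = c *: val T f + val T g.
Proof. by have [h _ _] := bopP T. Qed.
Lemma bop0 : val T 0 = 0.
Proof.
have := bop_lin 1 0 0; rewrite scaler0 addr0 scale1r => e.
by apply: (addrI (val T 0)); rewrite -e addr0.
Qed.
Lemma bopZ c f : val T (c *: f) = c *: val T f.
Proof. by rewrite -[c *: f]addr0 bop_lin bop0 addr0. Qed.
Lemma bopD f g : val T (f + g) = val T f + val T g.
Proof. by rewrite -[f]scale1r bop_lin !scale1r. Qed.

Definition opnorm : R := sup [set nrm (val T f) | f in [set f | nrm f <= 1]].

Let ball_set : set R := [set nrm (val T f) | f in [set f | nrm f <= 1]].

Let ball_has_sup : has_sup ball_set.
Proof.
have [_ [M M0 bM] _] := bopP T; split.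
  by exists (nrm (val T 0)), 0 => //=; rewrite nrm0.
exists M => _ [f f1 <-]; apply: (le_trans (bM f)).
by rewrite -[X in _ <= X]mulr1; exact: ler_wpM2l.
Qed.

Lemma opnorm_ge0 : 0 <= opnorm.
Proof.
apply: (le_trans (nrm_ge0 (val T 0))); apply: ub_le_sup; first by case: ball_has_sup.
by exists 0 => //=; rewrite nrm0.
Qed.

Lemma opnorm_bound f : nrm (val T f) <= opnorm * nrm f.
Proof.
have [f0|f0] := eqVneq (nrm f) 0; first by rewrite f0 mulr0 (nrm_eq0 f0) bop0 nrm0.
have fp : 0 < nrm f by rewrite lt_neqAle eq_sym f0 nrm_ge0.
have e : f = (nrm f)%:C *: ((nrm f)^-1%:C *: f).
  by rewrite scalerA -rmorphM mulfV // rmorph1 scale1r.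
rewrite {1}e bopZ nrmZr ?nrm_ge0 // mulrC ler_pM2r //.
apply: ub_le_sup; first by case: ball_has_sup.
exists ((nrm f)^-1%:C *: f) => //=.
by rewrite nrmZr ?invr_ge0 ?nrm_ge0 // mulVf.
Qed.

Lemma opnorm_le M : 0 <= M -> bounded_by (val T) M -> opnorm <= M.
Proof.
move=> M0 bM; apply: ge_sup; first by case: ball_has_sup.
move=> _ [f f1 <-]; apply: (le_trans (bM f)).
by rewrite -[X in _ <= X]mulr1; exact: ler_wpM2l.
Qed.

Definition bop_adj : H -> H := sval (cid (let: And3 _ _ h := bopP T in h)).

Lemma bop_adjP : adjoint_to (val T) bop_adj.
Proof. by rewrite /bop_adj; case: cid. Qed.

Lemma bop_adj_is_bop : is_bop bop_adj.
Proof.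
have aP := bop_adjP; split.
- move=> c f g; apply: ip_ext => h; rewrite ipDl ip_scale !(ip_sym _ h).
  rewrite (ip_sym _ (Num.conj c *: h)) -!aP ipDr bopZ.
  by rewrite (ip_sym _ (c *: f)) ip_scale (ip_sym f).
- exists opnorm; first exact: opnorm_ge0.
  move=> g; have [g0|g0] := eqVneq (nrm (bop_adj g)) 0.
    by rewrite g0 mulr_ge0 ?opnorm_ge0 ?nrm_ge0.
  have gp : 0 < nrm (bop_adj g) by rewrite lt_neqAle eq_sym g0 nrm_ge0.
  rewrite -(ler_pM2r gp) -expr2 nrm_sq -aP.
  apply: (le_trans (cauchy_schwarz _ _)); rewrite mulrAC.
  by apply: ler_wpM2r; [exact: nrm_ge0|exact: opnorm_bound].
- by exists (val T) => f g; rewrite ip_sym -aP ip_sym.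
Qed.

Definition bop_star : bop := mk_bop bop_adj_is_bop.

Lemma bop_starP f g : ip (val T f) g = ip f (val bop_star g).
Proof. exact: bop_adjP. Qed.

End OneOperator.

Lemma bop_star_uniq (T S : bop) : adjoint_to (val T) (val S) -> bop_star T = S.
Proof.
move=> TS; apply: bop_eq => g; apply: ip_ext => f.
by rewrite !(ip_sym _ f) -TS -bop_starP.
Qed.

Lemma bop_starK (T : bop) : bop_star (bop_star T) = T.
Proof. by apply: bop_star_uniq => f g; rewrite ip_sym -bop_starP ip_sym. Qed.

Lemma bop_starD (T S : bop) : bop_star (T + S) = bop_star T + bop_star S.
Proof. by apply: bop_star_uniq => f g; rewrite !valD ipDl ipDr !bop_starP. Qed.

Lemma bop_starB (T S : bop) : bop_star (T - S) = bop_star T - bop_star S.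
Proof. by apply: bop_star_uniq => f g; rewrite !valB ipBl ipBr !bop_starP. Qed.

Lemma bop_starZ c (T : bop) : bop_star (c *: T) = Num.conj c *: bop_star T.
Proof. by apply: bop_star_uniq => f g; rewrite !valZ ip_scale bop_starP bopZ. Qed.

Lemma opnorm_star (T : bop) : opnorm (bop_star T) = opnorm T.
Proof.
have le (S : bop) : opnorm (bop_star S) <= opnorm S.
  apply: opnorm_le (opnorm_ge0 _) _ => g.
  have [g0|g0] := eqVneq (nrm (val (bop_star S) g)) 0.
    by rewrite g0 mulr_ge0 ?opnorm_ge0 ?nrm_ge0.
  have gp : 0 < nrm (val (bop_star S) g) by rewrite lt_neqAle eq_sym g0 nrm_ge0.
  rewrite -(ler_pM2r gp) -expr2 nrm_sq -bop_starP.
  apply: (le_trans (cauchy_schwarz _ _)); rewrite mulrAC.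
  by apply: ler_wpM2r; [exact: nrm_ge0|exact: opnorm_bound].
by apply/eqP; rewrite eq_le le -{1}(bop_starK T) le.
Qed.

Lemma opnormD (T S : bop) : opnorm (T + S) <= opnorm T + opnorm S.
Proof.
apply: opnorm_le; first by rewrite addr_ge0 ?opnorm_ge0.
move=> f; rewrite valD mulrDl; apply: (le_trans (nrmD _ _)).
by apply: lerD; exact: opnorm_bound.
Qed.

Lemma opnorm_eq0 (T : bop) : opnorm T = 0 -> T = 0.
Proof.
move=> T0; apply: bop_eq => f; apply: nrm_eq0; apply/eqP.
by rewrite eq_le nrm_ge0 andbT; have := opnorm_bound T f; rewrite T0 mul0r.
Qed.

Lemma opnormZ c (T : bop) : opnorm (c *: T) = complex.Re `|c| * opnorm T.
Proof.
have n0 (d : R[i]) : 0 <= complex.Re `|d| by have := normr_ge0 d; rewrite norm_real_part lecR.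
have le d (S : bop) : opnorm (d *: S) <= complex.Re `|d| * opnorm S.
  apply: opnorm_le => [|f]; first by rewrite mulr_ge0 ?opnorm_ge0.
  by rewrite valZ nrmZ -mulrA ler_wpM2l // opnorm_bound.
apply/eqP; rewrite eq_le le andTb.
have [c0|c0] := eqVneq c 0.
  have z : complex.Re `|c| = 0 by apply: complexI; rewrite -norm_real_part; apply/eqP; rewrite normr_eq0 c0.
  by rewrite z mul0r opnorm_ge0.
have cp : 0 < complex.Re `|c|.
  by rewrite -(ltcR 0) -norm_real_part normr_gt0.
rewrite mulrC -ler_pdivlMr //.
have := le c^-1 (c *: T); rewrite scalerA mulVf // scale1r => h.
apply: (le_trans h); rewrite mulrC ler_wpM2l ?opnorm_ge0 //.
by rewrite normfV norm_real_part -fmorphV.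
Qed.

Definition bop_norm (T : bop) : R[i] := (opnorm T)%:C.

Lemma bop_normD (T S : bop) : bop_norm (T + S) <= bop_norm T + bop_norm S.
Proof. by rewrite /bop_norm -rmorphD lecR opnormD. Qed.
Lemma bop_normZ c (T : bop) : bop_norm (c *: T) = `|c| * bop_norm T.
Proof. by rewrite /bop_norm opnormZ rmorphM (norm_real_part c). Qed.
Lemma bop_norm_eq0 (T : bop) : bop_norm T = 0 -> T = 0.
Proof. by move=> [/opnorm_eq0]. Qed.

HB.instance Definition _ :=
  Lmodule_isNormed.Build R[i] bop bop_normD bop_normZ bop_norm_eq0.

Lemma bop_normE (T : bop) : `|T| = (opnorm T)%:C. Proof. by []. Qed.



Lemma le0_all_eps (x M : R) : 0 <= M -> (forall e, 0 < e -> x <= e * M) -> x <= 0.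
Proof.
move=> M0 h; apply/ler_addgt0Pr => d d0; rewrite add0r.
have M1 : 0 < M + 1 by lra.
apply: (le_trans (h (d / (M + 1)) (divr_gt0 d0 M1))).
by rewrite mulrAC ler_pdivrMr // ler_pM2l //; lra.
Qed.

Section Completeness.
Variables (F : set_system bop) (FF : ProperFilter F).
Hypothesis Fcauchy : cauchy F.

Lemma opnorm_cauchy (e : R) : 0 < e ->
  exists2 P, F P & forall T S : bop, P T -> P S -> opnorm (T - S) <= e.
Proof.
move=> e0; have e20 : 0 < (e / 2)%:C by rewrite ltcR divr_gt0.
have [x Fx] := (cauchyP F).1 Fcauchy _ e20.
exists (ball x (e / 2)%:C) => // T S.
rewrite -ball_normE /= !bop_normE !ltcR => xT xS.
have -> : T - S = (x - S) + -1 *: (x - T).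
  by rewrite scaleN1r opprB [RHS]addrC addrA subrK.
apply: (le_trans (opnormD _ _)); rewrite opnormZ normrN1.
have -> : complex.Re (1 : R[i]) = 1 by [].
lra.
Qed.

(** Operator-norm Cauchy filters converge, uniformly on the unit ball, to a map; [D] is
    used for the identity and for the adjoint. *)
Lemma uniform_limit (D : bop -> bop) :
  (forall T S : bop, opnorm (D T - D S) = opnorm (T - S)) ->
  exists l : H -> H, forall e, 0 < e ->
    exists2 P, F P & forall T : bop, P T -> forall f, nrm (val (D T) f - l f) <= e * nrm f.
Proof.
move=> Diso.
have close (T S : bop) f : nrm (val (D T) f - val (D S) f) <= opnorm (T - S) * nrm f.
  by rewrite -valB -Diso opnorm_bound.
have pt f : exists l, forall e, 0 < e -> exists2 P, F P & forall T : bop, P T ->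
    ip (val (D T) f - l) (val (D T) f - l) <= e ^+ 2.
  apply: hilbert_complete => e e0.
  have f1 : 0 < nrm f + 1 by have := nrm_ge0 f; lra.
  have [P FP hP] := opnorm_cauchy (divr_gt0 e0 f1).
  exists P => // T S PT PS; rewrite -nrm_le ?(ltW e0) //.
  apply: (le_trans (close _ _ _)).
  apply: (le_trans (ler_wpM2r (nrm_ge0 _) (hP _ _ PT PS))).
  by rewrite mulrAC ler_pdivrMr // ler_pM2l //; lra.
exists (fun f => sval (cid (pt f))) => e e0.
have [P FP hP] := opnorm_cauchy e0; exists P => // T PT f.
case: cid => l /= hl; apply/ler_addgt0Pr => d d0.
have [Q FQ hQ] := hl _ d0.
have [S [PS QS]] := filter_ex (filterI FP FQ).
have -> : val (D T) f - l = (val (D T) f - val (D S) f) + (val (D S) f - l).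
  by rewrite addrA subrK.
apply: (le_trans (nrmD _ _)); apply: lerD.
  apply: (le_trans (close _ _ _)); apply: ler_wpM2r; [exact: nrm_ge0|exact: hP].
by rewrite nrm_le ?(ltW d0) //; exact: hQ.
Qed.

(** The uniform limits of the operators and of their adjoints are adjoint to each
    other. *)
Lemma bop_cauchy_cvg : cvg F.
Proof.
have [l hl] := @uniform_limit id (fun _ _ => erefl).
have [l' hl'] : exists l' : H -> H, forall e, 0 < e -> exists2 P, F P &
    forall T : bop, P T -> forall f, nrm (val (bop_star T) f - l' f) <= e * nrm f.
  apply: uniform_limit => T S; rewrite -[RHS]opnorm_star.
  by rewrite bop_starB.
have lb : is_bop l.
  split.
  - move=> c f g; apply/eqP; rewrite -subr_eq0; apply/eqP/nrm_eq0/eqP.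
    rewrite eq_le nrm_ge0 andbT.
    have c0 : 0 <= complex.Re `|c| by have := normr_ge0 c; rewrite norm_real_part lecR.
    apply: (@le0_all_eps _ (nrm (c *: f + g) + (complex.Re `|c| * nrm f + nrm g))).
      by rewrite !addr_ge0 ?mulr_ge0 ?nrm_ge0.
    move=> e e0; have [P FP hP] := hl _ e0; have [T PT] := filter_ex FP.
    have -> : l (c *: f + g) - (c *: l f + l g) =
        (l (c *: f + g) - val T (c *: f + g)) +
        (c *: (val T f - l f) + (val T g - l g)).
      rewrite bop_lin scalerBr [X in _ = _ + X]addrACA -opprD.
      by rewrite addrA subrK.
    rewrite !mulrDr; apply: (le_trans (nrmD _ _)); apply: lerD.
      by rewrite nrm_subC; exact: hP.
    apply: (le_trans (nrmD _ _)); apply: lerD; last exact: hP.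
    by rewrite nrmZ mulrCA; apply: ler_wpM2l => //; exact: hP.
  - have [P FP hP] := hl 1 ltr01; have [T PT] := filter_ex FP.
    exists (opnorm T + 1); first by rewrite addr_ge0 ?opnorm_ge0.
    move=> f; have -> : l f = val T f - (val T f - l f) by rewrite opprB addrC subrK.
    rewrite mulrDl; apply: (le_trans (nrmB _ _)).
    by apply: lerD; [exact: opnorm_bound|exact: hP].
  - exists l' => f g; apply/eqP; rewrite -subr_eq0 -normr_le0.
    apply: (@le0_all_eps _ (nrm f * nrm g + nrm f * nrm g)).
      by rewrite !addr_ge0 ?mulr_ge0 ?nrm_ge0.
    move=> e e0; have [P FP hP] := hl _ e0; have [Q FQ hQ] := hl' _ e0.
    have [T [PT QT]] := filter_ex (filterI FP FQ).
    have -> : ip (l f) g - ip f (l' g) =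
        ip f (val (bop_star T) g - l' g) - ip (val T f - l f) g.
      by rewrite ipBr ipBl -bop_starP; lra.
    rewrite mulrDr; apply: (le_trans (ler_normB _ _)); apply: lerD.
      apply: (le_trans (abs_ip _ _)); rewrite mulrCA.
      by apply: ler_wpM2l; [exact: nrm_ge0|exact: hQ].
    apply: (le_trans (abs_ip _ _)); rewrite mulrA.
    by apply: ler_wpM2r; [exact: nrm_ge0|exact: hP].
apply/cvg_ex; exists (mk_bop lb); apply/(@cvgrPdist_le _ _ _ _ _ id) => e e0.
have er : e = (complex.Re e)%:C by rewrite -[in RHS](gtr0_norm e0) -norm_real_part gtr0_norm.
rewrite er ltcR in e0; have [P FP hP] := hl _ e0.
apply: filterS FP => T PT; rewrite bop_normE er lecR; apply: opnorm_le (ltW e0) _ => f.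
by rewrite valB nrm_subC; exact: hP.
Qed.

End Completeness.

HB.instance Definition _ := Uniform_isComplete.Build bop bop_cauchy_cvg.

Lemma bop_mul_is_bop (T S : bop) : is_bop (val T \o val S).
Proof.
split=> [c f g /=||].
- by rewrite !bop_lin.
- exists (opnorm T * opnorm S) => [|f /=]; first by rewrite mulr_ge0 ?opnorm_ge0.
  apply: (le_trans (opnorm_bound _ _)); rewrite -mulrA.
  by apply: ler_wpM2l; [exact: opnorm_ge0|exact: opnorm_bound].
- exists (val (bop_star S) \o val (bop_star T)) => f g /=.
  by rewrite !bop_starP.
Qed.

Definition bop_mul (T S : bop) : bop := mk_bop (bop_mul_is_bop T S).

Lemma bop_mulA (T S U : bop) : bop_mul T (bop_mul S U) = bop_mul (bop_mul T S) U.
Proof. exact: bop_eq. Qed.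
Lemma bop_mulDl (T S U : bop) : bop_mul (T + S) U = bop_mul T U + bop_mul S U.
Proof. exact: bop_eq. Qed.
Lemma bop_mulDr (T S U : bop) : bop_mul T (S + U) = bop_mul T S + bop_mul T U.
Proof. by apply: bop_eq => f; rewrite /= bopD. Qed.
Lemma bop_mulZl c (T S : bop) : bop_mul (c *: T) S = c *: bop_mul T S.
Proof. exact: bop_eq. Qed.
Lemma bop_mulZr c (T S : bop) : bop_mul T (c *: S) = c *: bop_mul T S.
Proof. by apply: bop_eq => f; rewrite /= bopZ. Qed.
Lemma bop_starM (T S : bop) :
  bop_star (bop_mul T S) = bop_mul (bop_star S) (bop_star T).
Proof. by apply: bop_star_uniq => f g /=; rewrite !bop_starP. Qed.

Lemma opnormM (T S : bop) : opnorm (bop_mul T S) <= opnorm T * opnorm S.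
Proof.
apply: opnorm_le; first by rewrite mulr_ge0 ?opnorm_ge0.
move=> f /=; apply: (le_trans (opnorm_bound _ _)); rewrite -mulrA.
by apply: ler_wpM2l; [exact: opnorm_ge0|exact: opnorm_bound].
Qed.

(** The square of the norm of [T f] is the inner product of [T^* T f] with [f]. *)
Lemma opnorm_star_mul (T : bop) : opnorm (bop_mul (bop_star T) T) = opnorm T ^+ 2.
Proof.
apply/eqP; rewrite eq_le; apply/andP; split.
  by apply: (le_trans (opnormM _ _)); rewrite opnorm_star expr2.
set M := opnorm (bop_mul _ _).
have M0 : 0 <= M := opnorm_ge0 _.
rewrite -(sqr_sqrtr M0) ler_pXn2r ?nnegrE ?opnorm_ge0 ?sqrtr_ge0 //.
apply: opnorm_le (sqrtr_ge0 _) _ => f.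
rewrite nrm_le ?mulr_ge0 ?sqrtr_ge0 ?nrm_ge0 // exprMn sqr_sqrtr //.
rewrite bop_starP; apply: (le_trans (cauchy_schwarz _ _)).
rewrite expr2 mulrCA; apply: ler_wpM2l; first exact: nrm_ge0.
exact: (opnorm_bound (bop_mul (bop_star T) T) f).
Qed.

Lemma bop_normM (T S : bop) : `|bop_mul T S| <= `|T| * `|S|.
Proof. by rewrite !bop_normE -rmorphM lecR opnormM. Qed.
Lemma bop_norm_star (T : bop) : `|bop_mul (bop_star T) T| = `|T| ^+ 2.
Proof. by rewrite !bop_normE -rmorphXn opnorm_star_mul. Qed.

Definition bounded_operators : cstar_algebra R :=
  CstarAlgebra bop_mulA bop_mulDl bop_mulDr bop_mulZl bop_mulZr bop_starK bop_starD
    bop_starZ bop_starM bop_normM bop_norm_star.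

End Operators.

(** * Square-summable functions *)

Section SquareSummable.
Local Open Scope complex_scope.
Local Open Scope ring_scope.
Context {R : realType} (I : countType).
Implicit Types (f g : I -> R[i]) (x : I) (F : I -> R).

(** The sums below run over this exhaustion of [I] by finite sets, so that absolutely
    convergent families can be treated as limits of sequences. *)
Definition initial (n : nat) : seq I := pmap (@pickle_inv I) (iota 0 n).

Lemma mem_initial n x : (x \in initial n) = (pickle x < n)%N.
Proof.
rewrite mem_pmap; apply/mapP/idP => [[j] | h].
  rewrite mem_iota add0n => jn e; suff -> : pickle x = j by [].
  by have := @pickle_invK I j; rewrite -e /=.
by exists (pickle x); rewrite ?mem_iota ?add0n // pickleK_inv.
Qed.

Lemma uniq_initial n : uniq (initial n).
Proof.
apply: (@pmap_uniq _ _ _ pickle); last exact: iota_uniq.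
exact: pickle_invK.
Qed.

Lemma sum_initial_le F (s : seq I) : (forall x, 0 <= F x) -> uniq s ->
  exists n, \sum_(x <- s) F x <= \sum_(x <- initial n) F x.
Proof.
move=> F0 us; exists (\max_(x <- s) pickle x).+1; set N := _.+1.
have sub x : x \in s -> x \in initial N.
  by move=> xs; rewrite mem_initial ltnS; exact: leq_bigmax_seq.
rewrite [X in _ <= X](bigID (mem s)) /= -[X in X <= _]addr0; apply: lerD.
  rewrite -[X in _ <= X]big_filter le_eqVlt; apply/orP; left; apply/eqP.
  apply: perm_big; apply: uniq_perm => //; first by rewrite filter_uniq ?uniq_initial.
  by move=> x; rewrite mem_filter; case: (boolP (x \in s)) => // /sub ->.
by apply: sumr_ge0.
Qed.

Definition partial_sum F (n : nat) : R := \sum_(x <- initial n) F x.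

Lemma partial_sum_le F m n : (forall x, 0 <= F x) -> (m <= n)%N ->
  partial_sum F m <= partial_sum F n.
Proof.
move=> F0 mn; rewrite /partial_sum [X in _ <= X](bigID (mem (initial m))) /=.
rewrite -[X in X <= _]addr0; apply: lerD; last exact: sumr_ge0.
rewrite -[X in _ <= X]big_filter le_eqVlt; apply/orP; left; apply/eqP.
apply: perm_big; apply: uniq_perm; rewrite ?filter_uniq ?uniq_initial //.
move=> x; rewrite mem_filter !mem_initial; case: (ltnP (pickle x) m) => //= h.
by rewrite (leq_trans h mn).
Qed.

Definition total_sum F : R := limn (partial_sum F).

Definition summable F : Prop := exists M, forall n, partial_sum F n <= M.

Lemma summable_cvg F : (forall x, 0 <= F x) -> summable F -> cvgn (partial_sum F).
Proof.
move=> F0 [M hM]; apply: nondecreasing_is_cvgn.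
  by move=> m n; exact: partial_sum_le.
by exists M => _ [n _ <-].
Qed.

Lemma partial_le_total F n : (forall x, 0 <= F x) -> summable F ->
  partial_sum F n <= total_sum F.
Proof.
move=> F0 sF; apply: nondecreasing_cvgn_le; last exact: summable_cvg.
by move=> m p; exact: partial_sum_le.
Qed.

Lemma total_sum_le F M : cvgn (partial_sum F) -> (forall n, partial_sum F n <= M) ->
  total_sum F <= M.
Proof. by move=> cF h; apply: limr_le => //; apply: nearW. Qed.

Lemma dominated_cvg F G : (forall x, `|F x| <= G x) -> summable G ->
  cvgn (partial_sum F).
Proof.
move=> FG [M hM].
have c1 : cvgn (partial_sum (fun x => G x + F x)).
  apply: summable_cvg => [x|].
    by have := FG x; rewrite ler_norml => /andP[h _]; lra.
  exists (M + M) => n; rewrite /partial_sum big_split /=; apply: lerD; first exact: hM.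
  apply: (le_trans _ (hM n)); apply: ler_sum => x _.
  exact: le_trans (ler_norm _) (FG x).
have G0 x : 0 <= G x by exact: le_trans (normr_ge0 _) (FG x).
have c2 : cvgn (partial_sum G) by apply: summable_cvg => //; exists M.
have -> : partial_sum F = partial_sum (fun x => G x + F x) \- partial_sum G.
  apply/funext => n; rewrite /partial_sum /= -sumrB; apply: eq_bigr => x _; lra.
exact: is_cvgB.
Qed.

Lemma total_sumD F G : cvgn (partial_sum F) -> cvgn (partial_sum G) ->
  total_sum (fun x => F x + G x) = total_sum F + total_sum G.
Proof.
move=> cF cG; rewrite /total_sum -limD //; congr (limn _).
by apply/funext => n; rewrite /partial_sum big_split.
Qed.

Lemma total_sumZ r F : cvgn (partial_sum F) ->
  total_sum (fun x => r * F x) = r * total_sum F.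
Proof.
move=> cF; rewrite /total_sum -[RHS]/(r *: limn (partial_sum F) : R^o).
rewrite -limZl_tmp //; congr (limn _).
by apply/funext => n; rewrite /partial_sum -mulr_sumr.
Qed.

(** The real part of the product of [a] with the conjugate of [b]. *)
Definition redot (a b : R[i]) : R :=
  complex.Re a * complex.Re b + complex.Im a * complex.Im b.

Definition square_sum f : I -> R := fun x => redot (f x) (f x).

Lemma square_sum_ge0 f x : 0 <= square_sum f x.
Proof. by rewrite /square_sum /redot -!expr2 addr_ge0 ?sqr_ge0. Qed.

Lemma redot_le (a b : R[i]) : `|redot a b| <= redot a a + redot b b.
Proof.
case: a b => [a a'] [b b']; rewrite ler_norml /redot /=.
have := (sqr_ge0 (a - b), sqr_ge0 (a' - b')); have := (sqr_ge0 (a + b), sqr_ge0 (a' + b')).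
by move=> [p1 p2] [m1 m2]; apply/andP; split; lra.
Qed.

Definition l2_pred : {pred I -> R[i]} := fun f => `[< summable (square_sum f) >].

Lemma l2_closed : submod_closed l2_pred.
Proof.
split.
  apply/asboolP; exists 0 => n; rewrite /partial_sum big1 // => x _.
  by rewrite /square_sum /redot /= !mul0r addr0.
move=> a f g /asboolP[M hM] /asboolP[N hN]; apply/asboolP.
have a0 : 0 <= redot a a by rewrite /redot -!expr2 addr_ge0 ?sqr_ge0.
exists (2 * redot a a * M + 2 * N) => n.
apply: (@le_trans _ _ (2 * redot a a * partial_sum (square_sum f) n +
   2 * partial_sum (square_sum g) n)); last first.
  by apply: lerD; apply: ler_wpM2l => //; rewrite ?mulr_ge0.
rewrite /partial_sum !mulr_sumr -big_split /=; apply: ler_sum => x _.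
rewrite /square_sum [(a *: f + g) x]/(a * f x + g x).
case: (a) (f x) (g x) => [u v] [p q] [r s]; rewrite /redot /=.
have : 0 <= (u * p - v * q - r) ^+ 2 + (u * q + v * p - s) ^+ 2.
  by rewrite addr_ge0 ?sqr_ge0.
lra.
Qed.

HB.instance Definition _ := GRing.isSubmodClosed.Build _ _ l2_pred l2_closed.

Definition l2 : Type := {f : I -> R[i] | f \in l2_pred}.
HB.instance Definition _ := Choice.on l2.
HB.instance Definition _ := SubType.on l2.
HB.instance Definition _ := [SubChoice_isSubLmodule of l2 by <:].

Lemma l2P (f : l2) : summable (square_sum (val f)).
Proof. by case: f => f /= /asboolP. Qed.

Lemma l2_mem f : summable (square_sum f) -> f \in l2_pred.
Proof. by move=> h; apply/asboolP. Qed.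

Definition mk_l2 f (h : summable (square_sum f)) : l2 :=
  exist _ f (l2_mem h).

Lemma l2_eq (f g : l2) : (forall x, val f x = val g x) -> f = g.
Proof. by move=> e; apply: val_inj; apply/funext. Qed.

Definition l2_ip (f g : l2) : R := total_sum (fun x => redot (val f x) (val g x)).

Lemma l2_ip_cvg (f g : l2) : cvgn (partial_sum (fun x => redot (val f x) (val g x))).
Proof.
apply: (@dominated_cvg _ (fun x => square_sum (val f) x + square_sum (val g) x)).
  by move=> x; exact: redot_le.
have [[M hM] [N hN]] := (l2P f, l2P g).
by exists (M + N) => n; rewrite /partial_sum big_split; apply: lerD; [exact: hM|exact: hN].
Qed.

Lemma l2_ip_sym (f g : l2) : l2_ip f g = l2_ip g f.
Proof.
by congr total_sum; apply/funext => x; rewrite /redot mulrC [X in _ + X]mulrC.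
Qed.

Lemma l2_ipDl (f g h : l2) : l2_ip (f + g) h = l2_ip f h + l2_ip g h.
Proof.
rewrite /l2_ip -total_sumD; [|exact: l2_ip_cvg..].
congr total_sum; apply/funext => x.
rewrite [val (f + g) x]/(val f x + val g x).
by case: (val f x) (val g x) (val h x) => [a b] [c d] [u v]; rewrite /redot /=; lra.
Qed.

Lemma l2_ip_scale (c : R[i]) (f g : l2) : l2_ip (c *: f) g = l2_ip f (Num.conj c *: g).
Proof.
congr total_sum; apply/funext => x.
rewrite [val (c *: f) x]/(c * val f x) [val (_ *: g) x]/(Num.conj c * val g x).
by case: (val f x) (val g x) c => [a b] [u v] [p q]; rewrite /redot /=; ring.
Qed.

Lemma l2_ip_real (r : R) (f g : l2) : l2_ip (r%:C *: f) g = r * l2_ip f g.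
Proof.
rewrite /l2_ip -total_sumZ; last exact: l2_ip_cvg.
congr total_sum; apply/funext => x.
rewrite [val (_ *: f) x]/(r%:C * val f x).
by case: (val f x) (val g x) => [a b] [u v]; rewrite /redot /=; ring.
Qed.

Lemma l2_ip_ge0 (f : l2) : 0 <= l2_ip f f.
Proof.
apply: le_trans (partial_le_total 0 (square_sum_ge0 _) (l2P f)).
by apply: sumr_ge0 => x _; exact: square_sum_ge0.
Qed.

Lemma l2_ip_eq0 (f : l2) : l2_ip f f = 0 -> f = 0.
Proof.
move=> f0; apply: l2_eq => x; apply/eqP.
have h : square_sum (val f) x <= 0.
  rewrite -f0; apply: le_trans (partial_le_total (pickle x).+1 (square_sum_ge0 _) (l2P f)).
  rewrite /partial_sum (bigD1_seq x) ?mem_initial ?uniq_initial //=.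
  by rewrite lerDl sumr_ge0 // => y _; exact: square_sum_ge0.
move: h; rewrite /square_sum /redot [val 0 x]/(0 : R[i]).
case: (val f x) => [a b] /=; rewrite -!expr2 => h.
have [a2 b2] := (sqr_ge0 a, sqr_ge0 b).
have /eqP : a ^+ 2 = 0 by lra.
have /eqP : b ^+ 2 = 0 by lra.
by rewrite !expf_eq0 /= => /eqP -> /eqP ->.
Qed.

Lemma filter_complete (T : Type) (F : set_system T) (v : T -> R) : ProperFilter F ->
  (forall e, 0 < e -> exists2 P, F P & forall i j, P i -> P j -> `|v i - v j| <= e) ->
  exists l : R, v i @[i --> F] --> l.
Proof.
move=> FF h; apply/(@cvg_ex R (v @ F)).
apply: (@cauchy_cvg R (v @ F)); apply: cauchy_exP => e e0.
have e2 : 0 < e / 2 by rewrite divr_gt0.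
have [P FP hP] := h _ e2.
have [i Pi] := filter_ex FP; exists (v i).
apply: (@filterS _ F _ P) => // j Pj; rewrite /= -ball_normE /=.
by apply: (le_lt_trans (hP _ _ Pi Pj)); lra.
Qed.

(** The limit is taken coordinatewise; the bound on differences passes to the limit in
    each finite partial sum, uniformly in the number of terms. *)
Lemma l2_complete (T : Type) (F : set_system T) (u : T -> l2) : ProperFilter F ->
  (forall e, 0 < e -> exists2 P, F P & forall i j, P i -> P j ->
    l2_ip (u i - u j) (u i - u j) <= e ^+ 2) ->
  exists l, forall e, 0 < e -> exists2 P, F P & forall i, P i ->
    l2_ip (u i - l) (u i - l) <= e ^+ 2.
Proof.
move=> FF h.
have partial (f : l2) n : partial_sum (square_sum (val f)) n <= l2_ip f f.
  exact: partial_le_total (square_sum_ge0 _) (l2P f).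
have term (f : l2) x : square_sum (val f) x <= l2_ip f f.
  apply: le_trans (partial f (pickle x).+1).
  rewrite /partial_sum (bigD1_seq x) ?mem_initial ?uniq_initial //=.
  by rewrite lerDl sumr_ge0 // => y _; exact: square_sum_ge0.
have coord x : exists l : R[i], complex.Re (val (u i) x) @[i --> F] --> complex.Re l /\
    complex.Im (val (u i) x) @[i --> F] --> complex.Im l.
  have small e : 0 < e -> exists2 P, F P & forall i j, P i -> P j ->
      `|complex.Re (val (u i) x) - complex.Re (val (u j) x)| <= e /\
      `|complex.Im (val (u i) x) - complex.Im (val (u j) x)| <= e.
    move=> e0; have [P FP hP] := h _ e0; exists P => // i j Pi Pj.
    have := le_trans (term _ x) (hP _ _ Pi Pj).
    rewrite /square_sum /redot [val (_ - _) x]/(val (u i) x - val (u j) x).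
    case: (val (u i) x) (val (u j) x) => [a b] [c d] /=; rewrite -!expr2 => le.
    have [s1 s2] := (sqr_ge0 (a - c), sqr_ge0 (b - d)).
    split; rewrite -(@ler_pXn2r _ 2) ?nnegrE ?(ltW e0) // real_normK ?num_real //; lra.
  have [a ha] : exists l : R, complex.Re (val (u i) x) @[i --> F] --> l.
    apply: filter_complete => e /small[P FP hP].
    by exists P => // i j Pi Pj; have [] := hP _ _ Pi Pj.
  have [b hb] : exists l : R, complex.Im (val (u i) x) @[i --> F] --> l.
    apply: filter_complete => e /small[P FP hP].
    by exists P => // i j Pi Pj; have [] := hP _ _ Pi Pj.
  by exists (a +i* b).
have [l hl] := choice coord.
have bnd e : 0 < e -> exists2 P, F P & forall i, P i -> forall n,
    partial_sum (square_sum (val (u i) - l)) n <= e ^+ 2.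
  move=> e0; have [P FP hP] := h _ e0; exists P => // i Pi n.
  have c : partial_sum (square_sum (val (u i - u j))) n @[j --> F] -->
      partial_sum (square_sum (val (u i) - l)) n.
    rewrite /partial_sum; apply: cvg_big => [|x _]; first exact: add_continuous.
    have [ra rb] := hl x.
    have E a : redot (val (u i) x - a) (val (u i) x - a) =
       (complex.Re (val (u i) x) - complex.Re a) * (complex.Re (val (u i) x) - complex.Re a) +
       (complex.Im (val (u i) x) - complex.Im a) * (complex.Im (val (u i) x) - complex.Im a).
      by case: (val (u i) x) a => [p q] [r s].
    rewrite [square_sum _ x]E; under eq_cvg do rewrite [square_sum _ _]E.
    by apply: cvgD; apply: cvgM; apply: cvgB => //; exact: cvg_cst.
  have -> : partial_sum (square_sum (val (u i) - l)) n =
      lim (partial_sum (square_sum (val (u i - u j))) n @[j --> F]).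
    by apply/esym/cvg_lim.
  apply: limr_le; first by apply/cvg_ex; eexists; exact: c.
  by apply: filterS FP => j Pj; exact: le_trans (partial _ n) (hP _ _ Pi Pj).
have ml : l \in l2_pred.
  have [P FP hP] := bnd 1 ltr01; have [i Pi] := filter_ex FP.
  have -> : l = val (u i) - (val (u i) - l) by rewrite opprB addrC subrK.
  apply: rpredB; first exact: valP.
  by apply: l2_mem; exists (1 ^+ 2); exact: hP.
exists (exist _ l ml) => e e0; have [P FP hP] := bnd _ e0; exists P => // i Pi.
by apply: total_sum_le; [exact: l2_ip_cvg|exact: hP].
Qed.

Definition l2_hilbert : hilbert R :=
  Hilbert l2_ip_sym l2_ipDl l2_ip_scale l2_ip_real l2_ip_ge0 l2_ip_eq0 l2_complete.

End SquareSummable.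

Section PartialInjections.
Local Open Scope complex_scope.
Local Open Scope ring_scope.
Context {R : realType} {I : countType}.
Local Notation H := (@l2_hilbert R I).
Implicit Types (f : @l2 R I) (x y : I).

Definition inverse_partial (g h : I -> option I) : Prop :=
  forall x y, g x = Some y <-> h y = Some x.

Definition pull (g : I -> option I) (v : I -> R[i]) : I -> R[i] :=
  fun x => if g x is Some y then v y else 0.

Section OnePartialInjection.
Variables (g h : I -> option I) (gh : inverse_partial g h).

Lemma pull_bound f n : partial_sum (square_sum (pull g (val f))) n <= l2_ip f f.
Proof.
have us : uniq (pmap g (initial I n)).
  apply: (@pmap_uniq _ _ _ (fun y => odflt y (h y))); last exact: uniq_initial.
  by move=> x /=; case E: (g x) => [y|] //=; rewrite ((gh _ _).1 E).
have [m hm] := sum_initial_le (square_sum_ge0 (val f)) us.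
apply: le_trans (partial_le_total m (square_sum_ge0 _) (l2P f)).
apply: le_trans hm; rewrite /partial_sum le_eqVlt; apply/orP; left; apply/eqP.
elim: (initial I n) => [|x s IH]; first by rewrite !big_nil.
rewrite big_cons IH /= {1}/square_sum /pull; case: (g x) => [y|] /=.
  by rewrite big_cons.
by rewrite /redot /= !mul0r !addr0 add0r.
Qed.

Lemma pull_summable f : summable (square_sum (pull g (val f))).
Proof. by exists (l2_ip f f); exact: pull_bound. Qed.

Definition pull_fun f : @l2 R I := mk_l2 (pull_summable f).

Lemma pull_ip_le f : l2_ip (pull_fun f) (pull_fun f) <= l2_ip f f.
Proof. by apply: total_sum_le; [exact: l2_ip_cvg|exact: pull_bound]. Qed.

Lemma pull_linear c f f' : pull_fun (c *: f + f') = c *: pull_fun f + pull_fun f'.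
Proof.
apply: l2_eq => x; rewrite [RHS]/(c * pull g (val f) x + pull g (val f') x).
rewrite [LHS]/(pull g (fun y => c * val f y + val f' y) x) /pull.
by case: (g x) => //; rewrite mulr0 -[RHS]/(0 + 0 : R[i]) addr0.
Qed.

End OnePartialInjection.

Lemma inverse_partial_sym g h : inverse_partial g h -> inverse_partial h g.
Proof. by move=> gh x y; split=> /gh. Qed.

(** Being isometric on the functions supported on its domain, the operator of a
    partial injection is adjoint to the one of the inverse, by polarization. *)
Lemma pull_adjoint g h (gh : inverse_partial g h) (f k : @l2 R I) :
  l2_ip (pull_fun gh f) k = l2_ip f (pull_fun (inverse_partial_sym gh) k).
Proof.
set T := pull_fun gh; set S := pull_fun _.
have STS a : S (T (S a)) = S a.
  apply: l2_eq => x /=; rewrite /pull; case E: (h x) => [y|] //=.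
  by have /gh -> := E; rewrite E.
have TST a : T (S (T a)) = T a.
  apply: l2_eq => x /=; rewrite /pull; case E: (g x) => [y|] //=.
  by have /gh -> := E; rewrite E.
have iso a : l2_ip (S (T a)) (S (T a)) = l2_ip (T a) (T a).
  apply/eqP; rewrite eq_le pull_ip_le /=.
  by rewrite -{1 2}(TST a) pull_ip_le.
have pol (a b : H) : ip a b = (ip (a + b) (a + b) - ip a a - ip b b) / 2.
  by rewrite ipDl !ipDr (ip_sym b a); field.
have TD a b : T (a + b) = T a + T b by have := pull_linear gh 1 a b; rewrite !scale1r.
have SD a b : S (a + b) = S a + S b.
  by have := pull_linear (inverse_partial_sym gh) 1 a b; rewrite !scale1r.
have iso2 a b : l2_ip (S (T a)) (S (T b)) = l2_ip (T a) (T b).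
  rewrite [LHS](pol (S (T a)) (S (T b))) [RHS](pol (T a) (T b)).
  have := iso (a + b); rewrite TD SD => E.
  rewrite [ip (_ + _) _]E.
  by rewrite [in LHS]/ip /= !iso.
have -> : l2_ip (T f) k = l2_ip (T f) (T (S k)).
  congr total_sum; apply/funext => x /=; rewrite /pull.
  case E: (g x) => [y|] //=; first by have /gh -> := E.
  by rewrite /redot /= !mul0r.
have -> : l2_ip f (S k) = l2_ip (S (T f)) (S k).
  congr total_sum; apply/funext => x /=; rewrite /pull.
  case E: (h x) => [y|] //=; first by have /gh -> := E.
  by rewrite /redot /= !mulr0.
by rewrite -iso2 STS.
Qed.

Lemma pull_is_bop g h (gh : inverse_partial g h) : @is_bop R H (pull_fun gh).
Proof.
split.
- by move=> c a b; exact: pull_linear.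
- exists 1 => // f; rewrite mul1r nrm_le ?nrm_ge0 // nrm_sq; exact: pull_ip_le.
- by exists (pull_fun (inverse_partial_sym gh)) => a b; exact: pull_adjoint.
Qed.

(** The partial isometry whose matrix is the graph of [g]. *)
Definition pull_op g h (gh : inverse_partial g h) : bounded_operators H :=
  mk_bop (pull_is_bop gh).

Lemma pull_op_star g h (gh : inverse_partial g h) :
  cs_star (pull_op gh) = pull_op (inverse_partial_sym gh).
Proof. by apply: bop_star_uniq => a b; exact: pull_adjoint. Qed.

End PartialInjections.

(** * A representation on a tail class *)

Section PathModel.
Local Open Scope complex_scope.
Local Open Scope ring_scope.
Context {R : realType} {k : nat} {L : kgraph k} (x0 : infpath L).
Implicit Types (l a b : mor L) (v w : vertex L) (m n p : degree k).

(** Adding and removing prefixes does not leave the class of [x0], and the class is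
    countable, because a path in it is determined by a prefix and a tail of [x0]. *)
Definition tail_equivalent (y : infpath L) : Prop := exists m n, shift m y = shift n x0.

Lemma tail_shift p (y : infpath L) : tail_equivalent y -> tail_equivalent (shift p y).
Proof.
by move=> [m [n e]]; exists m, (n + p); rewrite shift_shift addrC -!shift_shift e.
Qed.

Lemma tail_pre l (y : infpath L) : src l = start y -> tail_equivalent y ->
  tail_equivalent (pre l y).
Proof.
move=> ly [m [n e]]; exists (deg l + m), n.
by rewrite -shift_shift shift_pre.
Qed.

Definition tail_class : Type := {y : infpath L | `[< tail_equivalent y >]}.
HB.instance Definition _ := Choice.on tail_class.
HB.instance Definition _ := SubType.on tail_class.

Lemma tail_classP (y : tail_class) : tail_equivalent (val y).
Proof. by case: y => y /= /asboolP. Qed.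

Definition tail_mk (y : infpath L) (h : tail_equivalent y) : tail_class :=
  exist _ y (introT (asboolP (tail_equivalent y)) h).

Lemma tail_code_exists (y : tail_class) :
  exists c : mor L * degree k, src c.1 = start (shift c.2 x0) /\
    pre c.1 (shift c.2 x0) = val y.
Proof.
have [m [n e]] := tail_classP y; exists (seg (val y) m, n); split.
  by rewrite -[LHS]/(src (seg (val y) m)) -[RHS]/(start (shift n x0)) -e src_seg.
by rewrite -[LHS]/(pre (seg (val y) m) (shift n x0)) -e pre_seg.
Qed.

Definition tail_code (y : tail_class) : mor L * degree k := sval (cid (tail_code_exists y)).
Definition tail_decode (c : mor L * degree k) : option tail_class :=
  insub (pre c.1 (shift c.2 x0)).

Lemma tail_codeK : pcancel tail_code tail_decode.
Proof.
move=> y; rewrite /tail_code /tail_decode; case: cid => c /= [_ ->].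
by rewrite valK.
Qed.

HB.instance Definition _ := PCanIsCountable tail_codeK.

Definition class_shift p (y : tail_class) : tail_class :=
  tail_mk (tail_shift p (tail_classP y)).

Definition strip l (y : tail_class) : option tail_class :=
  if `[< cylinder l (val y) >] then Some (class_shift (deg l) y) else None.
Definition attach l (y : tail_class) : option tail_class :=
  if src l == start (val y) then insub (pre l (val y)) else None.

Lemma strip_attach l : inverse_partial (strip l) (attach l).
Proof.
move=> y z; rewrite /strip /attach; split.
  case: asboolP => // /cylinder_pre[x lx yx] [<-].
  rewrite -[val (class_shift _ _)]/(shift (deg l) (val y)) yx shift_pre // lx eqxx.
  by rewrite -yx valK.
case: eqP => // lz; case: insubP => // w _ wz [<-].
have c : cylinder l (val w) by apply/cylinder_pre; exists (val z).
case: asboolP => // _; congr Some; apply: val_inj.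
by rewrite -[LHS]/(shift (deg l) (val w)) wz shift_pre.
Qed.

Local Notation H := (@l2_hilbert R tail_class).
Local Notation B := (bounded_operators H).

(** The operator taking the basis vector of [x] to that of [l x], or to zero. *)
Definition creation l : B := pull_op (strip_attach l).

Lemma creationE l (f : H) y : val (val (creation l) f) y =
  if `[< cylinder l (val y) >] then val f (class_shift (deg l) y) else 0.
Proof. by rewrite /= /pull /strip; case: asboolP. Qed.

Lemma creation_starE l (f : H) y : val (val (creation l)^† f) y =
  if attach l y is Some z then val f z else 0.
Proof.
by rewrite /creation pull_op_star.
Qed.

Lemma op_eq (S T : B) : (forall (f : H) y, val (val S f) y = val (val T f) y) -> S = T.
Proof. by move=> e; apply: bop_eq => f; apply: l2_eq => y; exact: e. Qed.

Lemma op_addE (S T : B) (f : H) y :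
  val (val (S + T) f) y = val (val S f) y + val (val T f) y.
Proof.
exact: (congr1 (fun g : H => val g y) (@valD R H S T f)).
Qed.

Lemma op_mulE (S T : B) (f : H) : val (S ** T) f = val S (val T f).
Proof. by []. Qed.

Lemma creationT l (f : H) y : cylinder l (val y) ->
  val (val (creation l) f) y = val f (class_shift (deg l) y).
Proof. by move=> c; rewrite creationE; case: asboolP. Qed.

Lemma creationF l (f : H) y : ~ cylinder l (val y) -> val (val (creation l) f) y = 0.
Proof. by move=> c; rewrite creationE; case: asboolP. Qed.

Lemma creation_starT l (f : H) (y z : tail_class) : src l = start (val y) ->
  val z = pre l (val y) -> val (val (creation l)^† f) y = val f z.
Proof.
move=> ly zE; rewrite creation_starE /attach ly eqxx.
by case: insubP => [w _|] e; [congr (val f _); apply: val_inj; rewrite e zE|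
  move: e; rewrite -zE (valP z)].
Qed.

Lemma creation_starF l (f : H) y : src l <> start (val y) ->
  val (val (creation l)^† f) y = 0.
Proof. by move=> /eqP/negPf ly; rewrite creation_starE /attach ly. Qed.

Lemma cylinder_idm v (x : infpath L) : cylinder (idm v) x <-> start x = v.
Proof.
rewrite cylinder_seg deg_idm seg0; split=> [/(congr1 (@rng _ _))|->//].
by rewrite !rng_idm.
Qed.

Lemma creation_idm v (f : H) y :
  val (val (creation (idm v)) f) y = if start (val y) == v then val f y else 0.
Proof.
case: eqP => [e|ne]; last by rewrite creationF // => /cylinder_idm.
rewrite creationT; last exact/cylinder_idm.
by congr (val f _); apply: val_inj; rewrite -[LHS]/(shift _ (val y)) deg_idm shift0.
Qed.

Lemma creation_range l (f : H) y : val (val (creation l ** (creation l)^†) f) y =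
  if `[< cylinder l (val y) >] then val f y else 0.
Proof.
rewrite op_mulE creationE; case: asboolP => // /cylinder_pre[x lx yx].
have e : shift (deg l) (val y) = x by rewrite yx shift_pre.
by rewrite (@creation_starT _ _ _ y) // -[val (class_shift _ _)]/(shift (deg l) (val y)) e.
Qed.

Lemma creation_source l : (creation l)^† ** creation l = creation (idm (src l)).
Proof.
apply: op_eq => f y; rewrite op_mulE creation_idm; case: eqP => [e|ne]; last first.
  by rewrite creation_starF // => /esym.
pose z := tail_mk (tail_pre (esym e) (tail_classP y)).
have zE : val z = pre l (val y) by [].
rewrite (creation_starT _ (esym e) zE) creationT; last first.
  by rewrite zE; apply/cylinder_pre; exists (val y).
congr (val f _); apply: val_inj.
by rewrite -[LHS]/(shift (deg l) (val z)) zE shift_pre.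
Qed.

Lemma creation_comp a b : src a = rng b ->
  creation (comp a b) = creation a ** creation b.
Proof.
move=> ab; apply: op_eq => f y; rewrite op_mulE.
have [c|nc] := pselect (cylinder (comp a b) (val y)).
  have [x bx yx] := (cylinder_pre _ _).1 c; rewrite src_comp // in bx.
  have ax : src a = start (pre b x) by rewrite start_pre.
  rewrite pre_comp // in yx.
  rewrite !creationT //; first last.
  - by apply/cylinder_pre; exists (pre b x).
  - rewrite -[val (class_shift _ _)]/(shift (deg a) (val y)) yx shift_pre //.
    by apply/cylinder_pre; exists x.
  congr (val f _); apply: val_inj.
  rewrite -[LHS]/(shift (deg (comp a b)) (val y)).
  rewrite -[RHS]/(shift (deg b) (shift (deg a) (val y))).
  by rewrite shift_shift deg_comp.
rewrite creationF //; have [ca|nca] := pselect (cylinder a (val y)); last first.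
  by rewrite creationF.
rewrite creationT // creationF // => cb; apply: nc.
have [x ax yx] := (cylinder_pre _ _).1 ca.
move: cb; rewrite -[val (class_shift _ _)]/(shift (deg a) (val y)) yx shift_pre //.
move=> /cylinder_pre[w bw xw]; apply/cylinder_pre; exists w; first by rewrite src_comp.
by rewrite pre_comp // xw.
Qed.

(** The last relation says that a path from [v] has exactly one initial segment of each
    degree. *)
Lemma creation_ck (Lrow : row_finite L) : is_ck_family creation.
Proof.
split.
- move=> l; apply: op_eq => f y; rewrite op_mulE creation_range.
  by case: asboolP => // c; rewrite creationF.
- move=> v; split.
    by apply: op_eq => f y; rewrite op_mulE !creation_idm; case: eqP.
  have e := creation_source (idm v); rewrite src_idm in e.
  by rewrite -e cs_starM cs_starK.
- move=> v w vw; apply: op_eq => f y; rewrite op_mulE !creation_idm.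
  case: eqP => [->|//]; case: eqP => [vw'|//].
  by case: vw.
- exact: creation_comp.
- exact: creation_source.
move=> v n; apply: op_eq => f y; rewrite creation_idm.
have fin := Lrow v n; rewrite fsbig_finite //=.
pose ev (T : B) : R[i] := val (val T f) y.
have evS (s : seq (mor L)) (T : mor L -> B) :
    ev (\sum_(m <- s) T m) = \sum_(m <- s) ev (T m).
  elim: s => [|m s IH]; first by rewrite !big_nil.
  by rewrite !big_cons -IH; exact: op_addE.
rewrite -[RHS]/(ev _) evS.
under eq_bigr => m _ do rewrite /ev creation_range.
case: eqP => [yv|yv].
  have m0 : paths_from v n (seg (val y) n) by split; rewrite ?rng_seg ?deg_seg.
  rewrite (bigD1_seq (seg (val y) n)); [|by rewrite in_fset_set // inE|exact: finmap.fset_uniq].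
  rewrite /=.
  case: asboolP => [_|[]]; last by apply/cylinder_seg; rewrite deg_seg.
  rewrite big_seq_cond big1 ?addr0 // => m /andP[]; rewrite in_fset_set // inE.
  move=> [_ dm] /eqP ne; case: asboolP => // /cylinder_seg; rewrite dm => e.
  by case: ne; rewrite -{1}e.
rewrite big_seq big1 // => m; rewrite in_fset_set // inE => -[rm _].
case: asboolP => // /cylinder_seg e; case: yv.
by rewrite -rm -e rng_seg.
Qed.

Lemma creation_neq0 (y : tail_class) : creation (idm (start (val y))) != 0.
Proof.
pose d : tail_class -> R[i] := fun z => if z == y then 1 else 0.
have sd : summable (square_sum d).
  exists 1 => n; rewrite /partial_sum.
  have [yn|yn] := boolP (y \in initial tail_class n).
    rewrite (bigD1_seq y) ?uniq_initial //= big1 => [|z /negPf zy].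
      by rewrite /square_sum /d eqxx /redot /= mulr1 mulr0 !addr0.
    by rewrite /square_sum /d zy /redot /= mulr0 addr0.
  rewrite big_seq big1 // => z zn; rewrite /square_sum /d.
  by case: eqP => [e|_]; [move: yn; rewrite -e zn|rewrite /redot /= mulr0 addr0].
apply/eqP => /(congr1 (fun T : B => val (val T (mk_l2 sd)) y)).
rewrite creation_idm eqxx /= /d eqxx => /eqP; apply/negP.
exact: oner_neq0.
Qed.

End PathModel.

(** The universal family maps onto the concrete one on the tail class of any infinite
    path, and by strong connectedness a tail class meets every vertex. *)
Lemma generator_neq0 (R : realType) (k : nat) (L : kgraph k) (A : cstar_algebra R)
  (s : mor L -> A) (x0 : infpath L) (v : vertex L) : row_finite L ->
  strongly_connected L -> is_kgraph_algebra s -> (s (idm v) != 0)%R.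
Proof.
move=> Lrow Lconn [_ _ universal].
(* The path [l x0] starts at [v]. *)
have [l [rl sl]] := Lconn v (start x0).
have t : tail_equivalent x0 (pre l x0).
  by apply: tail_pre => //; exists 0%R, 0%R.
have [f _ fs] := universal _ _ (@creation_ck R k L x0 Lrow).
have := creation_neq0 (R := R) (tail_mk t).
rewrite -[val (tail_mk _)]/(pre l x0) start_pre // rl -fs.
by apply: contra_neq => ->; rewrite raddf0.
Qed.

(** * The derived subgroup *)

Section DerivedType.
Context {gT : groupType} (G : set gT).
Local Notation K := (commutator_subgroup G).
Local Open Scope group_scope.

Lemma val_derived (u : derived G) : K (val u).
Proof. exact: (set_mem (valP u)). Qed.

Definition mk_derived x (Kx : K x) : derived G := exist _ x (mem_set Kx).

(** Subgroups of the type [derived G] are studied through their images in the ambient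
    group. *)
Lemma image_subgroup (N : set (derived G)) : is_subgroup N -> is_subgroup (val @` N).
Proof.
move=> sN; split=> [|_ _ [u Nu <-] [v Nv <-]|_ [u Nu <-]].
- by exists 1 => //; exact: subgroup1 sN.
- by exists (u * v) => //; exact: (subgroupM sN).
- by exists u^-1 => //; exact: (subgroupV sN).
Qed.

Lemma image_normal_subgroup (N : set (derived G)) :
  is_normal_subgroup setT N -> is_normal_subgroup K (val @` N).
Proof.
move=> [sN _ NJ]; split; first exact: image_subgroup.
  by move=> _ [u _ <-]; exact: val_derived.
move=> g _ Kg [u Nu <-]; exists (u ^ mk_derived Kg) => //.
exact: NJ.
Qed.

(** The image of the derived subgroup of the type [derived G] contains all commutators of
    [K], hence [commutator_subgroup K]. *)
Lemma derived_type_perfect : K `<=` commutator_subgroup K ->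
  commutator_subgroup [set: derived G] = setT.
Proof.
move=> perf; rewrite -subTset => u _.
suff [w Nw /val_inj <- //] : (val @` commutator_subgroup [set: derived G]) (val u).
have im : commutator_subgroup K `<=` val @` commutator_subgroup [set: derived G].
  apply: commutator_subgroup_min.
    exact/image_subgroup/commutator_subgroupP.
  move=> f g Kf Kg; exists [~ mk_derived Kf, mk_derived Kg] => //.
  exact: sub_commutator_subgroup.
exact: (im _ (perf _ (val_derived u))).
Qed.

Lemma derived_type_simple :
  (forall N, is_normal_subgroup K N -> N <> [set 1] -> N = K) ->
  forall N : set (derived G), is_normal_subgroup setT N -> N = [set 1] \/ N = setT.
Proof.
move=> simple N nN; have [N1|N1] := pselect (val @` N = [set 1]); [left|right].
  rewrite eqEsubset; split=> [u Nu|_ ->]; last by have [[]] := nN.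
  by apply: val_inj; suff : [set 1] (val u) by []; rewrite -N1; exists u.
rewrite -subTset => u _.
have : (val @` N) (val u).
  by rewrite (simple _ (image_normal_subgroup nN) N1); exact: val_derived.
by move=> [w Nw /val_inj <-].
Qed.

End DerivedType.

Section DerivedAction.
Context {X : topologicalType}.
Hypotheses (Xbasis : clopen_basis X) (Xsep : clopen_separated X) (Xperf : perfect X).
Hypothesis X0 : [set: X] !=set0.
Variable loc : (X -> X) -> X -> Prop.
Hypotheses (Hloc : germs loc) (Hpi : purely_infinite loc).
Context {gT : groupType} (G : set gT) (act : gT -> X -> X).
Hypothesis HG : full_group loc G act.
Local Open Scope group_scope.

Lemma derived_simple_group : simple_group (derived G).
Proof.
split; last exact: (derived_type_simple (derived_simple Xbasis Xsep Xperf Hloc Hpi HG X0)).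
have [f [g [Kf Kg fg]]] := derived_noncommuting Xbasis Xsep Xperf Hloc Hpi HG X0.
move=> T1; apply: fg.
have f1 : [set 1] (mk_derived Kf) by rewrite -T1.
by have -> : f = 1 by [have := congr1 val f1]; rewrite comm1g.
Qed.

Lemma derived_compressing : compressing_action loc (fun u : derived G => act (val u)).
Proof.
have HA := fg_action HG; have KG := commutator_subgroup_sub (ga_sub HA).
have valG (u : derived G) : G (val u) by exact: (KG _ (val_derived u)).
split.
- split=> //.
  + move=> x; exact: ga_act1 HA x.
  + by move=> u v x _ _; exact: (ga_actM HA).
  + by move=> u _ fix_u; apply: val_inj; exact: (ga_faithful HA (valG u)).
  + by move=> u x _; exact: (ga_germ HA).
- move=> A B C oA cB oC BA CA C0 AB.
  have [f [Kf sf fB]] := derived_compress Xbasis Xsep Xperf Hloc Hpi HG oA cB oC BA CA C0 AB.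
  by exists (mk_derived Kf).
- move=> u.
  have T0 : set0 <> [set: X] by move=> e; case: X0 => x; rewrite -e.
  have [f1 [f2 [A1 [A2 [e [K1 K2] [c1 _ n1 s1] [c2 _ n2 s2]]]]]] :=
    fragmentation Xbasis Xsep Xperf Hloc Hpi HG (commutator_subgroupP G)
      (@subset_refl _ _) KG (val_derived u) (conj open0 closed0) T0.
  exists (mk_derived K1), (mk_derived K2), A1, A2; split=> //.
  exact: val_inj.
- move=> t u et; have [f Kf tf] := transport_derived Hloc HG et (val_derived u).
  by exists (mk_derived Kf).
- by apply: derived_type_perfect; exact: (derived_perfect Xbasis Xsep Xperf Hloc Hpi HG X0).
- exact: (derived_type_simple (derived_simple Xbasis Xsep Xperf Hloc Hpi HG X0)).
Qed.

End DerivedAction.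

Theorem theorem5p2 (R : realType) (k : nat) (k_gt0 : (0 < k)%N) (L : kgraph k)
  (L_row_finite : row_finite L) (L_source_free : source_free L)
  (L_strongly_connected : strongly_connected L)
  (L_finite_vertices : finite_set [set: vertex L])
  (L_aperiodic : aperiodic L)
  (L_cantor : is_cantor_space R (infpath L))
  (* (A, s) is the unital C*-algebra O_L with its generators s_m *)
  (A : unital_cstar_algebra R) (s : mor L -> A)
  (A_universal : is_kgraph_algebra s) :
  ((forall N : set (unitary A), is_normal_subgroup (ht s) N ->
      N <> [set 1%g] -> commutator_subgroup (ht s) `<=` N) /\
   simple_group (derived (ht s))) /\
  (exists S : set (subset_space (derived (ht s))),
     is_stabilizer_urs (@ht'_act R k L A s) S /\
     forall T : set (subset_space (derived (ht s))),
       is_nontrivial_urs T <-> T = S).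
Proof.
have [[x _] compactX _ _ isolatedX] := L_cantor.
have X0 : [set: infpath L] !=set0 by exists x.
have [ck generated _] := A_universal.
have s0 v : (s (idm v) != 0)%R.
  exact: (generator_neq0 x v L_row_finite L_strongly_connected A_universal).
have full := ht_full_group ck generated L_row_finite L_finite_vertices L_aperiodic s0 compactX.
have basis := @path_clopen_basis k L; have sep := @path_clopen_separated k L.
have perf := path_perfect isolatedX.
have pinf := path_purely_infinite L_finite_vertices L_strongly_connected perf.
have germ := @prefix_germs k L.
split; first split.
- exact: (derived_sub_normal basis sep perf germ pinf full).
- exact: (derived_simple_group basis sep perf X0 germ pinf full).
have [z _ az] := L_aperiodic (start x).
apply: (stabilizer_urs_classification basis sep perf germ pinf
  (derived_compressing basis sep perf X0 germ pinf full) X0 (x0 := z)) => u uz.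
apply: (aperiodic_regular az) uz.
have K_ht := commutator_subgroup_sub (ga_sub (fg_action full)).
exact: (ga_germ (fg_action full) z (K_ht _ (val_derived u))).
Qed.
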